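(* Let $k$ be a field of characteristic $2$, let $P=\alpha_3u^3+\alpha_2u^2+\alpha_1u+\alpha_0\in k[u]$ be a glueing polynomial with $\alpha_0\neq 0$, and let $Y$ be the surface over $k$ defined in the context. Then the scheme $Y$ is locally of complete intersection.
   Context: The surface $Y$. Let $X=\mathbb{P}^2_k$ with affine charts $U=\operatorname{Spec}k[u,v]$, $U'=\operatorname{Spec}k[u^{-1},vu^{-1}]$, $U''=\operatorname{Spec}k[uv^{-1},v^{-1}]$. Let $A\subset X$ be the line given by $v=0$ on $U$ and by $vu^{-1}=0$ on $U'$, and let $B\subset X$ be its first order infinitesimal neighborhood (defined by the square of the ideal of $A$), so $B=\operatorname{Spec}k[u,\epsilon]\cup\operatorname{Spec}k[u^{-1},\epsilon u^{-1}]$ where $\epsilon$ is the class of $v$ and $\epsilon^2=0$. Let $C=\operatorname{Spec}k[u^2,u^3]\cup\operatorname{Spec}k[u^{-1}]$ be the rational cuspidal curve of arithmetic genus $1$. Let $\varphi:B\to C$ be the flat morphism of degree two given by $u^2\mapsto u^2$, $u^3\mapsto u^3+\epsilon P$, $u^{-1}\mapsto u^{-1}+\epsilon u^{-4}P$. Then $Y$ is the pushout of the closed embedding $B\subset X$ and $\varphi:B\to C$: it has the same underlying space as $X$, and $\mathcal{O}_Y\subset\mathcal{O}_X$ is the subsheaf of sections whose restriction to $B$ lies in $\mathcal{O}_C$ (embedded in $\mathcal{O}_B$ via $\varphi$). It is an integral projective surface, covered by the affine open subschemes $V=\operatorname{Spec}k[u^2,u^3+vP,v^2,v^2u,v^3,v^3u]$,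 $V'=\operatorname{Spec}k[u^{-2},u^{-1}+vu^{-4}P,v^2u^{-2},v^2u^{-3},v^3u^{-3},v^3u^{-4}]$ and $V''=\operatorname{Spec}k[uv^{-1},v^{-1}]$. A locally noetherian scheme $S$ is locally of complete intersection if for all $s\in S$ the completion of $\mathcal{O}_{S,s}$ is of the form $R/I$ with $R$ a regular local noetherian ring and $I\subset R$ an ideal generated by a regular sequence. *)

(* Defs.v *)
From HB Require Import structures.
From mathcomp Require Import all_boot all_order all_algebra.
From mathcomp Require Import ring_quotient ring.
From mathcomp Require Import boolp classical_sets functions.

Set Implicit Arguments.
Unset Strict Implicit.
Unset Printing Implicit Defensive.

Import GRing.Theory.
Local Open Scope classical_set_scope.
Local Open Scope ring_scope.

Section Ideals.
Variable R : comNzRingType.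

(* Ideals in the wide sense: unlike [idealr R], the unit ideal is allowed. *)
Definition is_ideal (I : set R) : Prop :=
  I 0 /\ forall a x y, I x -> I y -> I (a * x + y).

Definition ideal_gen (G : set R) : set R := smallest is_ideal G.

Fixpoint ideal_pow (I : set R) (n : nat) : set R :=
  if n is n'.+1 then ideal_gen [set x * y | x in I & y in ideal_pow I n']
  else setT.

Definition noetherian : Prop :=
  forall I : set R, is_ideal I -> exists s : seq R, I = ideal_gen [set` s].

(* [m] is proper (as an [idealr]) and its complement consists of units. *)
Definition local_with (m : idealr R) : Prop :=
  forall x : R, x \notin m -> exists y, x * y = 1.

Definition prime_chain (n : nat) (p : nat -> prime_idealr R) : Prop :=
  forall i, (i < n)%N ->
    {subset p i <= p i.+1} /\ exists2 x, x \in p i.+1 & x \notin p i.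

Definition krull_dim (d : nat) : Prop :=
  (exists p, prime_chain d p) /\ (forall n p, prime_chain n p -> (n <= d)%N).

Definition regular_local : Prop :=
  noetherian /\
  exists m : idealr R, local_with m /\
    exists s : seq R, [set` m] = ideal_gen [set` s] /\ krull_dim (size s).

Definition regular_sequence (s : seq R) : Prop :=
  (forall i, (i < size s)%N -> forall x : R,
     ideal_gen [set` take i s] (s`_i * x) -> ideal_gen [set` take i s] x)
  /\ ~ ideal_gen [set` s] 1.

End Ideals.

Section SubringType.
Variables (R : comNzRingType) (S : subringClosed R).

Definition subring_of := {x : R | x \in S}.
HB.instance Definition _ := SubChoice.on subring_of.
HB.instance Definition _ := [SubChoice_isSubComNzRing of subring_of by <:].

End SubringType.

(* The [m]-adic completion, i.e. the inverse limit of the rings [A / m^n],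
   presented as the ring of sequences [a] of [A] such that [a n] and [a n.+1]
   agree modulo [m^n], modulo those with [a n] in [m^n] for all [n]. *)
Section Completion.
Variables (A : comNzRingType) (m : idealr A).

Local Notation mpow n := (ideal_pow [set` m] n).

Definition coherent : {pred nat -> A} :=
  [pred a : nat -> A | `[< forall n, mpow n (a n.+1 - a n) >]].

Lemma is_ideal_pow n : is_ideal (mpow n).
Proof.
case: n => [|n] //=; split.
  by move=> J [[]].
move=> a x y Hx Hy J JG; have [[J0 JP] _] := JG.
by apply: JP; [apply: Hx | apply: Hy].
Qed.

Lemma ideal_pow1P x : mpow 1 x -> x \in m.
Proof.
move=> /(_ [set` m]); apply; split.
  split=> [|a u v] /=; first exact: rpred0.
  by move=> um vm; rewrite rpredD // idealMr.
by move=> _ [u um [v _ <-]] /=; rewrite mulrC idealMr.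
Qed.

Lemma coherent_subring_closed : subring_closed coherent.
Proof.
have P0 n : mpow n 0 by case: (is_ideal_pow n).
have PD n x y : mpow n x -> mpow n y -> mpow n (x + y).
  by case: (is_ideal_pow n) => _ h hx hy; rewrite -[x]mul1r; apply: h.
have PM n a x : mpow n x -> mpow n (a * x).
  by case: (is_ideal_pow n) => J0 h hx; rewrite -[_ * _]addr0; apply: h.
split.
- by apply/asboolP => n; rewrite subrr.
- move=> a b /asboolP ha /asboolP hb; apply/asboolP => n.
  rewrite -[(a - b) n.+1]/(a n.+1 - b n.+1) -[(a - b) n]/(a n - b n).
  rewrite (_ : _ - _ = (a n.+1 - a n) + (-1) * (b n.+1 - b n)).
    by apply: PD => //; apply: PM.
  ring.
- move=> a b /asboolP ha /asboolP hb; apply/asboolP => n.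
  rewrite -[(a * b) n.+1]/(a n.+1 * b n.+1) -[(a * b) n]/(a n * b n).
  rewrite (_ : _ - _ =
    a n.+1 * (b n.+1 - b n) + b n * (a n.+1 - a n)).
    by apply: PD; apply: PM.
  ring.
Qed.

HB.instance Definition _ :=
  GRing.isSubringClosed.Build (nat -> A) coherent coherent_subring_closed.

Definition coherent_ring : comNzRingType := subring_of coherent.

Definition coherent_null : {pred coherent_ring} :=
  [pred a : coherent_ring | `[< forall n, mpow n (val a n) >]].

Lemma coherent_null_idealr_closed : idealr_closed coherent_null.
Proof.
split.
- by apply/asboolP => n; case: (is_ideal_pow n).
- apply/negP => /asboolP /(_ 1%N) /ideal_pow1P.
  by rewrite [val 1 1%N]/(1 : A) idealr1.
- move=> a u v /asboolP hu /asboolP hv; apply/asboolP => n.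
  by case: (is_ideal_pow n) => _; apply.
Qed.

HB.instance Definition _ :=
  isIdealr.Build coherent_ring coherent_null coherent_null_idealr_closed.

Definition completion : comNzRingType := {ideal_quot coherent_null}.

End Completion.

(* The localization at a prime of a subring [A] of a field, again as a subring
   of that field. *)
Section Localization.
Variables (K : fieldType) (A : subringClosed K) (p : prime_idealr (subring_of A)).

Definition localization : {pred K} :=
  [pred x | `[< exists a b : subring_of A, b \notin p /\ x = val a / val b >]].

Lemma notin_prime_neq0 (b : subring_of A) : b \notin p -> val b != 0.
Proof. by apply: contra => /eqP b0; rewrite (_ : b = 0) ?rpred0 //; apply: val_inj. Qed.

Lemma localization_subring_closed : subring_closed localization.
Proof.
have NM (b d : subring_of A) : b \notin p -> d \notin p -> b * d \notin p.
  by move=> bp dp; rewrite prime_idealrM negb_or bp.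
split.
- apply/asboolP; exists 1, 1; split; last by rewrite divr1.
  by rewrite idealr1.
- move=> _ _ /asboolP[a [b [bp ->]]] /asboolP[c [d [dp ->]]].
  apply/asboolP; exists (a * d - c * b), (b * d); split; first exact: NM.
  by rewrite -mulNr addf_div ?notin_prime_neq0 //= mulNr.
- move=> _ _ /asboolP[a [b [bp ->]]] /asboolP[c [d [dp ->]]].
  apply/asboolP; exists (a * c), (b * d); split; first exact: NM.
  by rewrite mulf_div.
Qed.

HB.instance Definition _ :=
  GRing.isSubringClosed.Build K localization localization_subring_closed.

Definition local_ring : comNzRingType := subring_of localization.

Definition local_max : {pred local_ring} :=
  [pred x : local_ring | `[< exists a b : subring_of A,
     [/\ a \in p, b \notin p & val x = val a / val b] >]].

Lemma local_max_idealr_closed : idealr_closed local_max.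
Proof.
have NM (b d : subring_of A) : b \notin p -> d \notin p -> b * d \notin p.
  by move=> bp dp; rewrite prime_idealrM negb_or bp.
split.
- apply/asboolP; exists 0, 1; split; rewrite ?rpred0 ?idealr1 //=.
  by rewrite mul0r.
- apply/negP => /asboolP[a [b [ap bp /= e]]].
  have b0 := notin_prime_neq0 bp.
  have ba : b = a by apply: val_inj; rewrite -[LHS]mul1r [X in X * _]e divfK.
  by rewrite ba ap in bp.
- move=> z x y /asboolP[a [b [ap bp xE]]] /asboolP[c [d [cp dp yE]]].
  have /asboolP[e [f [fp zE]]] := valP z.
  apply/asboolP; exists (e * a * d + c * (f * b)), (f * b * d); split.
  + rewrite [e * a]mulrC [c * _]mulrC -mulrA [a * _]mulrC.
    by rewrite rpredD // idealMr.
  + by rewrite !NM.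
  + rewrite /= xE yE zE mulf_div addf_div ?notin_prime_neq0 ?NM //.
    by rewrite mulf_neq0 ?notin_prime_neq0.
Qed.

HB.instance Definition _ :=
  isIdealr.Build local_ring local_max local_max_idealr_closed.

End Localization.

Arguments local_max {K A} p _.

Definition complete_intersection_quotient (C : comNzRingType) : Prop :=
  exists (R : comNzRingType) (I : idealr R) (s : seq R),
    [/\ regular_local R, regular_sequence s, [set` I] = ideal_gen [set` s]
      & exists f : {rmorphism {ideal_quot I} -> C}, bijective f].

(* An integral scheme with function field [K] is given by an affine open
   covering, whose members [Spec (A i)] are recorded as subrings [A i] of [K];
   the common field [K] encodes the gluing. Its points are the primes of the
   [A i], and the stalk of the structure sheaf at a point is the localization. *)
Definition locally_noetherian (K : fieldType) (I : Type)
    (A : I -> subringClosed K) : Prop :=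
  forall i, noetherian (subring_of (A i)).

Definition locally_complete_intersection (K : fieldType) (I : Type)
    (A : I -> subringClosed K) : Prop :=
  locally_noetherian A /\
  forall i (p : prime_idealr (subring_of (A i))),
    complete_intersection_quotient (completion (local_max p)).

(* [X] is the projective plane with function field [k(u, v)], [A] is the line
   [v = 0], [B] its first order infinitesimal neighborhood, [C] the cuspidal
   curve [Spec k[u^2, u^3]] + [Spec k[u^-1]], and [phi : B -> C] is given by
     [u^2 |-> u^2],  [u^3 |-> u^3 + e P],  [u^-1 |-> u^-1 + e u^-4 P]
   with [e] the class of [v]; in characteristic 2 the formulas agree on
   overlaps. [Y] is the pushout of [B -> X] and [phi]: it has the space of [X],
   and its sections are those of [X] whose restriction to [B] comes from [C]. *)

Lemma mul_cubic_inv (F : fieldType) (x y c3 c2 c1 c0 : F) : x != 0 ->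
  y * x ^- 4 * (c3 * x ^+ 3 + c2 * x ^+ 2 + c1 * x + c0) =
  y * x^-1 * (c3 + c2 * x^-1 + c1 * x^-1 ^+ 2 + c0 * x^-1 ^+ 3).
Proof. by move=> x0; field. Qed.

Inductive chart_index := IndexV | IndexV' | IndexV''.

Section Surface.
Variable k : fieldType.

Definition ratfun : fieldType := {fraction {poly {poly k}}}.

Local Notation "x %:F" := (tofrac x).

Definition constK (c : k) : ratfun := c%:P%:P%:F.
Definition polyK (Q : {poly k}) : ratfun := Q%:P%:F.
Definition uK : ratfun := ('X%:P)%:F.
Definition vK : ratfun := 'X%:F.
Local Notation u := uK.
Local Notation v := vK.

Definition is_subalgebra (S : set ratfun) : Prop :=
  [/\ forall c, S (constK c), forall x y, S x -> S y -> S (x - y)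
    & forall x y, S x -> S y -> S (x * y)].

(* the k-subalgebra [k[s]] generated by [s] *)
Definition adjoin (s : seq ratfun) : set ratfun :=
  smallest is_subalgebra [set` s].

(* The sections of the pushout over an affine open of the plane: [OX] is the
   ring of sections of the structure sheaf of the plane, [b] is an equation of
   the line [A], so that restriction to [B] is reduction modulo [b ^+ 2], and
   [OC] is a subalgebra of [OX] whose reduction modulo [b ^+ 2] is the image
   under [phi] of the coordinate ring of the corresponding chart of [C]. *)
Definition pushout_ring (OX : set ratfun) (b : ratfun) (OC : set ratfun)
    : set ratfun :=
  [set f | OX f /\ exists2 g, OC g & exists2 h, OX h & f - g = b ^+ 2 * h].

Lemma is_subalgebra_adjoin s : is_subalgebra (adjoin s).
Proof.
split=> [c B [[Bc _ _] _] | x y Hx Hy B BG | x y Hx Hy B BG]; first exact: Bc.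
  by have [[_ BB _] _] := BG; apply: BB; [apply: Hx | apply: Hy].
by have [[_ _ BM] _] := BG; apply: BM; [apply: Hx | apply: Hy].
Qed.

Lemma adjoin_mem s x : x \in s -> adjoin s x.
Proof. by move=> xs B [_]; apply. Qed.

Lemma adjoin_sub s (S : set ratfun) :
  is_subalgebra S -> (forall x, x \in s -> S x) -> adjoin s `<=` S.
Proof. by move=> SS sS x; apply; split=> // y /= /sS. Qed.

Lemma subalgebraD S x y : is_subalgebra S -> S x -> S y -> S (x + y).
Proof.
move=> [S0 SB _] Sx Sy; have S00 : S 0 by rewrite -(subrr (constK 0)); apply: SB; apply: S0.
by rewrite -[y]opprK -[- y]add0r; do 2?[apply: (SB)].
Qed.

Lemma subalgebra1 S : is_subalgebra S -> S 1.
Proof. by move=> [/(_ 1)]; rewrite /constK !rmorph1. Qed.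

Lemma subalgebraX S x n : is_subalgebra S -> S x -> S (x ^+ n).
Proof.
move=> SS Sx; elim: n => [|n IHn]; first by rewrite expr0; apply: subalgebra1.
by rewrite exprS; case: SS => _ _; apply.
Qed.

Lemma is_subalgebra_pushout_ring OX b OC :
  is_subalgebra OX -> is_subalgebra OC -> OC `<=` OX ->
  is_subalgebra (pushout_ring OX b OC).
Proof.
move=> XS [C0 CB CM] CX; have [X0 XB XM] := XS.
have X00 : OX 0 by rewrite -(subrr (constK 0)); apply: XB.
split=> [c | x y [Xx [g Cg [h Xh e]]] [Xy [g' Cg' [h' Xh' e']]]
  | x y [Xx [g Cg [h Xh e]]] [Xy [g' Cg' [h' Xh' e']]]].
- by split=> //; exists (constK c) => //; exists 0; rewrite ?subrr ?mulr0.
- split; first exact: XB.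
  exists (g - g'); first exact: CB.
  exists (h - h'); first exact: XB.
  by rewrite mulrBr -e -e'; ring.
- split; first exact: XM.
  exists (g * g'); first exact: CM.
  exists (h * y + g * h').
    by apply: subalgebraD => //; apply: XM => //; apply: CX.
  by rewrite mulrDr mulrA -e mulrCA -e'; ring.
Qed.

Lemma subalgebra_subring_closed (S : set ratfun) :
  is_subalgebra S -> subring_closed [pred x | `[< S x >]].
Proof.
move=> SS; have [S0 SB SM] := SS.
split=> [|x y /asboolP Sx /asboolP Sy|x y /asboolP Sx /asboolP Sy];
  apply/asboolP; [exact: subalgebra1 | exact: SB | exact: SM].
Qed.

Variables a3 a2 a1 a0 : k.

Definition glueing_poly : {poly k} :=
  a3 *: 'X^3 + a2 *: 'X^2 + a1 *: 'X + a0%:P.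
Local Notation P := (polyK glueing_poly).

Lemma polyK_glueing : P =
  constK a3 * u ^+ 3 + constK a2 * u ^+ 2 + constK a1 * u + constK a0.
Proof.
by rewrite /polyK /glueing_poly -!mul_polyC !(rmorphD, rmorphM, rmorphXn).
Qed.

(* chart [U], where [C] is [Spec k[u^2, u^3]] *)
Definition sectionsV : set ratfun :=
  pushout_ring (adjoin [:: u; v]) v (adjoin [:: u ^+ 2; u ^+ 3 + v * P]).

(* chart [U'], where [C] is [Spec k[u^-1]] *)
Definition sectionsV' : set ratfun :=
  pushout_ring (adjoin [:: u^-1; v * u^-1]) (v * u^-1)
               (adjoin [:: u^-1 + v * u ^- 4 * P]).

(* chart [U''], which does not meet the line [A] *)
Definition sectionsV'' : set ratfun := adjoin [:: u * v^-1; v^-1].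

Definition chartV : {pred ratfun} := [pred x | `[< sectionsV x >]].
Definition chartV' : {pred ratfun} := [pred x | `[< sectionsV' x >]].
Definition chartV'' : {pred ratfun} := [pred x | `[< sectionsV'' x >]].

Lemma uK_neq0 : u != 0.
Proof. by rewrite /uK tofrac_eq0 polyC_eq0 polyX_eq0. Qed.

Lemma chartV_subring_closed : subring_closed chartV.
Proof.
apply/subalgebra_subring_closed/is_subalgebra_pushout_ring;
  try exact: is_subalgebra_adjoin.
set S := adjoin [:: u; v].
have SS : is_subalgebra S by apply: is_subalgebra_adjoin.
have [S0 _ SM] := SS.
have Su : S u by apply: adjoin_mem; rewrite !inE eqxx.
have Sv : S v by apply: adjoin_mem; rewrite !inE eqxx orbT.
apply: adjoin_sub => // x; rewrite !inE => /orP[] /eqP ->.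
  exact: (subalgebraX _ SS).
apply: (subalgebraD SS); first exact: (subalgebraX _ SS).
apply: (SM) => //; rewrite polyK_glueing.
by do ?[apply: (subalgebraD SS)]; rewrite //; apply: SM => //; apply: (subalgebraX _ SS).
Qed.

Lemma chartV'_subring_closed : subring_closed chartV'.
Proof.
apply/subalgebra_subring_closed/is_subalgebra_pushout_ring;
  try exact: is_subalgebra_adjoin.
set S := adjoin [:: u^-1; v * u^-1].
have SS : is_subalgebra S by apply: is_subalgebra_adjoin.
have [S0 _ SM] := SS.
have Su : S u^-1 by apply: adjoin_mem; rewrite !inE eqxx.
have Sv : S (v * u^-1) by apply: adjoin_mem; rewrite !inE eqxx orbT.
apply: adjoin_sub => // x; rewrite !inE => /eqP ->.
apply: (subalgebraD SS) => //.
rewrite (_ : _ * _ = (v * u^-1) * (constK a3 + constK a2 * u^-1 +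
  constK a1 * u^-1 ^+ 2 + constK a0 * u^-1 ^+ 3)).
  apply: (SM) => //; do ?[apply: (subalgebraD SS)]; rewrite //;
    by apply: SM => //; apply: (subalgebraX _ SS).
by rewrite polyK_glueing; apply: mul_cubic_inv; exact: uK_neq0.
Qed.

Lemma chartV''_subring_closed : subring_closed chartV''.
Proof. exact/subalgebra_subring_closed/is_subalgebra_adjoin. Qed.

HB.instance Definition _ :=
  GRing.isSubringClosed.Build ratfun chartV chartV_subring_closed.
HB.instance Definition _ :=
  GRing.isSubringClosed.Build ratfun chartV' chartV'_subring_closed.
HB.instance Definition _ :=
  GRing.isSubringClosed.Build ratfun chartV'' chartV''_subring_closed.

Definition surfaceY (i : chart_index) : subringClosed ratfun :=
  match i with
  | IndexV => chartV
  | IndexV' => chartV'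
  | IndexV'' => chartV''
  end.

End Surface.

(* Main.v *)
(* Every completed local ring of [Y] is a hypersurface.

Off the line [A] the surface is the projective plane, whose local rings are
regular. Near [A], write [x], [z] for the affine coordinates, [z = 0] being the
line. Squares of sections are polynomials in [x ^ 2] and [z ^ 2] because the
characteristic is [2]. With [w] the lift of the generator of [O_C] involving [P],
the ring [k[x ^ 2, z ^ 2, w]] is regular along the line: [x ^ 2] or [z ^ 2] can be
solved for in terms of [w] and the other one, the assumption [a0 <> 0] being used
at the cusp. If [B] is its localization, the local ring of [Y] is [B + B y] with
[y ^ 2 = b] in the square of the maximal ideal of [B]: take [y = z ^ 3] at
infinity and [y = z ^ 2 * (x + a2 * z)] over the cusp. So it is [B[y] / (y ^ 2 - b)],
and its completion is the quotient of that of [B[y]] by [y ^ 2 - b].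

The completion of a ring with an adically regular system of parameters is
handled one parameter at a time: if [R] is complete for a nonzerodivisor [x] and
[R / x] is regular, then [R] is regular, the bound on the dimension being Krull's
principal ideal theorem. *)

From HB Require Import structures.
Require Import Defs.
From mathcomp Require Import all_boot all_order all_algebra.
From mathcomp Require Import ring_quotient ring zify.
From mathcomp Require Import boolp classical_sets functions.

Set Implicit Arguments.
Unset Strict Implicit.
Unset Printing Implicit Defensive.

Import GRing.Theory.
Local Open Scope classical_set_scope.
Local Open Scope ring_scope.
Local Open Scope quotient_scope.

(** * Ideals *)

(** Two obstacles shape the argument. The kernel of a map of completions is a priori only the
    closure of the ideal of the equation. Instead of Artin-Rees, a shift of orders is checked by
    hand: [F * r] in [M^(n+e)] forces [r] in [M^n]. It holds with [e = 1] for a parameter and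
    [e = 2] for ['X^2 - b], which is why [b] has to lie in the square of the maximal ideal.

    The other is that [B + B y] is the whole stalk. As [k[x, z]] is spanned over [k[x^2, z^2]] by
    [1, x, z, xz], the stalk is spanned over [B] by [1], [z^2 x], [z^3] and [z^2 xz]. Splitting the
    cubic in [w] into its even and odd parts in [x] turns [z^2 w] and [w y] into linear relations
    among these elements and [y]. They can be solved because the determinant is, up to powers of
    [a0], congruent to [1] or [a0^2] modulo the maximal ideal. The term [a2 z] of [y] makes the
    coefficient of [z^3] over the cusp the constant [a0]. Freeness comes from a derivation, the
    Jacobian with [w]: it kills [x^2], [z^2] and [w], but not [y]. *)

Section IdealBasics.
Variable R : comNzRingType.
Implicit Types (I J : set R) (s : seq R).

Lemma is_idealD I x y : is_ideal I -> I x -> I y -> I (x + y).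
Proof. by move=> [_ h] Ix Iy; rewrite -[x]mul1r; apply: h. Qed.

Lemma is_idealM I a x : is_ideal I -> I x -> I (a * x).
Proof. by move=> [I0 h] Ix; rewrite -[a * x]addr0; apply: h. Qed.

Lemma is_idealMl I a x : is_ideal I -> I x -> I (x * a).
Proof. by rewrite mulrC; apply: is_idealM. Qed.

Lemma is_idealN I x : is_ideal I -> I x -> I (- x).
Proof. by move=> II Ix; rewrite -mulN1r; apply: is_idealM. Qed.

Lemma is_idealB I x y : is_ideal I -> I x -> I y -> I (x - y).
Proof. by move=> II Ix Iy; apply: is_idealD => //; apply: is_idealN. Qed.

Lemma is_idealBl I x y : is_ideal I -> I y -> I (x - y) -> I x.
Proof. by move=> II Iy Ixy; rewrite -(subrK y x); apply: is_idealD. Qed.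

Lemma is_ideal_sum I (n : nat) (F : 'I_n -> R) :
  is_ideal I -> (forall i, I (F i)) -> I (\sum_(i < n) F i).
Proof.
move=> II IF; elim/big_ind: _ => // [|x y]; first by case: II.
exact: is_idealD.
Qed.

Lemma is_ideal_gen (G : set R) : is_ideal (ideal_gen G).
Proof.
split=> [J [[]] //|a x y Hx Hy J JG]; have [[_ h] _] := JG.
by apply: h; [apply: Hx | apply: Hy].
Qed.

Lemma ideal_gen_mem (G : set R) x : G x -> ideal_gen G x.
Proof. by move=> Gx J [_]; apply. Qed.

Lemma ideal_gen_sub (G : set R) I :
  is_ideal I -> (forall x, G x -> I x) -> forall x, ideal_gen G x -> I x.
Proof. by move=> II GI x; apply; split. Qed.

Lemma is_ideal_multiples a : is_ideal [set x : R | exists b, x = a * b].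
Proof.
split=> [|c _ _ [x ->] [y ->]]; first by exists 0; rewrite mulr0.
by exists (c * x + y); ring.
Qed.

Lemma ideal_gen_nilP x : ideal_gen [set` [::]] x <-> x = 0 :> R.
Proof.
split=> [|->]; last by case: (is_ideal_gen [set` ([::] : seq R)]).
apply: (@ideal_gen_sub _ [set y | y = 0]) => //; split=> // a _ _ -> ->.
by rewrite mulr0 addr0.
Qed.

Lemma ideal_gen_seqP s x :
  ideal_gen [set` s] x <-> exists c : nat -> R, x = \sum_(i < size s) c i * s`_i.
Proof.
split.
  apply: (@ideal_gen_sub _ [set y | exists c : nat -> R,
    y = \sum_(i < size s) c i * s`_i]) => [|{}x /= xs].
    split=> [|a _ _ [b ->] [c ->]].
      by exists (fun=> 0); rewrite big1 // => i _; rewrite mul0r.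
    exists (fun i => a * b i + c i); rewrite mulr_sumr -big_split /=.
    by apply: eq_bigr => i _; ring.
  exists (fun i => (i == index x s)%:R).
  have ix : (index x s < size s)%N by rewrite index_mem.
  rewrite (bigD1 (Ordinal ix)) //= eqxx mul1r nth_index // big1 ?addr0 // => i.
  by rewrite -val_eqE /= => /negPf ->; rewrite mul0r.
move=> [c ->]; apply: (is_ideal_sum (is_ideal_gen _)) => i.
by apply: (is_idealM _ (is_ideal_gen _)); apply: ideal_gen_mem => /=; rewrite mem_nth.
Qed.

Lemma ideal_gen1P (a x : R) : ideal_gen [set` [:: a]] x <-> exists b, x = a * b.
Proof.
rewrite ideal_gen_seqP /=; split=> [[c ->]|[b ->]].
  by exists (c 0%N); rewrite big_ord1 mulrC.
by exists (fun=> b); rewrite big_ord1 mulrC.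
Qed.

Lemma ideal_gen_consP (a : R) s x :
  ideal_gen [set` a :: s] x <-> exists b, ideal_gen [set` s] (x - a * b).
Proof.
rewrite ideal_gen_seqP /=; split=> [[c ->]|[b /ideal_gen_seqP[c e]]].
  exists (c 0%N); apply/ideal_gen_seqP; exists (fun i => c i.+1).
  by rewrite big_ord_recl /= mulrC [a * _]mulrC addrC addKr.
exists (fun i => if i is i'.+1 then c i' else b).
by rewrite big_ord_recl /= -e; ring.
Qed.

Lemma noetherian_acc : noetherian R -> forall I : nat -> set R,
  (forall n, is_ideal (I n)) -> (forall n, I n `<=` I n.+1) ->
  exists N, forall n, I n `<=` I N.
Proof.
move=> noeth I II Imono.
have le m n : (m <= n)%N -> I m `<=` I n.
  move=> /subnK <-; elim: (n - m)%N => [|j IH] x Ix //.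
  by rewrite addSn; apply/Imono/IH.
pose U := [set x | exists n, I n x].
have UI : is_ideal U.
  split=> [|a x y [m Ix] [n Iy]]; first by exists 0%N; case: (II 0%N).
  exists (maxn m n); case: (II (maxn m n)) => _; apply.
    by apply: le Ix; rewrite leq_maxl.
  by apply: le Iy; rewrite leq_maxr.
have [s Us] := noeth _ UI.
have sU x : x \in s -> U x by move=> xs; rewrite Us; apply: ideal_gen_mem.
have [N sN] : exists N, forall x, x \in s -> I N x.
  elim: {Us} s sU => [|a s IH] sU; first by exists 0%N.
  have [N sN] : exists N, forall x, x \in s -> I N x.
    by apply: IH => x xs; apply: sU; rewrite inE xs orbT.
  have [n an] : U a by apply: sU; rewrite inE eqxx.
  exists (maxn N n) => x; rewrite inE => /orP[/eqP ->|/sN Ix].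
    by apply: le an; rewrite leq_maxr.
  by apply: le Ix; rewrite leq_maxl.
exists N => n x Ix; have : U x by exists n.
by rewrite Us; apply: (@ideal_gen_sub _ (I N)).
Qed.

Lemma noetherian_max : noetherian R -> forall Phi : set (set R),
  (forall I, Phi I -> is_ideal I) -> forall I0, Phi I0 ->
  exists I, [/\ Phi I, I0 `<=` I & forall J, Phi J -> I `<=` J -> J `<=` I].
Proof.
move=> noeth Phi PhiI I0 PI0; apply: contrapT => nomax.
have step (I : {I | Phi I /\ I0 `<=` I}) :
    exists J : {I | Phi I /\ I0 `<=` I}, sval I `<=` sval J /\ ~ (sval J `<=` sval I).
  case: I => I [PI sI]; apply: contrapT => noJ; apply: nomax; exists I; split=> // J PJ IJ.
  apply: contrapT => nJ; apply: noJ.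
  by exists (exist _ J (conj PJ (subset_trans sI IJ))).
have [f Hf] := choice step.
pose I n := sval (iter n f (exist _ I0 (conj PI0 (@subset_refl _ I0)))).
have [n|n x|N hN] := @noetherian_acc noeth I.
- by rewrite /I; case: (iter _ _ _) => /= J [PJ _]; apply: PhiI.
- by rewrite {2}/I /=; case: (Hf (iter n f (exist _ I0 (conj PI0 (@subset_refl _ I0))))) => h _; apply: h.
case: (Hf (iter N f (exist _ I0 (conj PI0 (@subset_refl _ I0))))) => _; apply.
exact: (hN N.+1).
Qed.

Definition is_prime (p : set R) : Prop :=
  [/\ is_ideal p, ~ p 1 & forall a b, p (a * b) -> p a \/ p b].

(** Connects ideals given as propositional sets with the bundled boolean ones, which are proper by
    definition; the boolean predicate comes from classical logic. *)
Lemma ex_idealr I : is_ideal I -> ~ I 1 -> exists M : idealr R, [set` M] = I.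
Proof.
move=> II I1; pose S := [pred x | `[< I x >]].
have Scl : idealr_closed S.
  split; first by apply/asboolP; case: II.
    by apply/negP => /asboolP.
  by move=> a x y /asboolP Ix /asboolP Iy; apply/asboolP; case: II => _; apply.
pose M := HB.pack_for (idealr R) (S : R -> bool) (isIdealr.Build R S Scl).
by exists M; apply/seteqP; split=> x /= /asboolP.
Qed.

Lemma ex_prime_idealr p : is_prime p -> exists M : prime_idealr R, [set` M] = p.
Proof.
move=> [II I1 pI]; pose S := [pred x | `[< p x >]].
have Scl : idealr_closed S.
  split; first by apply/asboolP; case: II.
    by apply/negP => /asboolP.
  by move=> a x y /asboolP Ix /asboolP Iy; apply/asboolP; case: II => _; apply.
have Sp : prime_idealr_closed S.
  by move=> a b /asboolP/pI[] h; apply/orP; [left|right]; apply/asboolP.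
pose M := HB.pack_for (prime_idealr R) (S : R -> bool) (isIdealr.Build R S Scl)
  (isPrimeIdealrClosed.Build R S Sp).
by exists M; apply/seteqP; split=> x /= /asboolP.
Qed.

Lemma is_ideal_idealr (M : idealr R) : is_ideal [set` M].
Proof.
by split=> [|a x y /= xM yM]; [exact: rpred0 | rewrite rpredD // idealMr].
Qed.

Lemma is_prime_prime_idealr (p : prime_idealr R) : is_prime [set` p].
Proof.
split; first exact: is_ideal_idealr.
  by rewrite /= idealr1.
by move=> a b /=; rewrite prime_idealrM => /orP[]; [left|right].
Qed.

Lemma idealr_quotP (I : idealr R) (x : R) :
  (\pi_{ideal_quot I} x = 0 :> {ideal_quot I}) <-> x \in I.
Proof.
rewrite -[0](rmorph0 (\pi_{ideal_quot I})).
split=> [/eqP|xI]; first by rewrite -Quotient.idealrBE subr0.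
by apply/eqP; rewrite -Quotient.idealrBE subr0.
Qed.

End IdealBasics.

(** Turns a function obtained by choice, whose laws are known only inside a proof, into a ring
    morphism. *)
Lemma ex_rmorphism (A B : comNzRingType) (f : A -> B) :
  f 1 = 1 -> {morph f : x y / x + y} -> {morph f : x y / x * y} ->
  exists g : {rmorphism A -> B}, g =1 f.
Proof.
move=> f1 fD fM.
have f0 : f 0 = 0 by apply: (addrI (f 0)); rewrite -fD !addr0.
have fZ : zmod_morphism f.
  move=> x y; rewrite fD; congr (_ + _).
  by apply: (addrI (f y)); rewrite -fD !subrr f0.
have fm : monoid_morphism f by split.
pose g := HB.pack_for {rmorphism A -> B} f (GRing.isZmodMorphism.Build A B f fZ)
  (GRing.isMonoidMorphism.Build A B f fm).
by exists g.
Qed.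

Lemma ex_rmorphism_quot (A B : comNzRingType) (I : idealr A) (f : {rmorphism A -> B}) :
  (forall x, x \in I -> f x = 0) ->
  exists g : {rmorphism {ideal_quot I} -> B}, forall x, g (\pi_{ideal_quot I} x) = f x.
Proof.
move=> fI; pose g (q : {ideal_quot I}) := f (repr q).
have gpi x : g (\pi_{ideal_quot I} x) = f x.
  apply/eqP; rewrite -subr_eq0 -rmorphB; apply/eqP/fI.
  by rewrite Quotient.idealrBE reprK.
have [||| h hE] := @ex_rmorphism _ _ g; last by exists h => x; rewrite hE.
- by rewrite -(rmorph1 (\pi_{ideal_quot I})) gpi rmorph1.
- by move=> x y; rewrite -[x]reprK -[y]reprK -rmorphD !gpi rmorphD.
- by move=> x y; rewrite -[x]reprK -[y]reprK -rmorphM !gpi rmorphM.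
Qed.

Lemma ex_quotient (R : comNzRingType) (I : set R) : is_ideal I -> ~ I 1 ->
  exists (R' : comNzRingType) (f : {rmorphism R -> R'}),
    (forall y, exists x, f x = y) /\ (forall x, f x = 0 <-> I x).
Proof.
move=> II I1; have [M <-] := ex_idealr II I1.
exists {ideal_quot M}, (\pi_{ideal_quot M}); split=> [y|x].
  by exists (repr y); exact: reprK.
exact: idealr_quotP.
Qed.

Section IdealPowers.
Variables (O : comNzRingType) (M : idealr O).
Local Notation mpow n := (ideal_pow [set` M] n).

Lemma ideal_powS_mul n x y : x \in M -> mpow n y -> mpow n.+1 (x * y).
Proof. by move=> xM yM; apply: ideal_gen_mem; exists x => //; exists y. Qed.

Lemma ideal_powS_sub n (J : set O) : is_ideal J ->
  (forall x y, x \in M -> mpow n y -> J (x * y)) -> forall x, mpow n.+1 x -> J x.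
Proof.
move=> JI h; apply: ideal_gen_sub => // _ [x xM [y yM <-]]; exact: h.
Qed.

Lemma ideal_powM m n x y : mpow m x -> mpow n y -> mpow (m + n) (x * y).
Proof.
elim: m x y => [|m IH] x y /= xm yn.
  by apply: is_idealM => //; apply: is_ideal_pow.
have hI : is_ideal [set x | mpow (m + n).+1 (x * y)].
  have [h0 h] := is_ideal_pow M (m + n).+1.
  split=> [|a u v /= hu hv] /=; first by rewrite mul0r.
  by rewrite mulrDl -mulrA; apply: h.
apply: (ideal_gen_sub hI) x xm => _ [u uM [v vm <-]] /=.
by rewrite -mulrA; apply: ideal_powS_mul => //; apply: IH.
Qed.

Lemma ideal_powSW n x : mpow n.+1 x -> mpow n x.
Proof.
apply: (@ideal_powS_sub _ (mpow n)); first exact: is_ideal_pow.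
by move=> u v _; apply: is_idealM; apply: is_ideal_pow.
Qed.

Lemma ideal_pow_le m n x : (m <= n)%N -> mpow n x -> mpow m x.
Proof.
move=> /subnK <-; elim: (n - m)%N => // j IH.
by rewrite addSn => /ideal_powSW.
Qed.

Lemma ideal_pow1E x : mpow 1 x <-> x \in M.
Proof.
split; first exact: ideal_pow1P.
by move=> xM; rewrite -[x]mulr1; apply: ideal_powS_mul.
Qed.

Lemma ideal_powX n x : x \in M -> mpow n (x ^+ n).
Proof.
by move=> xM; elim: n => // n IH; rewrite exprS; apply: ideal_powS_mul.
Qed.

End IdealPowers.

(** * Adic completions *)

Section CompletionBasics.
Variables (O : comNzRingType) (M : idealr O).
Local Notation mpow n := (ideal_pow [set` M] n).
Implicit Types (c d : completion M) (o : O).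

Definition approx c n : O := val (repr c) n.

(** Congruence of [c] and [o] modulo the [n]-th power. The representative behind [approx] is
    arbitrary, so elements of the completion are compared only through this relation. *)
Definition apx c n o : Prop := mpow n (approx c n - o).

Lemma apx_approx c n : apx c n (approx c n).
Proof. by rewrite /apx subrr; case: (is_ideal_pow M n). Qed.

Lemma apx_pi (a : coherent_ring M) n : apx (\pi_(completion M) a) n (val a n).
Proof.
rewrite /apx /approx.
have : a - repr (\pi_(completion M) a) \in @coherent_null _ M.
  by rewrite Quotient.idealrBE reprK.
move/asboolP => /(_ n) h; rewrite -[X in mpow n X]opprB.
by apply: is_idealN => //; apply: is_ideal_pow.
Qed.

Lemma apx_trans c n o o' : apx c n o -> mpow n (o - o') -> apx c n o'.
Proof.
move=> h h'; rewrite /apx (_ : _ - o' = (approx c n - o) + (o - o')).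
  by apply: is_idealD => //; apply: is_ideal_pow.
by ring.
Qed.

Lemma apx_uniq c n o o' : apx c n o -> apx c n o' -> mpow n (o - o').
Proof.
move=> h h'; rewrite (_ : o - o' = (approx c n - o') - (approx c n - o)).
  by apply: is_idealB => //; apply: is_ideal_pow.
by ring.
Qed.

Lemma apx_coherent c m n o : (m <= n)%N -> apx c n o -> apx c m o.
Proof.
move=> mn h; rewrite /apx (_ : _ - o = (approx c m - approx c n) + (approx c n - o)); last by ring.
apply: is_idealD; first exact: is_ideal_pow; last exact: ideal_pow_le h.
have /asboolP coh := valP (repr c).
rewrite -opprB; apply: is_idealN; first exact: is_ideal_pow.
move: mn => /subnK <-; elim: (n - m)%N => [|j IH].
  by rewrite subrr; case: (is_ideal_pow M m).
rewrite addSn /approx (_ : _ - _ = (val (repr c) (j + m).+1 - val (repr c) (j + m)%N)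
  + (val (repr c) (j + m)%N - val (repr c) m)); last by ring.
apply: is_idealD => //; first exact: is_ideal_pow.
by apply: ideal_pow_le (coh _); rewrite leq_addl.
Qed.

Lemma apx_reprE (a : coherent_ring M) c n :
  c = \pi_(completion M) a -> apx c n (val a n).
Proof. by move->; apply: apx_pi. Qed.

Lemma apxD c d n o o' : apx c n o -> apx d n o' -> apx (c + d) n (o + o').
Proof.
move=> hc hd; apply: apx_trans (apx_reprE n (a := repr c + repr d) _) _.
  by rewrite rmorphD /= !reprK.
rewrite -[val _ n]/(approx c n + approx d n).
rewrite (_ : _ - _ = (approx c n - o) + (approx d n - o')); last by ring.
by apply: is_idealD => //; apply: is_ideal_pow.
Qed.

Lemma apxM c d n o o' : apx c n o -> apx d n o' -> apx (c * d) n (o * o').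
Proof.
move=> hc hd; apply: apx_trans (apx_reprE n (a := repr c * repr d) _) _.
  by rewrite rmorphM /= !reprK.
rewrite -[val _ n]/(approx c n * approx d n).
rewrite (_ : _ - _ = approx d n * (approx c n - o) + o * (approx d n - o')); last by ring.
by apply: is_idealD; [|apply: is_idealM..] => //; apply: is_ideal_pow.
Qed.

Lemma apxN c n o : apx c n o -> apx (- c) n (- o).
Proof.
move=> hc; apply: apx_trans (apx_reprE n (a := - repr c) _) _.
  by rewrite rmorphN /= !reprK.
rewrite -[val _ n]/(- approx c n) -opprD.
by apply: is_idealN => //; apply: is_ideal_pow.
Qed.

Lemma apxB c d n o o' : apx c n o -> apx d n o' -> apx (c - d) n (o - o').
Proof. by move=> hc hd; apply: apxD => //; apply: apxN. Qed.

Lemma apx1 n : apx 1 n 1.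
Proof. by apply: (apx_reprE (a := 1)); rewrite rmorph1. Qed.

Lemma apx0 n : apx 0 n 0.
Proof. by apply: (apx_reprE (a := 0)); rewrite rmorph0. Qed.

Lemma apx_eq0 c : (forall n, apx c n 0) -> c = 0.
Proof.
move=> h; rewrite -[c]reprK; apply/idealr_quotP/asboolP => n.
by have := h n; rewrite /apx subr0.
Qed.

Lemma apx_eq c d (o : nat -> O) :
  (forall n, apx c n (o n)) -> (forall n, apx d n (o n)) -> c = d.
Proof.
move=> hc hd; apply/subr0_eq/apx_eq0 => n.
by rewrite -(subrr (o n)); apply: apxB.
Qed.

Lemma ex_completion (a : nat -> O) : (forall n, mpow n (a n.+1 - a n)) ->
  exists c, forall n, apx c n (a n).
Proof.
move=> ha; have Ha : a \in coherent M by apply/asboolP.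
pose a' : coherent_ring M := exist _ a Ha.
by exists (\pi_(completion M) a') => n; apply: (apx_pi a').
Qed.

Lemma ex_completion_const o : exists c, forall n, apx c n o.
Proof.
by apply: (ex_completion (a := fun=> o)) => n; rewrite subrr; case: (is_ideal_pow M n).
Qed.

End CompletionBasics.

Section CompletionMap.
Variables (O O' : comNzRingType) (M : idealr O) (M' : idealr O').
Variable pi : {rmorphism O -> O'}.
Local Notation mpow n := (ideal_pow [set` M] n).
Local Notation mpow' n := (ideal_pow [set` M'] n).

Lemma ideal_pow_map : (forall a, a \in M -> pi a \in M') ->
  forall n r, mpow n r -> mpow' n (pi r).
Proof.
move=> piM; elim=> [//|n IH]; apply: (@ideal_powS_sub _ M n (fun r => mpow' n.+1 (pi r))).
  have [h0 h] := is_ideal_pow M' n.+1.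
  by split=> [|a x y hx hy]; rewrite ?rmorph0 // rmorphD rmorphM; apply: h.
move=> x y xM yM; rewrite rmorphM; apply: ideal_powS_mul; first exact: piM.
exact: IH.
Qed.

Lemma ideal_pow_lift : (forall y, exists x, pi x = y) ->
  (forall a, pi a \in M' -> a \in M) ->
  forall n r', mpow' n r' -> exists2 r, mpow n r & pi r = r'.
Proof.
move=> pisurj piM; elim=> [r' _|n IH]; first by have [r <-] := pisurj r'; exists r.
apply: (@ideal_powS_sub _ M' n (fun r' => exists2 r, mpow n.+1 r & pi r = r')).
  have [h0 h] := is_ideal_pow M n.+1.
  split=> [|a _ _ [x hx <-] [y hy <-]]; first by exists 0; rewrite ?rmorph0.
  have [b <-] := pisurj a.
  by exists (b * x + y); rewrite ?rmorphD ?rmorphM //; apply: h.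
move=> x' y' x'M /IH[y hy <-]; have [x xE] := pisurj x'; subst x'.
by exists (x * y); rewrite ?rmorphM //; apply: ideal_powS_mul => //; apply: piM.
Qed.

Lemma ex_completion_map : (forall a, a \in M -> pi a \in M') ->
  exists Pi : {rmorphism completion M -> completion M'},
    forall c n o, apx c n o -> apx (Pi c) n (pi o).
Proof.
move=> piM; have powmap := ideal_pow_map piM.
have ex (c : completion M) : exists c' : completion M',
    forall n o, apx c n o -> apx c' n (pi o).
  have [n|c' hc'] := @ex_completion _ M' (fun n => pi (approx c n)).
    rewrite -rmorphB; apply: powmap.
    have hc : apx c n (approx c n.+1).
      exact: apx_coherent (leqnSn n) (apx_approx c n.+1).
    by have := apx_uniq hc (apx_approx c n).
  exists c' => n o hc; apply: apx_trans (hc' n) _.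
  by rewrite -rmorphB; apply: powmap.
have [f hf] := choice ex.
have [||| g gE] := @ex_rmorphism _ _ f; last by exists g => c n o; rewrite gE; apply: hf.
- apply: (@apx_eq _ M' _ _ (fun=> 1)) => n; last exact: apx1.
  by rewrite -(rmorph1 pi); apply/hf/apx1.
- move=> c d; apply: (@apx_eq _ M' _ _ (fun n => pi (approx c n + approx d n))) => n.
    by apply/hf/apxD; apply: apx_approx.
  by rewrite rmorphD; apply: apxD; apply/hf/apx_approx.
- move=> c d; apply: (@apx_eq _ M' _ _ (fun n => pi (approx c n * approx d n))) => n.
    by apply/hf/apxM; apply: apx_approx.
  by rewrite rmorphM; apply: apxM; apply/hf/apx_approx.
Qed.

(* [F] behaves like an element of order at most [e] for the [M]-adic filtration:
   this makes the ideal generated by [F] closed in the completion. *)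
Lemma completion_quot (F : O) (e : nat) :
  (forall y, exists x, pi x = y) ->
  (forall a, pi a = 0 <-> exists b, a = F * b) ->
  (forall a, a \in M <-> pi a \in M') ->
  (forall n r, mpow (n + e) (F * r) -> mpow n r) ->
  exists (Pi : {rmorphism completion M -> completion M'}) (Fhat : completion M),
    [/\ forall c n o, apx c n o -> apx (Pi c) n (pi o),
        forall n, apx Fhat n F,
        forall y, exists x, Pi x = y,
        forall a, Pi a = 0 <-> exists b, a = Fhat * b
      & forall a, Fhat * a = 0 -> a = 0].
Proof.
move=> pisurj piker piM hF.
have piM1 a : a \in M -> pi a \in M' by move/piM.
have piM2 a : pi a \in M' -> a \in M by move/piM.
have lift := ideal_pow_lift pisurj piM2.
have powI n := is_ideal_pow M n.
have [Pi hPi] := ex_completion_map piM1.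
have [Fhat hFhat] := ex_completion_const M F.
exists Pi, Fhat; split=> // [c'|a|a Fa0].
(* Separate lifts of the terms would not be coherent; the successive differences are lifted inside
   [mpow n] and summed. *)
- have hdelta n : exists d, mpow n d /\ pi d = approx c' n.+1 - approx c' n.
    have hc : apx c' n (approx c' n.+1).
      exact: apx_coherent (leqnSn n) (apx_approx c' n.+1).
    have /lift[r hr hr'] := apx_uniq hc (apx_approx c' n).
    by exists r.
  have [d hd] := choice hdelta.
  have [o0 ho0] := pisurj (approx c' 0).
  pose o n := o0 + \sum_(i < n) d i.
  have [n|c hc] := @ex_completion _ M o.
    by rewrite /o big_ord_recr /= (_ : _ - _ = d n); [case: (hd n)|ring].
  exists c; apply: (@apx_eq _ M' _ _ (approx c')) => n; last exact: apx_approx.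
  rewrite (_ : approx c' n = pi (o n)); first exact: hPi.
  rewrite /o rmorphD rmorph_sum /= ho0.
  elim: n => [|n IH]; first by rewrite big_ord0 addr0.
  rewrite big_ord_recr /= addrA -IH (proj2 (hd n)); ring.
- split=> [Pa0|[b ->]]; last first.
    apply: apx_eq0 => n; have := hPi _ n _ (apxM (hFhat n) (apx_approx b n)).
    have -> : pi (F * approx b n) = 0 by apply/piker; exists (approx b n).
    by [].
  have hr n : exists r, mpow n (approx a n - F * r).
    have := hPi _ n _ (apx_approx a n).
    rewrite Pa0 => /(apx_uniq (apx0 M' n)); rewrite sub0r -rmorphN => /lift[m hm].
    move/eqP; rewrite -subr_eq0 -rmorphB => /eqP/piker[b hb].
    exists b; rewrite -hb (_ : _ - _ = - m); last by ring.
    exact: is_idealN.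
  have [r Hr] := choice hr.
  (* Cancelling [F] costs [e] orders, so the [n]-th term of the quotient is read off at level
     [n + e]. *)
  have [n|rho hrho] := @ex_completion _ M (fun n => r (n + e)%N).
    apply: hF; rewrite mulrBr.
    have hn : apx a (n + e) (approx a (n.+1 + e)).
      by apply: apx_coherent (apx_approx a _); rewrite leq_add2r.
    have := apx_uniq hn (apx_approx a (n + e)); set A := approx a _; set B := approx a _ => hAB.
    rewrite (_ : _ - _ = (A - B) - (A - F * r (n.+1 + e)%N) + (B - F * r (n + e)%N)); last by ring.
    apply: is_idealD => //; apply: is_idealB => //.
    by apply: ideal_pow_le (Hr (n.+1 + e)%N); rewrite leq_add2r.
  exists rho; apply: (@apx_eq _ M _ _ (fun n => F * r (n + e)%N)) => n; last exact: apxM.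
  apply: (@apx_coherent _ _ _ n (n + e)); first exact: leq_addr.
  exact: apx_trans (apx_approx _ _) (Hr _).
- apply: apx_eq0 => n.
  have := apxM (hFhat (n + e)%N) (apx_approx a (n + e)%N); rewrite Fa0 => h.
  have := apx_uniq h (apx0 M _); rewrite subr0 => /hF h'.
  apply: apx_trans (apx_coherent _ (apx_approx a (n + e)%N)) _; first exact: leq_addr.
  by rewrite subr0.
Qed.

End CompletionMap.

(* [M] is generated by [x_1, ..., x_d] and [O / M] is a field; in the quotient of
   [O] by the previous ones, each [x_i] raises the [M]-adic order by exactly one. *)
Fixpoint regular_adic d : forall O : comNzRingType, idealr O -> Prop :=
  if d isn't d'.+1 then fun O M => local_with M /\ forall x, x \in M -> x = 0
  else fun O M => exists (x : O) (O' : comNzRingType) (M' : idealr O')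
      (pi : {rmorphism O -> O'}),
    [/\ x \in M /\ (forall y, exists a, pi a = y),
        forall a, pi a = 0 <-> exists b, a = x * b,
        forall a, a \in M <-> pi a \in M',
        forall n r, ideal_pow [set` M] n.+1 (x * r) -> ideal_pow [set` M] n r
      & regular_adic d' M'].

(* Successive quotients by nonzerodivisors [x_1, ..., x_d] lead to a field, and
   each quotient is complete for the next [x_i]: writing [y n] for the tail of the
   series [c n + c n.+1 * x + ...], completeness is the existence of all tails. *)
Fixpoint regular_complete d : comNzRingType -> Prop :=
  if d isn't d'.+1 then fun R => forall x : R, x != 0 -> exists y, x * y = 1
  else fun R => exists (x : R) (R' : comNzRingType) (pi : {rmorphism R -> R'}),
    [/\ (forall y, exists a, pi a = y) /\ (forall a, pi a = 0 <-> exists b, a = x * b),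
        forall a, x * a = 0 -> a = 0,
        forall c : nat -> R, exists y : nat -> R, forall n, y n = c n + x * y n.+1,
        forall a, (forall n, exists b, a = x ^+ n * b) -> a = 0
      & regular_complete d' R'].

(** By [completion_quot] with [e = 1], completion commutes with dividing by each parameter in turn;
    what remains is to sum power series in it. *)
Lemma regular_complete_completion d (O : comNzRingType) (M : idealr O) :
  regular_adic d M -> regular_complete d (completion M).
Proof.
elim: d O M => [|d IH] O M /=.
  move=> [locM M0] c c0.
  (* As [M] is zero, all terms of index at least 1 coincide; the term of index 0 carries no
     information, [mpow 0] being the whole ring. *)
  have pow0 n r : ideal_pow [set` M] n.+1 r -> r = 0.
    apply: (@ideal_powS_sub _ M n (fun r => r = 0)).
      by split=> // a _ _ -> ->; rewrite mulr0 addr0.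
    by move=> x y /M0 -> _; rewrite mul0r.
  have cE n : approx c n.+1 = approx c 1.
    have := apx_uniq (apx_approx c 1) (apx_coherent _ (apx_approx c n.+1)).
    by move/(_ isT)/pow0/eqP; rewrite subr_eq0 eq_sym => /eqP.
  have c1 : approx c 1 \notin M.
    apply: contra c0 => /M0 c10; apply/eqP/apx_eq0 => -[|n]; first by [].
    by rewrite /apx cE c10 subr0; case: (is_ideal_pow M n.+1).
  have [y hy] := locM _ c1.
  have [d hd] := ex_completion_const M y.
  exists d; apply: (@apx_eq _ M _ _ (fun=> 1)) => n; last exact: apx1.
  case: n => [|n]; first by [].
  by rewrite -hy -(cE n); apply: apxM => //; apply: apx_approx.
move=> [x [O' [M' [pi [[xM pisurj] piker piM hx /IH R'd]]]]].
have [|Pi [xhat [hPi hxhat Pisurj Piker xreg]]] := completion_quot pisurj piker piM (e := 1).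
  by move=> n r; rewrite addn1; apply: hx.
have powI n := is_ideal_pow M n.
exists xhat, (completion M'), Pi; split=> // [c|a ha].
(* The tail [y m] is the sum of the [c (m + j) * x ^+ j]; modulo [mpow N] only the terms with
   [j < N] count. *)
- have hy m : exists y : completion M, forall N, apx y N (\sum_(j < N) approx (c (m + j)%N) N * x ^+ j).
    apply: (@ex_completion _ M (fun N => \sum_(j < N) approx (c (m + j)%N) N * x ^+ j)) => N.
    rewrite big_ord_recr /= addrAC -sumrB; apply: is_idealD => //.
      apply: (is_ideal_sum (powI N)) => j; rewrite -mulrBl; apply: is_idealMl => //.
      apply: apx_uniq (apx_approx _ _).
      exact: apx_coherent (leqnSn N) (apx_approx _ _).
    by apply: is_idealM => //; apply: ideal_powX.
  have [y Hy] := choice hy.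
  exists y => m; apply: (apx_eq (Hy m)) => N.
  apply: apx_trans (apxD (apx_approx (c m) N) (apxM (hxhat N) (Hy m.+1 N))) _.
  case: N => [|N] //.
  rewrite mulr_sumr big_ord_recr [X in _ - X]big_ord_recl /= addn0 expr0 mulr1.
  set S1 := \sum_(i < N) _; set S2 := \sum_(i < N) _; set T := x * _.
  have -> : S1 = S2.
    by apply: eq_bigr => i _; rewrite /bump /= add1n addSnnS exprS; ring.
  rewrite (_ : _ - _ = T); last by ring.
  rewrite /T mulrCA -exprS; apply: (is_idealM _ (powI N.+1)); exact: ideal_powX.
- apply: apx_eq0 => n; have [b ->] := ha n.
  have xn : apx (xhat ^+ n) n (x ^+ n).
    elim: {1 3}n => [|m IHm]; first by rewrite !expr0; apply: apx1.
    by rewrite !exprS; apply: apxM.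
  apply: apx_trans (apxM xn (apx_approx b n)) _.
  by rewrite subr0; apply: is_idealMl => //; apply: ideal_powX.
Qed.

(** * Krull's principal ideal theorem *)

Section PrincipalIdealTheorem.
Variable R : comNzRingType.
Implicit Types (I J L Q : set R).

Definition ideal_add I J : set R := [set r | exists a, I a /\ J (r - a)].

Lemma is_ideal_add I J : is_ideal I -> is_ideal J -> is_ideal (ideal_add I J).
Proof.
move=> [I0 hI] [J0 hJ]; split=> [|a x y [u [Iu Ju]] [v [Iv Jv]]].
  by exists 0; rewrite subr0.
exists (a * u + v); split; first exact: hI.
by rewrite (_ : _ - _ = a * (x - u) + (y - v)); [apply: hJ | ring].
Qed.

Lemma ideal_addl I J x : is_ideal J -> I x -> ideal_add I J x.
Proof. by move=> [J0 _] Ix; exists x; rewrite subrr. Qed.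

Lemma ideal_addr I J x : is_ideal I -> J x -> ideal_add I J x.
Proof. by move=> [I0 _] Ix; exists 0; rewrite subr0. Qed.

(* The contraction to [R] of the extension of [I] to the localization at [Q]. *)
Definition saturation Q I : set R := [set r | exists s, ~ Q s /\ I (s * r)].

Lemma is_primeM Q a b : is_prime Q -> ~ Q a -> ~ Q b -> ~ Q (a * b).
Proof. by move=> [_ _ h] na nb /h[]. Qed.

Lemma is_prime_pow Q a n : is_prime Q -> Q (a ^+ n) -> Q a.
Proof.
move=> [_ Q1 h]; elim: n => [|n IH]; first by rewrite expr0.
by rewrite exprS => /h[].
Qed.

Lemma is_ideal_saturation Q I : is_prime Q -> is_ideal I -> is_ideal (saturation Q I).
Proof.
move=> QP II; split=> [|a x y [s [ns hs]] [t [nt ht]]].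
  by exists 1; rewrite mulr0; case: QP => _ ? _; case: II.
exists (s * t); split; first exact: is_primeM.
rewrite (_ : _ * _ = (a * t) * (s * x) + s * (t * y)); last by ring.
by apply: is_idealD => //; apply: is_idealM.
Qed.

Lemma saturation_sub Q I : is_prime Q -> I `<=` saturation Q I.
Proof. by move=> [_ Q1 _] x Ix; exists 1; rewrite mul1r. Qed.

Definition saturated Q I := forall s r, ~ Q s -> I (s * r) -> I r.

Lemma saturated_saturation Q I : is_prime Q -> saturated Q (saturation Q I).
Proof.
move=> QP s r ns [t [nt h]]; exists (t * s); rewrite -mulrA; split=> //.
exact: is_primeM.
Qed.

Hypothesis noeth : noetherian R.

(** A maximal element among the ideals containing [J] and avoiding [S] is prime: an element outside
    it divides, modulo it, a member of [S]; if a product of two such elements were inside, so would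
    be a product of members of [S]. *)
Lemma ex_prime_disjoint (S J : set R) :
  S 1 -> (forall a b, S a -> S b -> S (a * b)) -> is_ideal J ->
  (forall a, S a -> ~ J a) ->
  exists I, [/\ is_prime I, J `<=` I & forall a, S a -> ~ I a].
Proof.
move=> S1 SM JI JS.
have [|//|I [[II IS] JI' Imax]] :=
  @noetherian_max R noeth [set I | is_ideal I /\ forall a, S a -> ~ I a] _ J.
  by move=> I [].
exists I; split=> //; split=> //; first exact: IS.
move=> a b Iab; apply: contrapT => /not_orP[Ia Ib].
have key c : ~ I c -> exists2 u, S u & exists d, I (u - c * d).
  move=> Ic; apply: contrapT => no.
  have cI := is_ideal_add II (is_ideal_multiples c).
  apply: Ic; apply: (Imax (ideal_add I [set x | exists b, x = c * b])).
  - split=> // u Su [v [Iv [d hd]]]; apply: no; exists u => //; exists d.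
    by rewrite -hd opprB addrC subrK.
  - move=> x Ix; apply: ideal_addl => //; exact: is_ideal_multiples.
  - by apply: ideal_addr => //; exists 1; rewrite mulr1.
have [u Su [d hd]] := key a Ia; have [v Sv [e he]] := key b Ib.
apply: (IS (u * v)); first exact: SM.
rewrite (_ : u * v = v * (u - a * d) + a * d * (v - b * e) + d * e * (a * b)); last by ring.
by do 2?[apply: (is_idealD II)]; apply: is_idealM.
Qed.

(** Nakayama's lemma for [A] modulo [C] localized at [Q], without forming the localization: a factor
    [s] outside [Q] plays the denominator. The generators are eliminated one at a time. *)
Lemma nakayama (Q C A : set R) (gs : seq R) : is_prime Q -> is_ideal C ->
  (forall r, A r -> exists s, ~ Q s /\ exists d,
      ideal_gen [set x * y | x in Q & y in A] d /\ C (s * r - d)) ->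
  (forall g, g \in gs -> A g) ->
  (forall r, A r -> exists s, ~ Q s /\ ideal_add C (ideal_gen [set` gs]) (s * r)) ->
  forall r, A r -> exists s, ~ Q s /\ C (s * r).
Proof.
move=> QP CI HA; have [QI Q1 Qprime] := QP.
elim: gs => [|g gs IH] gsA gen r Ar.
  have [s [ns [c [Cc /ideal_gen_nilP/eqP]]]] := gen _ Ar.
  by rewrite subr_eq0 => /eqP e; exists s; rewrite e.
apply: IH r Ar => [h hgs|r Ar]; first by apply: gsA; rewrite inE hgs orbT.
have GI := is_ideal_add CI (is_ideal_gen [set` gs]).
have gen_split s : ideal_add C (ideal_gen [set` g :: gs]) s ->
    exists u, ideal_add C (ideal_gen [set` gs]) (s - u * g).
  move=> [c [Cc /ideal_gen_consP[u hu]]]; exists u, c; split=> //.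
  by rewrite (_ : _ - _ = s - c - g * u); last by ring.
have key b : ideal_gen [set x * y | x in Q & y in A] b ->
    exists s, ~ Q s /\ exists u, Q u /\
      ideal_add C (ideal_gen [set` gs]) (s * b - u * g).
  apply: (@ideal_gen_sub _ _ (fun b => exists s, ~ Q s /\ exists u, Q u /\
      ideal_add C (ideal_gen [set` gs]) (s * b - u * g))).
    split=> [|a b1 b2 [s1 [n1 [u1 [Qu1 h1]]]] [s2 [n2 [u2 [Qu2 h2]]]]].
      exists 1; split=> //; exists 0; split; first by case: QI.
      by rewrite mulr0 mul0r subr0; case: GI.
    exists (s1 * s2); split; first exact: is_primeM.
    exists (a * s2 * u1 + s1 * u2); split.
      by apply: (is_idealD QI); apply: is_idealM.
    rewrite (_ : _ - _ = a * s2 * (s1 * b1 - u1 * g) + s1 * (s2 * b2 - u2 * g)); last by ring.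
    by apply: (is_idealD GI); apply: is_idealM.
  move=> _ [x Qx [y Ay <-]]; have [s [ns /gen_split[u hu]]] := gen _ Ay.
  exists s; split=> //; exists (x * u); split; first exact: is_idealMl.
  by rewrite (_ : _ - _ = x * (s * y - u * g)); [apply: is_idealM | ring].
have Ag : A g by apply: gsA; rewrite inE eqxx.
(* Up to factors outside [Q], [g] equals [u * g] plus a combination of the other generators, with
   [u] in [Q]; hence [s' * s - u] lies outside [Q] and multiplies [g] into their span. *)
have [s [ns [b [/key[s' [ns' [u [Qu hu]]]] hb]]]] := HA _ Ag.
have nt : ~ Q (s' * s - u).
  by move=> h; have := is_idealD QI h Qu; rewrite subrK => /Qprime[].
have tg : ideal_add C (ideal_gen [set` gs]) ((s' * s - u) * g).
  rewrite (_ : _ * g = s' * (s * g - b) + (s' * b - u * g)); last by ring.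
  apply: (is_idealD GI) => //; apply: is_idealM => //.
  by apply: ideal_addl => //; apply: is_ideal_gen.
have [s2 [ns2 /gen_split[v hv]]] := gen _ Ar.
exists ((s' * s - u) * s2); split; first exact: is_primeM.
rewrite (_ : _ * r = (s' * s - u) * (s2 * r - v * g) + v * ((s' * s - u) * g)); last by ring.
by apply: (is_idealD GI); apply: is_idealM.
Qed.

(* The localization at [Q] of [R / J] is Artinian when [Q] is nilpotent modulo
   [J] there; its ideals are the [Q]-saturated ideals containing [J]. *)
Lemma saturated_dcc Q J (I : nat -> set R) : is_prime Q -> is_ideal J ->
  (forall f, Q f -> exists s n, ~ Q s /\ J (s * f ^+ n)) ->
  (forall n, [/\ is_ideal (I n), saturated Q (I n), J `<=` I n & I n.+1 `<=` I n]) ->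
  exists n0, forall n m, (n0 <= n <= m)%N -> I n `<=` I m.
Proof.
move=> QP JI Qnil HI; have [QI Q1 Qprime] := QP.
have Ile m n : (m <= n)%N -> I n `<=` I m.
  move=> /subnK <-; elim: (n - m)%N => [|j IH] x // Ix.
  by apply: IH; case: (HI (j + m)%N) => _ _ _; apply.
(* The traces of the chain on [L] are eventually constant. A maximal [L] with this property is shown
   to be the unit ideal. *)
pose stable L := exists n0, forall n m, (n0 <= n <= m)%N -> forall x, I n x -> L x -> I m x.
have [||L [[LI Lsat JL [n0 Lst]] _ Lmax]] := @noetherian_max R noeth
    [set L | [/\ is_ideal L, saturated Q L, J `<=` L & stable L]] _ (saturation Q J).
- by move=> L [].
- split; [exact: is_ideal_saturation|exact: saturated_saturation|exact: saturation_sub|].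
  exists 0%N => n m _ x _ [s [ns Js]]; have [_ sat JIm _] := HI m.
  by apply: (sat s) => //; apply: JIm.
have [L1|L1] := pselect (L 1).
  exists n0 => n m nm x Ix; apply: (Lst n m nm) => //.
  by rewrite -[x]mulr1; apply: is_idealM.
exfalso.
(* A socle element modulo [L]: for each generator [f] of [Q], the current [g] is multiplied by the
   last power of [f] that keeps it outside [L]. *)
have [g [Lg Qg]] : exists g, ~ L g /\ forall f, Q f -> L (f * g).
  have [fs Qfs] := noeth QI.
  have fsQ f : f \in fs -> Q f by move=> ffs; rewrite Qfs; apply: ideal_gen_mem.
  have [g [Lg hg]] : exists g, ~ L g /\ forall f, f \in fs -> L (f * g).
    elim: {Qfs} fs fsQ => [|f fs IH] fsQ; first by exists 1.
    have [|g [Lg hg]] := IH; first by move=> f' h; apply: fsQ; rewrite inE h orbT.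
    have [s [n [ns hn]]] : exists s n, ~ Q s /\ J (s * f ^+ n).
      by apply: Qnil; apply: fsQ; rewrite inE eqxx.
    have : exists k, `[< L (f ^+ k * g) >].
      exists n; apply/asboolP/(Lsat s) => //; rewrite mulrA.
      by apply: is_idealMl => //; apply: JL.
    move=> ex; case: (ex_minnP ex) => -[|k] /asboolP; first by rewrite mul1r.
    move=> hk kmin; exists (f ^+ k * g); split.
      by move=> h; have := kmin k; rewrite ltnn => /(_ (asboolT h)).
    move=> f'; rewrite inE => /orP[/eqP ->|/hg h]; first by rewrite mulrA -exprS.
    by rewrite mulrCA; apply: is_idealM.
  exists g; split=> // f; rewrite Qfs.
  apply: (@ideal_gen_sub _ _ (fun f => L (f * g))) => //.
  split=> [|a x y hx hy]; first by rewrite mul0r; case: LI.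
  by rewrite mulrDl -mulrA; apply: is_idealD => //; apply: is_idealM.
pose L' := ideal_add L [set x | exists b, x = g * b].
have L'I : is_ideal L' := is_ideal_add LI (is_ideal_multiples g).
have LL' : L `<=` L' by move=> x; apply: ideal_addl; apply: is_ideal_multiples.
have stL' : stable L'.
  have [[n1 h1]|h1] := pselect (exists n1, forall x, I n1 x -> L' x -> L x).
    exists (maxn n0 n1) => n m /andP[]; rewrite geq_max => /andP[n0n n1n] nm x Ix L'x.
    apply: (Lst n m) => //; first by rewrite n0n.
    by apply: h1 => //; apply: Ile n1n _ Ix.
  (* Here every [I m] contains some [r = l' + g * c'] with [c'] outside [Q]; subtracting a multiple
     of [r] from [c' * x] brings it into [L], where stability is known. *)
  exists n0 => n m /andP[n0n nm] x Ix [l [Ll [c hc]]].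
  have [r [Ir [l' [Ll' [c' hc']]] Lr]] : exists r, [/\ I m r, L' r & ~ L r].
    apply: contrapT => no; apply: h1; exists m => y Iy L'y; apply: contrapT => Ly.
    by apply: no; exists y.
  have nc' : ~ Q c'.
    move=> /Qg h; apply: Lr; rewrite (_ : r = l' + c' * g); first exact: is_idealD.
    by rewrite mulrC -hc'; ring.
  have [ImI Imsat _ _] := HI m; have [InI _ _ _] := HI n.
  apply: (Imsat c') => //.
  apply: (is_idealBl (y := c * r) ImI); first exact: is_idealM.
  apply: (Lst n m); first by rewrite n0n.
    by apply: (is_idealB InI); apply: is_idealM => //; apply: Ile nm _ _.
  rewrite (_ : _ - _ = c' * l - c * l').
    by apply: (is_idealB LI); apply: is_idealM.
  by move/eqP: hc hc'; rewrite subr_eq => /eqP -> /eqP; rewrite subr_eq => /eqP ->; ring.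
have [n1 hst] := stL'; apply: Lg; apply: (Lmax (saturation Q L')).
- split; [exact: is_ideal_saturation|exact: saturated_saturation| |].
    by move=> x /JL/LL'; apply: saturation_sub.
  exists n1 => n m nm x Ix [s [ns hs]]; have [ImI Imsat _ _] := HI m; have [InI _ _ _] := HI n.
  by apply: (Imsat s) => //; apply: (hst n m nm) hs; apply: is_idealM.
- by move=> x /LL'; apply: saturation_sub.
- by apply: saturation_sub => //; apply: ideal_addr => //; exists 1; rewrite mulr1.
Qed.


(* Krull's principal ideal theorem in [R / p], localized at [Q]: a prime minimal
   over [x] has height one. If no prime as claimed exists, then [Q] is nilpotent
   modulo [p + (x)] locally at [Q], so the symbolic powers of [P / p] stabilize
   modulo [x], hence stabilize, hence vanish locally at [P]. *)
Lemma prime_between (p P Q : set R) x :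
  is_prime p -> is_prime P -> is_prime Q -> p `<=` P -> P `<=` Q ->
  ~ (P `<=` p) -> ~ (Q `<=` P) -> Q x ->
  exists q, [/\ is_prime q, p `<=` q, ~ (q `<=` p), q `<=` Q & ~ (Q `<=` q)] /\ q x.
Proof.
move=> pP PP QP sp sP np nP Qx.
have [Px|nPx] := pselect (P x); first by exists P.
apply: contrapT => no.
have [pI p1 pprime] := pP; have [PI P1 Pprime] := PP; have [QI Q1 Qprime] := QP.
pose J := ideal_add p [set y | exists b, y = x * b].
have JI : is_ideal J := is_ideal_add pI (is_ideal_multiples x).
have pJ : p `<=` J by move=> y; apply: ideal_addl; apply: is_ideal_multiples.
have Jx : J x by apply: ideal_addr => //; exists 1; rewrite mulr1.
(* Otherwise a prime containing [J] and avoiding all [s * f ^+ n] with [s] outside [Q] lies in [Q],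
   contains [x] and misses [f], which is what [no] excludes. *)
have Qnil f : Q f -> exists s n, ~ Q s /\ J (s * f ^+ n).
  move=> Qf; apply: contrapT => nof; apply: no.
  have [|a b [s [n [ns ->]]] [t [m [nt ->]]]|//|a [s [n [ns ->]]] h|q [qP Jq qS]] :=
    @ex_prime_disjoint [set y | exists s n, ~ Q s /\ y = s * f ^+ n] J.
  - by exists 1, 0%N; rewrite expr0 mulr1.
  - exists (s * t), (n + m)%N; split; first exact: is_primeM.
    by rewrite exprD; ring.
  - by apply: nof; exists s, n.
  exists q; split; last exact: Jq.
  split=> //.
  - by move=> y /pJ/Jq.
  - by move=> /(_ x (Jq _ Jx)) /sp.
  - move=> y qy; apply: contrapT => nQy; apply: (qS y) => //.
    by exists y, 0%N; rewrite expr0 mulr1.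
  - move=> /(_ f Qf); apply: qS; exists 1, 1%N; rewrite expr1 mul1r; split=> //.
have [M ME] := ex_prime_idealr PP.
pose Ppow n := ideal_pow [set` M] n.
have PpowI n : is_ideal (Ppow n) by apply: is_ideal_pow.
pose S n := saturation P (ideal_add p (Ppow n)).
have addI n : is_ideal (ideal_add p (Ppow n)) := is_ideal_add pI (PpowI n).
have SI n : is_ideal (S n) := is_ideal_saturation PP (addI n).
have Ssat n : saturated P (S n) := @saturated_saturation P _ PP.
have pS n : p `<=` S n by move=> y py; apply: saturation_sub => //; apply: ideal_addl.
have SS n : S n.+1 `<=` S n.
  move=> y [s [ns [a [pa h]]]]; exists s; split=> //; exists a; split=> //.
  exact: ideal_powSW.
pose I n := saturation Q (ideal_add (S n) J).
have aI n : is_ideal (ideal_add (S n) J) := is_ideal_add (SI n) JI.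
have [n|n0 hn0] := @saturated_dcc Q J I QP JI Qnil.
  split; [exact: is_ideal_saturation|exact: saturated_saturation| |].
    by move=> y Jy; apply: saturation_sub => //; apply: ideal_addr.
  move=> y [s [ns [a [/SS Sa Jb]]]]; exists s; split=> //; by exists a.
(* Locally at [Q], stability modulo [x] puts [S n0] inside [S n0.+1 + x * S n0], because a multiple
   of [x] in [S n0] has its cofactor in [S n0]. Nakayama at [Q] removes the second term. *)
have Sstep r : S n0 r -> exists s, ~ Q s /\ S n0.+1 (s * r).
  have [gs Sgs] := noeth (SI n0).
  apply: (@nakayama Q (S n0.+1) (S n0) gs) => //.
  - move=> {}r Sr; have [] := hn0 n0 n0.+1 _ r.
    + by rewrite leqnn leqnSn.
    + by apply: saturation_sub => //; apply: ideal_addl.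
    move=> s [ns [a [Sa [a' [pa' [b hb]]]]]]; exists s; split=> //; exists (x * b); split.
      apply: ideal_gen_mem; exists x => //; exists b => //.
      apply: (Ssat n0 x) => //; rewrite -hb.
      apply: (is_idealB (SI n0)); last exact: pS.
      by apply: (is_idealB (SI n0)); [apply: is_idealM | apply: SS].
    have -> : s * r - x * b = a + a' by rewrite -hb; ring.
    by apply: is_idealD => //; apply: pS.
  - by move=> g ggs; rewrite Sgs; apply: ideal_gen_mem.
  - move=> {}r Sr; exists 1; split=> //; rewrite mul1r -Sgs; exact: ideal_addr.
(* Locally at [P], the power [Ppow n0] is now contained in [P * Ppow n0] modulo [p]; Nakayama at [P]
   makes it vanish there. *)
have Pstep r : Ppow n0 r -> exists s, ~ P s /\ p (s * r).
  have [gs Pgs] := noeth (PpowI n0).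
  apply: (@nakayama P p (Ppow n0) gs) => //.
  - move=> {}r Pr; have [|s [ns Ss]] := Sstep r.
      by apply: saturation_sub => //; apply: ideal_addr.
    have [t [nt [a [pa ha]]]] : S n0.+1 r by apply: (Ssat _ s) => // /sP.
    exists t; split=> //; exists (t * r - a); split; last by rewrite opprB addrC subrK.
    by move: ha; rewrite /Ppow /= ME.
  - by move=> g ggs; rewrite Pgs; apply: ideal_gen_mem.
  - move=> {}r Sr; exists 1; split=> //; rewrite mul1r -Pgs; exact: ideal_addr.
apply: np => y Py.
have [|s [ns]] := Pstep (y ^+ n0); first by apply: ideal_powX; rewrite -ME in Py.
by move=> /pprime[/sp //|/(is_prime_pow pP)].
Qed.

Definition set_chain n (p : nat -> set R) : Prop :=
  (forall i, (i <= n)%N -> is_prime (p i)) /\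
  (forall i, (i < n)%N -> p i `<=` p i.+1 /\ ~ (p i.+1 `<=` p i)).

(** Moves [x] down the chain: [prime_between] replaces the prime below the top by one containing
    [x], and the shorter chain ending there is treated in the same way. It bounds the loss of
    dimension in passing to the quotient by [x]. *)
Lemma set_chain_lower n p x : set_chain n.+1 p -> p n.+1 x ->
  exists p', [/\ set_chain n p', p' n = p n.+1 & p' 0%N x].
Proof.
elim: n p => [|n IH] p [pP pC] px.
  exists (fun=> p 1%N); split=> //; split=> // i _; exact: pP.
have [s1 n1] := pC n (leqnSn _); have [s2 n2] := pC n.+1 (leqnn _).
have [q [[qP sq nq qs nqs] qx]] : exists q, [/\ is_prime q, p n `<=` q,
    ~ (q `<=` p n), q `<=` p n.+2 & ~ (p n.+2 `<=` q)] /\ q x.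
  by apply: (@prime_between (p n) (p n.+1) (p n.+2)) => //; apply: pP; rewrite ?leqnSn // leqW.
pose p2 i := if (i <= n)%N then p i else q.
have [||p' [[p'P p'C] p'n p'x]] := IH p2; last 1 first.
- pose p3 i := if (i <= n)%N then p' i else p n.+2.
  exists p3; split; rewrite /p3 ?ltnn // ; split=> i.
    by case: ifP => ile _; [apply: p'P | apply: pP].
  rewrite ltnS => ilen; have : (i == n) || (i < n)%N by rewrite -leq_eqVlt.
  move=> /orP[/eqP ->|ile].
    by rewrite leqnn ltnn p'n /p2 ltnn.
  by rewrite ile (ltnW ile); apply: p'C.
- split=> i; rewrite /p2.
    by case: ifP => // ile _; apply: pP; rewrite (leq_trans ile) // leqW.
  rewrite ltnS => ilen; have : (i == n) || (i < n)%N by rewrite -leq_eqVlt.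
  move=> /orP[/eqP ->|ile]; first by rewrite leqnn ltnn.
  by rewrite ile (ltnW ile); apply: pC; rewrite ltnW // ltnS ltnW.
- by rewrite /p2 ltnn.
Qed.

End PrincipalIdealTheorem.

(** * Complete regular rings *)

Lemma prime_chain_set_chain (R : comNzRingType) n (p : nat -> prime_idealr R) :
  prime_chain n p -> set_chain n (fun i => [set` p i]).
Proof.
move=> pC; split=> i ile; first exact: is_prime_prime_idealr.
by have [sp [x px npx]] := pC i ile; split=> // /(_ x px) /=; rewrite (negPf npx).
Qed.

Lemma set_chain_prime_chain (R : comNzRingType) n (p : nat -> set R) :
  set_chain n p -> exists q : nat -> prime_idealr R, prime_chain n q.
Proof.
move=> [pP pC].
(* Indices above [n] receive [p 0] as a default prime. *)
have ex i : exists M : prime_idealr R, (i <= n)%N -> [set` M] = p i.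
  have [ile|_] := boolP (i <= n)%N; first by have [M ME] := ex_prime_idealr (pP i ile); exists M.
  by have [M ME] := ex_prime_idealr (pP 0%N (leq0n n)); exists M.
have [q hq] := choice ex.
exists q => i ile; have [s ns] := pC i ile.
rewrite -(hq i (ltnW ile)) -(hq i.+1 ile) in s ns; split=> //.
by apply: contrapT => no; apply: ns => x /= qx; apply: contrapT => /negP nqx; apply: no; exists x.
Qed.

Section Transfer.
Variables (R R' : comNzRingType) (pi : {rmorphism R -> R'}).
Hypothesis pisurj : forall y, exists a, pi a = y.

Lemma is_ideal_preimage (I : set R') : is_ideal I -> is_ideal [set a | I (pi a)].
Proof.
move=> [I0 h]; split=> [|a x y hx hy] /=; first by rewrite rmorph0.
by rewrite rmorphD rmorphM; apply: h.
Qed.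

Lemma is_prime_preimage (p : set R') : is_prime p -> is_prime [set a | p (pi a)].
Proof.
move=> [pI p1 pp]; split=> [||a b] /=; first exact: is_ideal_preimage.
  by rewrite rmorph1.
by rewrite rmorphM => /pp.
Qed.

Lemma is_ideal_image (I : set R) : is_ideal I ->
  is_ideal [set y | exists2 a, I a & pi a = y].
Proof.
move=> [I0 h]; split=> [|a _ _ [x hx <-] [y hy <-]].
  by exists 0; rewrite ?rmorph0.
have [b <-] := pisurj a.
by exists (b * x + y); [apply: h | rewrite rmorphD rmorphM].
Qed.

Lemma image_ideal_kernel (I : set R) a : is_ideal I ->
  (forall b, pi b = 0 -> I b) -> (exists2 b, I b & pi b = pi a) -> I a.
Proof.
move=> II kerI [b Ib /eqP]; rewrite eq_sym -subr_eq0 -rmorphB => /eqP/kerI.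
exact: is_idealBl.
Qed.

Lemma is_prime_image (p : set R) : is_prime p -> (forall b, pi b = 0 -> p b) ->
  is_prime [set y | exists2 a, p a & pi a = y].
Proof.
move=> [pI p1 pp] kerp; split; first exact: is_ideal_image.
  by rewrite -(rmorph1 pi) => /(image_ideal_kernel pI kerp).
move=> a b; have [x <-] := pisurj a; have [y <-] := pisurj b.
rewrite -rmorphM => /(image_ideal_kernel pI kerp) /pp[h|h]; [left|right].
  by exists x.
by exists y.
Qed.

End Transfer.

Section RegularComplete.

Lemma adic_divide (R R' : comNzRingType) (pi : {rmorphism R -> R'}) (x : R) :
  (forall a, pi a = 0 <-> exists b, a = x * b) ->
  (forall a, (forall n, exists b, a = x ^+ n * b) -> a = 0) ->
  forall a, a != 0 -> exists n b, a = x ^+ n * b /\ pi b != 0.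
Proof.
move=> piker sep a a0.
have : exists n, `[< ~ exists b, a = x ^+ n * b >].
  apply: contrapT => no; move/eqP: a0; apply; apply: sep => n.
  by apply: contrapT => h; apply: no; exists n; apply/asboolP.
move=> ex; case: (ex_minnP ex) => -[|n] /asboolP hn nmin.
  by case: hn; exists a; rewrite mul1r.
have [b ab] : exists b, a = x ^+ n * b.
  apply: contrapT => h; have := nmin n (asboolT h); by rewrite ltnn.
exists n, b; split=> //; apply/eqP => /piker[c bc]; apply: hn.
by exists c; rewrite ab bc exprSr mulrA.
Qed.

(** After division by the largest possible powers of [x], both factors have nonzero images in [R'],
    which is a domain by induction. *)
Lemma regular_complete_domain d (R : comNzRingType) : regular_complete d R ->
  forall a b : R, a * b = 0 -> a = 0 \/ b = 0.
Proof.
elim: d R => [|d IH] R /=.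
  move=> F a b ab; have [->|/F[c ac]] := eqVneq a 0; first by left.
  by right; rewrite -[b]mul1r -ac mulrAC ab mul0r.
move=> [x [R' [pi [[pisurj piker] xreg compl sep /IH R'dom]]]] a b ab.
have [->|a0] := eqVneq a 0; first by left.
have [->|b0] := eqVneq b 0; first by right.
have xnreg n c : x ^+ n * c = 0 -> c = 0.
  by elim: n => [|n IHn]; rewrite ?mul1r // exprS -mulrA => /xreg.
have [m [a' [aE a'0]]] := adic_divide piker sep a0.
have [n [b' [bE b'0]]] := adic_divide piker sep b0.
move: ab; rewrite aE bE mulrACA -exprD => /xnreg /(congr1 pi).
by rewrite rmorphM rmorph0 => /R'dom[] /eqP; rewrite ?(negPf a'0) ?(negPf b'0).
Qed.

(* Generators of the ideals of leading forms [{pi r | x ^+ n * r \in I}] lift to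
   generators of [I], the coefficients being obtained as [x]-adic series. *)
Lemma noetherian_adic (R R' : comNzRingType) (pi : {rmorphism R -> R'}) (x : R) :
  (forall y, exists a, pi a = y) ->
  (forall a, pi a = 0 <-> exists b, a = x * b) ->
  (forall c : nat -> R, exists y : nat -> R, forall n, y n = c n + x * y n.+1) ->
  (forall a, (forall n, exists b, a = x ^+ n * b) -> a = 0) ->
  noetherian R' -> noetherian R.
Proof.
move=> pisurj piker compl sep noeth I II.
pose J n := [set r | I (x ^+ n * r)].
have JI n : is_ideal (J n).
  split=> [|a u v hu hv]; rewrite /J /=; first by rewrite mulr0; case: II.
  by rewrite mulrDr mulrCA; apply: is_idealD => //; apply: is_idealM.
pose L n := [set y | exists2 a, J n a & pi a = y].
have LI n : is_ideal (L n) by apply: is_ideal_image.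
(* The ideals of leading forms increase with [n], since multiplying by [x] stays in [I]; they are
   stationary from [N] on. *)
have [n _ [a Ja <-]|N LN] := noetherian_acc noeth LI.
  by exists a => //; rewrite /J /= exprS -mulrA; apply: is_idealM.
have Lmono n : L (N + n)%N = L N.
  apply/seteqP; split; first exact: LN.
  move=> _ [a Ja <-]; exists a => //.
  by rewrite /J /= exprD mulrAC; apply: is_idealMl.
have Lgen n : exists s : seq R, (forall g, g \in s -> J n g) /\
    forall r, J n r -> exists c : nat -> R, exists r', r = \sum_(i < size s) c i * s`_i + x * r'.
  have [s' Ls'] := noeth _ (LI n).
  have lift i : exists g, (i < size s')%N -> J n g /\ pi g = s'`_i.
    have [ilt|_] := boolP (i < size s')%N; last by exists 0.
    have [g Jg gE] : L n s'`_i by rewrite Ls'; apply: ideal_gen_mem => /=; rewrite mem_nth.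
    by exists g.
  have [g hg] := choice lift.
  exists (mkseq g (size s')); rewrite size_mkseq; split=> [h /mapP[i]|r Jr].
    by rewrite mem_iota add0n => /andP[_ /hg[Jg _]] ->.
  have : L n (pi r) by exists r.
  rewrite Ls' => /ideal_gen_seqP[c' hc'].
  have [c hc] := choice (fun i => pisurj (c' i)).
  have /piker[r' hr'] : pi (r - \sum_(i < size s') c i * (mkseq g (size s'))`_i) = 0.
    apply/eqP; rewrite rmorphB subr_eq0 hc' rmorph_sum /=; apply/eqP/eq_bigr => i _.
    by rewrite rmorphM hc nth_mkseq //; have [_ ->] := hg i (ltn_ord i).
  by exists c, r'; rewrite -hr'; ring.
have [S hS] := choice Lgen.
pose G := flatten [seq [seq x ^+ n * g | g <- S n] | n <- iota 0 N.+1].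
exists G; apply/seteqP; split; last first.
  apply: (@ideal_gen_sub _ _ I) => // _ /flattenP[_ /mapP[n nin ->] /mapP[g gS ->]].
  by have [h _] := hS n; apply: h.
have GI := is_ideal_gen [set` G].
have GS n (c : nat -> R) : (n <= N)%N ->
    ideal_gen [set` G] (x ^+ n * \sum_(i < size (S n)) c i * (S n)`_i).
  move=> nN; rewrite mulr_sumr; apply: (is_ideal_sum GI) => i.
  rewrite mulrCA; apply: (is_idealM _ GI); apply: ideal_gen_mem => /=.
  apply/flattenP; exists [seq x ^+ n * g | g <- S n].
    by apply/mapP; exists n => //; rewrite mem_iota.
  by apply/mapP; exists (S n)`_i => //; rewrite mem_nth.
have JS n (c : nat -> R) : J n (\sum_(i < size (S n)) c i * (S n)`_i).
  apply: (is_ideal_sum (JI n)) => i; apply: (is_idealM _ (JI n)).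
  by have [h _] := hS n; apply: h; rewrite mem_nth.
have low n r : (n <= N)%N -> J n r ->
    exists r', J n.+1 r' /\ ideal_gen [set` G] (x ^+ n * r - x ^+ n.+1 * r').
  move=> nN Jr; have [_ h] := hS n; have [c [r' rE]] := h r Jr.
  exists r'; split.
    have Jd := is_idealB (JI n) Jr (JS n c); move: Jd.
    by rewrite rE addrAC subrr add0r /J /= mulrA -exprSr.
  rewrite rE (_ : _ - _ = x ^+ n * (\sum_(i < size (S n)) c i * (S n)`_i)).
    exact: GS.
  by rewrite exprSr; ring.
move=> f If.
have down n : (n <= N)%N -> exists r, J n r /\ ideal_gen [set` G] (f - x ^+ n * r).
  elim: n => [|n IHn] nN.
    exists f; rewrite /J /= mul1r subrr; split=> //; by case: GI.
  have [r [Jr hr]] := IHn (ltnW nN); have [r' [Jr' hr']] := low n r (ltnW nN) Jr.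
  exists r'; split=> //.
  rewrite (_ : _ - _ = (f - x ^+ n * r) + (x ^+ n * r - x ^+ n.+1 * r')); last by ring.
  exact: (is_idealD GI).
have [r0 [Jr0 hr0]] := down N (leqnn N).
apply: (is_idealBl GI _ hr0).
pose k := size (S N).
(* From level [N] on no new leading forms appear, so the expansion continues indefinitely with the
   generators [S N] alone. *)
have step n r : J (N + n)%N r -> exists c : nat -> R, exists r',
    J (N + n.+1)%N r' /\ r = \sum_(i < k) c i * (S N)`_i + x * r'.
  move=> Jr; have : L (N + n)%N (pi r) by exists r.
  rewrite Lmono => -[a Ja aE]; have [_ /(_ a Ja)[c [r1 ae]]] := hS N.
  have /piker[b hb] : pi (r - a) = 0 by rewrite rmorphB aE subrr.
  exists c, (r1 + b); split; last by rewrite mulrDr -hb {1}ae; ring.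
  have Jx : J (N + n)%N (x * (r1 + b)).
    rewrite (_ : x * _ = r - \sum_(i < size (S N)) c i * (S N)`_i).
      apply: (is_idealB (JI _)) => //; have := JS N c.
      by rewrite /J /= exprD mulrAC => h; apply: is_idealMl.
    by rewrite mulrDr -hb {1}ae; ring.
  by move: Jx; rewrite /J /= mulrA -exprSr addnS.
(* For the dependent choice, each remainder is stored with its membership proof, which the next step
   consumes. *)
pose T n := {r | J (N + n)%N r}.
have stepT (p : {n & T n}) : exists q : (nat -> R) * R, J (N + (tag p).+1)%N q.2 /\
    sval (tagged p) = \sum_(i < k) q.1 i * (S N)`_i + x * q.2.
  case: p => n [r Jr] /=; have [c [r' [h1 h2]]] := step n r Jr.
  by exists (c, r').
have [q hq] := choice stepT.
pose nxt n (r : T n) : T n.+1 := exist _ (q (Tagged T r)).2 (proj1 (hq (Tagged T r))).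
pose rr := fix rr n : T n := if n is n'.+1 then nxt n' (rr n')
   else exist _ r0 (eq_rect N (fun m => J m r0) Jr0 (N + 0)%N (esym (addn0 N))).
pose c n i := (q (Tagged T (rr n))).1 i.
have rE n : sval (rr n) = \sum_(i < k) c n i * (S N)`_i + x * sval (rr n.+1).
  exact: (proj2 (hq (Tagged T (rr n)))).
have [y hy] := choice (fun i => compl (fun n => c n i)).
pose e n := sval (rr n) - \sum_(i < k) y i n * (S N)`_i.
(* The error after subtracting the series obeys the recursion with zero coefficients, so [e 0] is
   divisible by every power of [x]. *)
have eE n : e n = x * e n.+1.
  rewrite /e rE mulrBr mulr_sumr.
  under [in X in _ - X = _]eq_bigr => i _ do rewrite hy mulrDl.
  rewrite big_split /= opprD addrACA subrr add0r; congr (_ - _).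
  by apply: eq_bigr => i _; rewrite mulrA.
have e0 : e 0%N = 0.
  apply: sep => n; exists (e n); elim: n => [|n IHn]; first by rewrite mul1r.
  by rewrite IHn eE exprSr mulrA.
have -> : r0 = \sum_(i < k) y i 0%N * (S N)`_i.
  by apply/subr0_eq; rewrite -[RHS]e0.
exact: (GS N (fun i => y i 0%N)).
Qed.

Lemma regular_complete_noetherian d (R : comNzRingType) :
  regular_complete d R -> noetherian R.
Proof.
elim: d R => [|d IH] R /=; last first.
  move=> [x [R' [pi [[pisurj piker] xreg compl sep /IH]]]].
  exact: noetherian_adic sep.
move=> F I II; have [[a [Ia a0]]|no] := pselect (exists a, I a /\ a <> 0).
  exists [:: a]; apply/seteqP; split=> b; last first.
    by move=> /ideal_gen1P[c ->]; apply: is_idealMl.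
  move/eqP: a0 => /F[c ac] _; apply/ideal_gen1P; exists (c * b).
  by rewrite mulrA ac mul1r.
exists [::]; apply/seteqP; split=> b.
  move=> Ib; apply/ideal_gen_nilP; apply: contrapT => b0; apply: no.
  by exists b.
by move=> /ideal_gen_nilP ->; case: II.
Qed.

Lemma regular_complete_local d (R : comNzRingType) : regular_complete d R ->
  exists m : idealr R, local_with m /\
    exists s : seq R, [set` m] = ideal_gen [set` s] /\ size s = d.
Proof.
elim: d R => [|d IH] R /=.
  move=> F; have [||m mE] := @ex_idealr R [set x | x = 0].
  - by split=> // a _ _ -> ->; rewrite mulr0 addr0.
  - by move/eqP; rewrite oner_eq0.
  exists m; split.
    move=> x xm; apply: F; apply: contra xm => /eqP ->; exact: rpred0.
  exists [::]; split=> //; rewrite mE; apply/seteqP.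
  by split=> x /ideal_gen_nilP.
move=> [x [R' [pi [[pisurj piker] xreg compl sep /IH[m' [loc' [s' [m'E ss']]]]]]]].
have [||m mE] := @ex_idealr R [set a | pi a \in m'].
- exact: is_ideal_preimage (is_ideal_idealr m').
- by rewrite /= rmorph1 idealr1.
have mP a : (a \in m) = (pi a \in m').
  apply/idP/idP => h; first by have : [set` m] a by []; rewrite mE.
  by rewrite -[is_true _]/([set` m] a) mE.
exists m; split.
  move=> a; rewrite mP => /loc'[b']; have [b <-] := pisurj b'.
  move=> /eqP; rewrite -rmorphM -(rmorph1 pi) -subr_eq0 -rmorphB => /eqP/piker[z hz].
  (* The geometric series that inverts [1 + x * z]; separatedness yields [y 1 = - (z * y 0)]. *)
  have [y hy] := compl (fun n => (- z) ^+ n).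
  pose e n := y n.+1 + z * y n.
  have e0 : e 0%N = 0.
    apply: sep => n; exists (e n); elim: n => [|n IHn]; first by rewrite mul1r.
    rewrite IHn exprSr -mulrA; congr (_ * _).
    by rewrite /e {1}hy [X in _ + z * X]hy exprS; ring.
  exists (b * y 0%N).
  have abE : a * b = 1 + x * z by rewrite -hz; ring.
  rewrite mulrA abE mulrDl mul1r -mulrA {1}hy expr0.
  have -> : y 1%N = - (z * y 0%N) by apply/eqP; rewrite -addr_eq0; apply/eqP.
  by rewrite mulrN addrNK.
have [l hl] := choice pisurj.
exists (x :: map l s'); rewrite /= size_map ss'; split=> //.
apply/seteqP; split=> a /=.
  rewrite mP -[is_true _]/([set` m'] (pi a)) m'E => /ideal_gen_seqP[c hc].
  have [c' hc'] := choice (fun i => pisurj (c i)).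
  have /piker[b hb] : pi (a - \sum_(i < size s') c' i * (map l s')`_i) = 0.
    apply/eqP; rewrite rmorphB subr_eq0 hc rmorph_sum /=; apply/eqP/eq_bigr => i _.
    by rewrite rmorphM hc' (nth_map 0) // hl.
  apply/ideal_gen_consP; exists b; rewrite -hb opprB addrC subrK.
  by apply/ideal_gen_seqP; exists c'; rewrite size_map.
apply: (@ideal_gen_sub _ _ [set` m]); first exact: is_ideal_idealr.
move=> b /=; rewrite inE mP => /orP[/eqP ->|/mapP[c cs' ->]].
  have -> : pi x = 0 by apply/piker; exists 1; rewrite mulr1.
  exact: rpred0.
rewrite hl -[is_true _]/([set` m'] c) m'E; exact: ideal_gen_mem.
Qed.

(** The zero ideal, prime by integrality, goes below the preimages of a chain of [R']; it is
    strictly smaller because [x] is nonzero. *)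
Lemma regular_complete_chain d (R : comNzRingType) : regular_complete d R ->
  exists p : nat -> set R, set_chain d p.
Proof.
elim: d R => [|d IH] R Rd.
  exists (fun=> [set x | x = 0]); split=> // i _; split.
  - by split=> // a _ _ -> ->; rewrite mulr0 addr0.
  - by move/eqP; rewrite oner_eq0.
  - by move=> a b /(regular_complete_domain Rd).
have dom := regular_complete_domain Rd.
have [x [R' [pi [[pisurj piker] xreg compl sep /IH[p [pP pC]]]]]] := Rd.
exists (fun i => if i is i'.+1 then [set a | p i' (pi a)] else [set a | a = 0]).
split=> -[|i] ile.
- split; first by split=> // a _ _ -> ->; rewrite mulr0 addr0.
    by move/eqP; rewrite oner_eq0.
  exact: dom.
- by apply: is_prime_preimage; apply: pP.
- have [pI _ _] := pP 0%N (leq0n d); split=> [_ ->|h].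
    by rewrite /= rmorph0; case: pI.
  have px0 : pi x = 0 by apply/piker; exists 1; rewrite mulr1.
  have x0 : x = 0 by apply: h; rewrite /= px0; case: pI.
  by have := xreg 1; rewrite x0 mul0r => /(_ erefl)/eqP; rewrite oner_eq0.
- have [s ns] := pC i ile; split=> [a /=|h]; first exact: s.
  apply: ns => y; have [a <-] := pisurj y; exact: h.
Qed.

(** A chain whose top contains [x] is lowered to a chain of primes containing [x], one step shorter,
    and these are primes of [R']. *)
Lemma regular_complete_dim d (R : comNzRingType) : regular_complete d R ->
  forall n (p : nat -> set R), set_chain n p -> (n <= d)%N.
Proof.
elim: d R => [|d IH] R Rd.
  case=> // n p [pP pC]; have [s ns] := pC 0%N isT; exfalso; apply: ns => y p1y.
  have [[p00 _] _ _] := pP 0%N isT; have [p1I p11 _] := pP 1%N isT.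
  have [-> //|/Rd[z yz]] := eqVneq y 0.
  by case: p11; rewrite -yz; apply: is_idealMl.
have noeth := regular_complete_noetherian Rd.
have [m [loc _]] := regular_complete_local Rd.
have [x [R' [pi [[pisurj piker] xreg compl sep /IH dim']]]] := Rd.
have px0 : pi x = 0 by apply/piker; exists 1; rewrite mulr1.
have lower n p : set_chain n.+1 p -> p n.+1 x -> (n <= d)%N.
  move=> pC px; have [p' [[p'P p'C] _ p'x]] := set_chain_lower noeth pC px.
  have p'xi i : (i <= n)%N -> p' i x.
    by elim: i => // i IHi ile; have [s _] := p'C i ile; apply/s/IHi/ltnW.
  have kerp i : (i <= n)%N -> forall b, pi b = 0 -> p' i b.
    move=> ile b /piker[c ->]; have [p'I _ _] := p'P i ile.
    by apply: is_idealMl => //; apply: p'xi.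
  apply: (dim' n (fun i => [set y | exists2 a, p' i a & pi a = y])).
  split=> i ile; first by apply: is_prime_image => //; [apply: p'P | apply: kerp].
  have [s ns] := p'C i ile; split=> [_ [a pa <-]|h]; first by exists a => //; apply: s.
  apply: ns => a pa; have [p'I _ _] := p'P i (ltnW ile).
  apply: (image_ideal_kernel (pi := pi) p'I (kerp i (ltnW ile))).
  by apply: h; exists a.
case=> // n p pC; have [px|npx] := pselect (p n.+1 x); first exact: lower pC px.
(* When [x] is outside the top prime, the maximal ideal is put on top; the chain gets one step
   longer and its top contains [x]. *)
apply: leqW; apply: (lower n.+1 (fun i => if (i <= n.+1)%N then p i else [set` m])).
  have [pP pCC] := pC; have [pI p1 _] := pP n.+1 (leqnn _).
  have xm : x \in m.
    apply: contrapT => /negP /loc[y /(congr1 pi)/eqP].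
    by rewrite rmorphM px0 mul0r rmorph1 eq_sym oner_eq0.
  split=> i ile.
    case: ifP => ile'; first exact: pP.
    split; [exact: is_ideal_idealr | by rewrite /= idealr1 |].
    move=> a b /= abm; apply: contrapT => /not_orP[/negP/loc[a' aa'] /negP/loc[b' bb']].
    have := idealMr (a' * b') abm.
    by rewrite mulrACA [a' * a]mulrC aa' mul1r mulrC bb' idealr1.
  rewrite ltnS in ile; rewrite ile; case: ifP => ile'; first exact: pCC.
  have -> : i = n.+1 by apply/eqP; rewrite eqn_leq ile leqNgt ile'.
  split=> [y py|/(_ x xm)//].
  apply: contrapT => /negP/loc[z yz]; apply: p1; rewrite -yz; exact: is_idealMl.
rewrite ltnn /=; apply: contrapT => /negP /loc[y /(congr1 pi)/eqP].
by rewrite rmorphM px0 mul0r rmorph1 eq_sym oner_eq0.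
Qed.

Lemma regular_complete_regular_local d (R : comNzRingType) :
  regular_complete d R -> regular_local R.
Proof.
move=> Rd; split; first exact: regular_complete_noetherian Rd.
have [m [loc [s [mE sd]]]] := regular_complete_local Rd.
exists m; split=> //; exists s; split=> //; split.
  have [p pC] := regular_complete_chain Rd.
  by rewrite sd; apply: set_chain_prime_chain pC.
move=> n p /prime_chain_set_chain; rewrite sd; exact: regular_complete_dim.
Qed.

End RegularComplete.

(** * Completed hypersurfaces *)

(** The presentation is [completion M] modulo the image of [F]. The order shift [e] makes this image
    a nonzerodivisor whose multiples are the exact kernel, and [F \in M] makes it a nonunit. *)
Lemma ciq_completion d (O O' : comNzRingType) (M : idealr O) (M' : idealr O')
    (pi : {rmorphism O -> O'}) (F : O) (e : nat) :
  regular_adic d M -> F \in M ->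
  (forall y, exists x, pi x = y) ->
  (forall a, pi a = 0 <-> exists b, a = F * b) ->
  (forall a, a \in M <-> pi a \in M') ->
  (forall n r, ideal_pow [set` M] (n + e) (F * r) -> ideal_pow [set` M] n r) ->
  complete_intersection_quotient (completion M').
Proof.
move=> regM FM pisurj piker piM hF.
have [Pi [Fhat [hPi hFhat Pisurj Piker Freg]]] := completion_quot pisurj piker piM hF.
have Fhat1 : ~ exists b, 1 = Fhat * b.
  move=> [b hb]; have := apxM (hFhat 1) (apx_approx b 1).
  rewrite -hb => h; have := apx_uniq (apx1 M 1) h.
  move=> /ideal_pow1P h1; have : 1 \in M.
    by rewrite -(subrK (F * approx b 1) 1) rpredD // mulrC idealMr.
  by rewrite idealr1.
have [I IE] := ex_idealr (is_ideal_multiples Fhat) Fhat1.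
have IP a : a \in I <-> exists b, a = Fhat * b.
  by rewrite -[is_true _]/([set` I] a) IE.
exists (completion M), I, [:: Fhat]; split.
- exact: regular_complete_regular_local (regular_complete_completion regM).
- split=> [[|//] _ a /ideal_gen_nilP/Freg -> |/ideal_gen1P //].
  exact/ideal_gen_nilP.
- rewrite IE; apply/seteqP; split=> a /=; first by move=> h; apply/ideal_gen1P.
  by move/ideal_gen1P.
have [a /IP/Piker //|f fE] := @ex_rmorphism_quot _ _ I Pi.
exists f; have fsurj c : exists q, f q = c.
  by have [a <-] := Pisurj c; exists (\pi_{ideal_quot I} a); apply: fE.
have [g hg] := choice fsurj; exists g => // q.
have finj q1 q2 : f q1 = f q2 -> q1 = q2.
  rewrite -[q1]reprK -[q2]reprK !fE => /eqP; rewrite -subr_eq0 -rmorphB => /eqP/Piker/IP h.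
  by apply/eqP; rewrite -Quotient.idealrBE.
by apply: finj; rewrite hg.
Qed.

Lemma coef0_eq0P (R : comNzRingType) (f : {poly R}) :
  f`_0 = 0 <-> exists g, f = 'X * g.
Proof.
split=> [f0|[g ->]]; last by rewrite mulrC coefMX.
exists (\poly_(i < size f) f`_i.+1); apply/polyP => -[|i]; rewrite mulrC coefMX //=.
by rewrite coef_poly; case: ltnP => // hi; rewrite nth_default // ltnW.
Qed.

Section PolynomialRing.
Variables (B : comNzRingType) (M : idealr B).
Local Notation mpow n := (ideal_pow [set` M] n).

(** The ideal generated by [M] and ['X]. The polynomial ring is not localized there: only its
    completion matters, and [regular_adic] asks locality of the last quotient alone. *)
Definition poly_max : {pred {poly B}} := [pred f : {poly B} | f`_0 \in M].

Lemma poly_max_idealr_closed : idealr_closed poly_max.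
Proof.
split; first by rewrite inE coef0 rpred0.
  by rewrite inE coef1 idealr1.
by move=> a f g; rewrite !inE => fM gM; rewrite coefD coef0M rpredD ?idealMr.
Qed.

HB.instance Definition _ := isIdealr.Build {poly B} poly_max poly_max_idealr_closed.

(** Each factor ['X] saves one factor from [M], so orders are read off coefficientwise; the
    subtraction is truncated, and coefficients of index at least [n] are unrestricted. *)
Lemma ideal_pow_poly n (f : {poly B}) :
  ideal_pow [set` poly_max] n f <-> forall i, mpow (n - i) f`_i.
Proof.
split=> [|h]; last first.
  rewrite -[f]coefK poly_def; apply: (is_ideal_sum (is_ideal_pow poly_max n)) => i.
  rewrite -mul_polyC; apply: (@ideal_pow_le _ poly_max n ((n - i) + i)%N); first by lia.
  apply: ideal_powM; last by apply: ideal_powX; rewrite inE coefX rpred0.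
  apply: (@ideal_pow_map _ _ M poly_max (@polyC B)) => // a aM.
  by rewrite inE coefC eqxx.
elim: n f => [|n IH]; first by [].
apply: (@ideal_powS_sub _ poly_max n (fun f => forall i, mpow (n.+1 - i) f`_i)).
  split=> [i|a f g hf hg i]; first by rewrite coef0; case: (is_ideal_pow M (n.+1 - i)).
  rewrite coefD coefM; apply: (is_idealD (is_ideal_pow M _)); last exact: hg.
  apply: (is_ideal_sum (is_ideal_pow M _)) => j; apply: (is_idealM _ (is_ideal_pow M _)).
  by apply: ideal_pow_le (hf _); lia.
move=> f g; rewrite inE => f0 /IH hg i; rewrite coefM.
apply: (is_ideal_sum (is_ideal_pow M _)) => -[[|j] jlt] /=.
  apply: (@ideal_pow_le _ M _ (n - i).+1); first by lia.
  by apply: ideal_powS_mul => //; rewrite subn0.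
apply: (is_idealM _ (is_ideal_pow M _)); apply: ideal_pow_le (hg _); lia.
Qed.

Lemma regular_adic_poly d : regular_adic d M -> regular_adic d.+1 poly_max.
Proof.
move=> regM; exists 'X, B, M, (horner_eval (0 : B)).
split=> // [|f|f|n f /ideal_pow_poly h].
- split=> [|y]; first by rewrite inE coefX rpred0.
  by exists y%:P; rewrite /= /horner_eval hornerC.
- by rewrite /= /horner_eval horner_coef0; apply: coef0_eq0P.
- by rewrite /= /horner_eval horner_coef0 inE.
- apply/ideal_pow_poly => i; have := h i.+1; by rewrite mulrC coefMX.
Qed.

(** [B] is the hypersurface ['X = 0] in its polynomial ring, so regular points reuse
    [ciq_completion]. *)
Lemma ciq_regular d : regular_adic d M -> complete_intersection_quotient (completion M).
Proof.
move=> regM; have reg1 := regular_adic_poly regM.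
apply: (@ciq_completion d.+1 _ _ poly_max M (horner_eval (0 : B)) 'X 1 reg1).
- by rewrite inE coefX rpred0.
- by move=> y; exists y%:P; rewrite /= /horner_eval hornerC.
- by move=> f; rewrite /= /horner_eval horner_coef0; apply: coef0_eq0P.
- by move=> f; rewrite /= /horner_eval horner_coef0 inE.
- move=> n f /ideal_pow_poly h; apply/ideal_pow_poly => i; have := h i.+1.
  by rewrite mulrC coefMX addn1.
Qed.

(** The coefficient of index [i + 2] in the product is [f_i - b * f_(i+2)]. Going down from the top
    degree, the order of [f_(i+2)] is known, and [b] adds the two orders lost by the shift. *)
Lemma ideal_pow_sqrX_subC (b : B) : mpow 2 b -> forall n (f : {poly B}),
  ideal_pow [set` poly_max] (n + 2) (('X^2 - b%:P) * f) -> ideal_pow [set` poly_max] n f.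
Proof.
move=> b2 n f /ideal_pow_poly h; apply/ideal_pow_poly.
suff: forall k i, (size f <= i + k)%N -> mpow (n - i) f`_i.
  by move=> H i; apply: (H (size f)); rewrite leq_addl.
elim=> [|k IH] i hi.
  rewrite addn0 in hi; rewrite nth_default //; by case: (is_ideal_pow M (n - i)).
have := h i.+2; rewrite mulrBl coefB mulrC coefMXn /= coefCM subn2 /= => h1.
apply: (is_idealBl (y := b * f`_i.+2) (is_ideal_pow M _)); last first.
  by apply: ideal_pow_le h1; lia.
apply: (@ideal_pow_le _ M _ (2 + (n - i.+2))%N); first by lia.
by apply: ideal_powM => //; apply: IH; lia.
Qed.

(* [D = B + B y] is the hypersurface [B[Y] / (Y ^ 2 - b)] over [B]. *)
Lemma ciq_hypersurface d (D : comNzRingType) (MD : idealr D)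
    (iota : {rmorphism B -> D}) (b : B) (y : D) :
  regular_adic d M -> mpow 2 b -> y ^+ 2 = iota b -> y \in MD ->
  (forall r, iota r \in MD <-> r \in M) ->
  (forall x, exists r0 r1, x = iota r0 + iota r1 * y) ->
  (forall r0 r1, iota r0 + iota r1 * y = 0 -> r0 = 0 /\ r1 = 0) ->
  complete_intersection_quotient (completion MD).
Proof.
move=> regM b2 yb yM iM span free.
have cfy : commr_rmorph iota y by move=> r; apply: mulrC.
pose pi : {rmorphism {poly B} -> D} := horner_morph cfy.
have piC r : pi r%:P = iota r by rewrite /pi /= /horner_morph map_polyC hornerC.
have piX : pi 'X = y by rewrite /pi /= /horner_morph map_polyX hornerX.
have bM : b \in M by apply/ideal_pow1E/ideal_powSW.
apply: (@ciq_completion d.+1 _ _ poly_max MD pi ('X^2 - b%:P) 2 (regular_adic_poly regM)).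
- by rewrite inE coefB coefXn coefC sub0r rpredN.
- move=> x; have [r0 [r1 ->]] := span x; exists (r0%:P + r1%:P * 'X).
  by rewrite rmorphD rmorphM /= !piC piX.
- have piF : pi ('X^2 - b%:P) = 0.
    by rewrite rmorphB rmorphXn /= piC piX yb subrr.
  move=> f; split=> [f0|[g ->]]; last by rewrite rmorphM /= piF mul0r.
  have Fmon : 'X^2 - b%:P \is monic by apply: monicXnsubC.
  (* The remainder has degree at most 1, and freeness of [1, y] annihilates it. *)
  have fE := Pdiv.RingMonic.rdivp_eq Fmon f.
  set q := Pdiv.Ring.rdivp _ _ in fE; set r := Pdiv.Ring.rmodp _ _ in fE.
  have : (size r < 3)%N.
    by rewrite -(size_XnsubC b (n := 2)) // Pdiv.Ring.ltn_rmodp monic_neq0.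
  rewrite ltnS => szr.
  have rE : r = (r`_0)%:P + (r`_1)%:P * 'X.
    apply/polyP => -[|[|i]]; rewrite coefD coefMX !coefC /= ?addr0 ?add0r //.
    by rewrite nth_default // (leq_trans szr).
  move: f0; rewrite fE rmorphD rmorphM /= piF mulr0 add0r rE rmorphD rmorphM /= !piC piX.
  by move=> /free[-> ->]; exists q; rewrite mul0r addr0 addr0 mulrC.
- move=> f; rewrite inE -iM.
  have fE : f = (f`_0)%:P + (f - (f`_0)%:P) by rewrite addrC subrK.
  have /coef0_eq0P[g hg] : (f - (f`_0)%:P)`_0 = 0 by rewrite coefB coefC subrr.
  have -> : pi f = iota f`_0 + pi g * y.
    by rewrite {1}fE hg rmorphD rmorphM /= piC piX mulrC.
  by rewrite (rpredDr _ (idealMr (pi g) yM)).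
- exact: ideal_pow_sqrX_subC.
Qed.

End PolynomialRing.

(** * Criteria for systems of one or two parameters *)

Section LowDimension.
Variables (O : comNzRingType) (M : idealr O).
Local Notation mpow n := (ideal_pow [set` M] n).
Hypothesis locM : local_with M.

Lemma regular_adic0 : (forall a, a \in M -> a = 0) -> regular_adic 0 M.
Proof. by []. Qed.

Lemma ex_quotient_idealr (x : O) : x \in M ->
  exists (O' : comNzRingType) (M' : idealr O') (pi : {rmorphism O -> O'}),
    [/\ forall y, exists a, pi a = y, forall a, pi a = 0 <-> exists b, a = x * b,
        forall a, a \in M <-> pi a \in M' & local_with M'].
Proof.
move=> xM.
have [|O' [pi [pisurj piker]]] := ex_quotient (is_ideal_multiples x).
  by move=> [b e]; have := idealMr b xM; rewrite mulrC -e idealr1.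
have kerM a : pi a = 0 -> a \in M by move=> /piker[b ->]; rewrite mulrC idealMr.
have piM a : (exists2 b, b \in M & pi b = pi a) -> a \in M.
  exact: (image_ideal_kernel (is_ideal_idealr M) kerM).
have [||M' M'E] := @ex_idealr O' [set y | exists2 a, a \in M & pi a = y].
- exact: is_ideal_image (is_ideal_idealr M).
- by rewrite -(rmorph1 pi) => /piM; rewrite idealr1.
have M'P y : y \in M' <-> exists2 a, a \in M & pi a = y.
  by rewrite -[is_true _]/([set` M'] y) M'E.
exists O', M', pi; split=> // [a|y].
  by rewrite M'P; split=> [aM|/piM //]; exists a.
have [a <-] := pisurj y => naM.
have /locM[b ab] : a \notin M by apply: contra naM => aM; apply/M'P; exists a.
by exists (pi b); rewrite -rmorphM ab rmorph1.
Qed.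

(** Here [mpow m] consists of multiples of [z ^+ m], so cancelling [z] lowers the order by one. *)
Lemma regular_adic1 (z : O) : z \in M -> (forall a, z * a = 0 -> a = 0) ->
  (forall a, a \in M -> exists b, a = z * b) -> regular_adic 1 M.
Proof.
move=> zM zreg Mz; have [O' [M' [pi [pisurj piker piM loc']]]] := ex_quotient_idealr zM.
exists z, O', M', pi; split=> // [n r|].
  have hJ m a : mpow m a -> exists b, a = z ^+ m * b.
    elim: m a => [|m IH] a; first by exists a; rewrite mul1r.
    apply: (@ideal_powS_sub _ M m (fun a => exists b, a = z ^+ m.+1 * b)).
      exact: is_ideal_multiples.
    by move=> u v /Mz[b ->] /IH[c ->]; exists (b * c); rewrite exprS; ring.
  move=> /(hJ n.+1)[b hb]; have /zreg/eqP : z * (r - z ^+ n * b) = 0.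
    by rewrite mulrBr hb exprS -mulrA subrr.
  rewrite subr_eq0 => /eqP ->; apply: (is_idealMl _ (is_ideal_pow M n)).
  exact: ideal_powX.
split=> // y; have [a <-] := pisurj y => /piM/Mz[b ->]; apply/piker; by exists b.
Qed.

End LowDimension.

(** The sequence [z, h] is regular and generates [M]. Elements of [mpow n.+1] have the form
    [z * u + h ^+ n.+1 * c] with [u] in [mpow n]; if such an element is a multiple of [z], then so
    is [c], and [z] can be cancelled. *)
Lemma regular_adic2 (O : comNzRingType) (M : idealr O) (z h : O) :
  local_with M -> z \in M -> h \in M -> (forall a, z * a = 0 -> a = 0) ->
  (forall a b, h * a = z * b -> exists c, a = z * c) ->
  (forall a, a \in M -> exists b c, a = z * b + h * c) -> regular_adic 2 M.
Proof.
move=> locM zM hM zreg hreg Mzh.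
have [O' [M' [pi [pisurj piker piM loc']]]] := ex_quotient_idealr locM zM.
exists z, O', M', pi; split=> // [n r|]; last first.
  have piz : pi z = 0 by apply/piker; exists 1; rewrite mulr1.
  apply: (@regular_adic1 O' M' loc' (pi h)).
  - exact/piM.
  - move=> y; have [a <-] := pisurj y; rewrite -rmorphM => /piker[b /hreg h'].
    exact/piker.
  - move=> y; have [a <-] := pisurj y => /piM/Mzh[b [c ->]]; exists (pi c).
    by rewrite rmorphD !rmorphM piz mul0r add0r.
have powI m := is_ideal_pow M m.
have hJ m a : ideal_pow [set` M] m.+1 a ->
    exists u c, ideal_pow [set` M] m u /\ a = z * u + h ^+ m.+1 * c.
  have JI k : is_ideal [set a | exists u c, ideal_pow [set` M] k u /\ a = z * u + h ^+ k.+1 * c].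
    split=> [|b _ _ [u [c [hu ->]]] [u' [c' [hu' ->]]]].
      exists 0, 0; rewrite !mulr0 addr0; split=> //; by case: (powI k).
    exists (b * u + u'), (b * c + c'); split; last by ring.
    by case: (powI k) => _; apply.
  elim: m a => [|m IH] a.
    by move=> /ideal_pow1E/Mzh[b [c ->]]; exists b, c; rewrite expr1.
  apply: (@ideal_powS_sub _ M m.+1 _ (JI m.+1)).
  move=> x y /Mzh[b [c ->]] hy; have [u [c' [hu yE]]] := IH _ hy.
  exists (b * y + c * (h * u)), (c * c'); split; last by rewrite mulrDl {2}yE !exprS; ring.
  apply: (is_idealD (powI m.+1)); apply: (is_idealM _ (powI m.+1)) => //.
  exact: ideal_powS_mul.
move=> /(hJ n)[u [c [hu e]]].
have hpow m a b : h ^+ m * a = z * b -> exists c, a = z * c.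
  elim: m a b => [|m IH] a b; first by rewrite mul1r; exists b.
  by rewrite exprS -mulrA => /hreg[b' /IH].
have [c' cE] : exists c', c = z * c'.
  by apply: (hpow n.+1 c (r - u)); rewrite mulrBr e; ring.
have /zreg/eqP : z * (r - u - h ^+ n.+1 * c') = 0.
  by rewrite !mulrBr e cE; ring.
rewrite subr_eq0 subr_eq => /eqP ->; apply: (is_idealD (powI n)) => //.
by apply: (is_idealMl _ (powI n)); apply: ideal_powSW; apply: ideal_powX.
Qed.

(** * Localizations of polynomial rings *)

Lemma local_idealrM (D : comNzRingType) (M : idealr D) (a b : D) :
  local_with M -> a \notin M -> b \notin M -> a * b \notin M.
Proof.
move=> locM /locM[a' aa'] bM; apply: contra bM => abM.
by have := idealMr a' abM; rewrite mulrA [a' * a]mulrC aa' mul1r.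
Qed.

Lemma local_cancel (D : comNzRingType) (M : idealr D) (u a z b : D) :
  local_with M -> u \notin M -> u * a = z * b -> exists c, a = z * c.
Proof.
move=> locM /locM[v uv] e; exists (b * v).
by rewrite mulrA -e -mulrA mulrCA uv mulr1.
Qed.

Lemma size_sub_lead (A : nzRingType) (c : {poly A}) : c != 0 ->
  (size (c - lead_coef c *: 'X^((size c).-1))%R < size c)%N.
Proof.
move=> c0; have sc : size c = (size c).-1.+1 by rewrite prednK // lt0n size_poly_eq0.
rewrite [X in (_ < X)%N]sc ltnS.
apply/leq_sizeP => j hj; rewrite coefB coefZ coefXn.
case: eqP => [->|/eqP nj]; first by rewrite mulr1 subrr.
by rewrite mulr0 subr0 nth_default // sc ltn_neqAle eq_sym nj.
Qed.

Section PrimePolynomial.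
Variables (k : fieldType) (g : {poly k}).
Hypothesis gprime : forall a b : {poly k}, g %| a * b -> g %| a \/ g %| b.

(** Gauss's lemma: a prime [g] of [k[x]] stays prime in [k[x][z]]. Leading terms divisible by [g]
    are discarded, until the product of the leading coefficients decides. *)
Lemma dvdp_polyC_mul (a b : {poly {poly k}}) :
  (forall i, g %| (a * b)`_i) -> (forall i, g %| a`_i) \/ (forall i, g %| b`_i).
Proof.
have [n le_n] := ubnP (size a + size b); elim: n a b le_n => // n IH a b.
rewrite ltnS => le_n gab.
have lower (c : {poly {poly k}}) : g %| lead_coef c -> c != 0 ->
    exists2 c' : {poly {poly k}}, (size c' < size c)%N &
      exists2 l : {poly {poly k}}, c = c' + l & forall i, g %| l`_i.
  move=> gl c0; exists (c - lead_coef c *: 'X^((size c).-1)).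
    exact: size_sub_lead.
  exists (lead_coef c *: 'X^((size c).-1)); first by rewrite subrK.
  by move=> i; rewrite coefZ dvdp_mulr.
have dvdM (l c : {poly {poly k}}) : (forall i, g %| l`_i) -> forall i, g %| (l * c)`_i.
  move=> hl i; rewrite coefM; elim/big_ind: _ => [||j _]; first exact: dvdp0.
    exact: dvdp_add.
  exact: dvdp_mulr.
have [->|a0] := eqVneq a 0; first by left=> i; rewrite coef0 dvdp0.
have [->|b0] := eqVneq b 0; first by right=> i; rewrite coef0 dvdp0.
have [la|la] := boolP (g %| lead_coef a).
  have [a' sa' [l aE gl]] := lower a la a0.
  have [||ga'|gb] := IH a' b; [by lia| |left|by right].
    move=> i; have := gab i; rewrite aE mulrDl coefD => h.
    by rewrite -(dvdp_addl _ (dvdM l b gl i)).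
  by move=> i; rewrite aE coefD dvdp_add.
have [lb|lb] := boolP (g %| lead_coef b).
  have [b' sb' [l bE gl]] := lower b lb b0.
  have [||ga|gb'] := IH a b'; [by lia| |by left|right].
    move=> i; have := gab i; rewrite bE mulrDr coefD => h.
    by rewrite -(dvdp_addl _ (_ : g %| (a * l)`_i)) // mulrC dvdM.
  by move=> i; rewrite bE coefD dvdp_add.
have := gab (size (a * b)).-1; rewrite -/(lead_coef (a * b)) lead_coefM.
by move=> /gprime[h|h]; [rewrite h in la | rewrite h in lb].
Qed.

Lemma dvdp_polyCP (f : {poly {poly k}}) :
  (forall i, g %| f`_i) <-> exists f', f = g%:P * f'.
Proof.
split=> [h|[f' ->] i]; last by rewrite coefCM dvdp_mulr.
exists (\poly_(i < size f) (f`_i %/ g)); apply/polyP => i.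
rewrite coefCM coef_poly; case: ltnP => hi; first by rewrite mulrC divpK.
by rewrite nth_default // mulr0.
Qed.

End PrimePolynomial.

Section LocalizedPolynomialRing.
Variables (k : fieldType) (D : comNzRingType) (M : idealr D).
Hypothesis locM : local_with M.

(** By division with remainder, the preimage of [M] in [k[x]] is generated by any nonzero element of
    least degree. *)
Lemma dvdp_min (theta : {rmorphism {poly k} -> D}) (g : {poly k}) :
  g != 0 -> theta g \in M ->
  (forall a, a != 0 -> theta a \in M -> (size g <= size a)%N) ->
  forall a, theta a \in M -> g %| a.
Proof.
move=> g0 gM gmin a aM; apply: contraT => nga.
have rM : theta (a %% g) \in M.
  have -> : a %% g = a - a %/ g * g by rewrite {2}(divp_eq a g) addrC addKr.
  by rewrite rmorphB rmorphM rpredB // idealMr.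
have := gmin (a %% g); rewrite leqNgt ltn_modp g0 /= => /(_ _ rM) h.
by have := h nga.
Qed.

Lemma ex_min_size (A : nzRingType) (S : set {poly A}) : (exists f, S f) ->
  exists f, S f /\ forall f', S f' -> (size f <= size f')%N.
Proof.
move=> [f Sf]; have : exists n, `[< exists f, S f /\ size f = n >].
  by exists (size f); apply/asboolP; exists f.
move=> ex; case: (ex_minnP ex) => n /asboolP[h [Sh <-]] hmin.
by exists h; split=> // f' Sf'; apply: hmin; apply/asboolP; exists f'.
Qed.

(** Modulo [z] the ring is a localization of a polynomial ring in one variable. So [M] is generated
    by [z], or by [z] and the nonzero polynomial of least degree that it contains. *)
Lemma regular_adic_curve (theta : {rmorphism {poly k} -> D}) (z : D) :
  z \in M -> (forall a, z * a = 0 -> a = 0) ->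
  (forall b, exists f g e, theta g \notin M /\ theta g * b = theta f + z * e) ->
  (forall f e, theta f = z * e -> f = 0) ->
  exists d, regular_adic d M.
Proof.
move=> zM zreg span free.
have Mspan b : b \in M -> exists f g e,
    [/\ theta f \in M, theta g \notin M & theta g * b = theta f + z * e].
  move=> bM; have [f [g [e [gM h]]]] := span b; exists f, g, e; split=> //.
  rewrite -[theta f](addrK (z * e)) -h.
  by apply: rpredB; [|rewrite mulrC]; apply: idealMr.
have [[g0 [g0M g00]]|no] := pselect (exists g, theta g \in M /\ g != 0); last first.
  exists 1%N; apply: (regular_adic1 locM zM zreg) => b /Mspan[f [g [e [fM gM h]]]].
  have f0 : f = 0 by apply: contrapT => /eqP f0; apply: no; exists f.
  by apply: (local_cancel locM gM); rewrite h f0 rmorph0 add0r.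
have [g [[gM gn0] gmin]] : exists g, (theta g \in M /\ g != 0) /\
    forall f', (theta f' \in M /\ f' != 0) -> (size g <= size f')%N.
  by apply: (@ex_min_size k [set g | theta g \in M /\ g != 0]); exists g0.
have gdvd := dvdp_min gn0 gM (fun a a0 aM => gmin a (conj aM a0)).
exists 2%N; apply: (regular_adic2 locM zM gM zreg).
  move=> a b hab; have [f [g' [e [g'M h]]]] := span a.
  have : theta (g * f) = z * (theta g' * b - theta g * e).
    have -> : theta (g * f) = theta g * (theta g' * a - z * e).
      by rewrite rmorphM h addrK.
    by rewrite !mulrBr mulrCA hab; ring.
  move=> /free/eqP; rewrite mulf_eq0 (negPf gn0) /= => /eqP f0.
  by apply: (local_cancel locM g'M); rewrite h f0 rmorph0 add0r.
move=> b /Mspan[f [g' [e [/gdvd/dvdpP[q fE] g'M h]]]].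
have [v g'v] := locM g'M; exists (e * v), (theta q * v).
have -> : b = (theta g' * b) * v by rewrite mulrAC g'v mul1r.
by rewrite h fE rmorphM; ring.
Qed.

(** If [M] contains no nonzero polynomial in the inner variable, one argues as in [k(x)[z]].
    Otherwise those that it contains are the multiples of a prime [g], and one argues modulo [g] as
    in [(k[x]/g)[z]]. *)
Lemma regular_adic_localization (theta : {rmorphism {poly {poly k}} -> D}) :
  (forall a b : D, a * b = 0 -> a = 0 \/ b = 0) ->
  (forall f, theta f = 0 -> f = 0) ->
  (forall d, exists f g, theta g \notin M /\ theta g * d = theta f) ->
  exists d, regular_adic d M.
Proof.
move=> dom inj span.
have reg (z : D) : z != 0 -> forall a, z * a = 0 -> a = 0.
  by move=> z0 a /dom[] // /eqP; rewrite (negPf z0).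
have thetan0 f : f != 0 -> theta f != 0 by apply: contra => /eqP/inj ->.
have Mspan b : b \in M -> exists f g,
    [/\ theta f \in M, theta g \notin M & theta g * b = theta f].
  by move=> bM; have [f [g [gM h]]] := span b; exists f, g; rewrite -h idealMr.
(* Pseudo-division: the multiplier is a power of the leading coefficient of [f], which both uses
   below show to be outside [M]. *)
have pdiv (f r : {poly {poly k}}) : theta f \in M -> theta r \in M -> f != 0 ->
    exists q rem n, [/\ theta rem \in M, (size rem < size f)%N &
      (lead_coef f ^+ n)%:P * r = q * f + rem].
  move=> fM rM f0; have := Pdiv.ComRing.rdivp_eq f r.
  set q := Pdiv.Ring.rdivp r f; set rem := Pdiv.Ring.rmodp r f; set n := Pdiv.Ring.rscalp r f => e.
  exists q, rem, n; rewrite Pdiv.Ring.ltn_rmodp f0 mul_polyC e; split=> //.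
  have -> : rem = lead_coef f ^+ n *: r - q * f by rewrite e addrC addKr.
  by rewrite rmorphB -mul_polyC !rmorphM rpredB // idealMr.
have [[g0 [g0M g00]]|no] := pselect (exists g : {poly k}, theta g%:P \in M /\ g != 0); last first.
  have constM (c : {poly k}) n : c != 0 -> theta (c ^+ n)%:P \notin M.
    move=> c0; apply/negP => h; apply: no; exists (c ^+ n); split=> //.
    by rewrite expf_neq0.
  have [[f0 [f0M f00]]|no'] := pselect (exists f, theta f \in M /\ f != 0); last first.
    exists 0%N; apply: regular_adic0 => // b /Mspan[f [g [fM gM h]]].
    have f0 : f = 0 by apply: contrapT => /eqP f0; apply: no'; exists f.
    have [v gv] := locM gM.
    by rewrite -[b]mul1r -gv mulrAC h f0 rmorph0 mul0r.
  have [f [[fM fn0] fmin]] : exists f, (theta f \in M /\ f != 0) /\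
      forall f', (theta f' \in M /\ f' != 0) -> (size f <= size f')%N.
    by apply: (@ex_min_size _ [set g | theta g \in M /\ g != 0]); exists f0.
  exists 1%N; apply: (regular_adic1 locM fM (reg _ (thetan0 _ fn0))).
  move=> b /Mspan[r [g [rM gM h]]]; have [q [rem [n [remM szrem e]]]] := pdiv f r fM rM fn0.
  have rem0 : rem = 0.
    apply/eqP; apply: contraT => rem0.
    by have := fmin rem (conj remM rem0); rewrite leqNgt szrem.
  apply: (local_cancel (b := theta q) locM (local_idealrM locM (constM (lead_coef f) n _) gM)).
    by rewrite lead_coef_eq0.
  by rewrite -mulrA h -rmorphM e rem0 addr0 mulrC rmorphM.
pose thetaC : {rmorphism {poly k} -> D} := (theta \o polyC).
have [g [[gM gn0] gmin]] : exists g, (thetaC g \in M /\ g != 0) /\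
    forall f', (thetaC f' \in M /\ f' != 0) -> (size g <= size f')%N.
  by apply: (@ex_min_size k [set g | thetaC g \in M /\ g != 0]); exists g0.
have gdvd := dvdp_min gn0 gM (fun a a0 aM => gmin a (conj aM a0)).
have gprime (a b : {poly k}) : g %| a * b -> g %| a \/ g %| b.
  move=> /dvdpP[q qE]; have abM : thetaC a * thetaC b \in M.
    by rewrite -rmorphM qE rmorphM idealMr.
  have [/gdvd|aM] := boolP (thetaC a \in M); first by left.
  have [/gdvd|bM] := boolP (thetaC b \in M); first by right.
  by have := local_idealrM locM aM bM; rewrite abM.
pose gdiv (f : {poly {poly k}}) := forall i, g %| f`_i.
have gdivM f : gdiv f -> theta f \in M.
  by move=> /dvdp_polyCP[f' ->]; rewrite rmorphM mulrC idealMr.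
have gPn0 : g%:P != 0 by rewrite polyC_eq0.
have zreg := reg _ (thetan0 _ gPn0).
have [[f0 [f0M f0g]]|no] := pselect (exists f, theta f \in M /\ ~ gdiv f); last first.
  exists 1%N; apply: (regular_adic1 locM gM zreg) => b /Mspan[r [g' [rM g'M h]]].
  have /dvdp_polyCP[r' rE] : gdiv r by apply: contrapT => nr; apply: no; exists r.
  by apply: (local_cancel (b := theta r') locM g'M); rewrite h rE rmorphM.
have [f [[fM fg] fmin]] : exists f, (theta f \in M /\ ~ gdiv f) /\
    forall f', (theta f' \in M /\ ~ gdiv f') -> (size f <= size f')%N.
  by apply: (@ex_min_size _ [set f | theta f \in M /\ ~ gdiv f]); exists f0.
have fn0 : f != 0 by apply/eqP => f0'; apply: fg => i; rewrite f0' coef0 dvdp0.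
(* If [g] divided the leading coefficient, removing the leading term of [f] would contradict
   minimality. *)
have leadM : thetaC (lead_coef f) \notin M.
  apply/negP => /gdvd gl.
  have gl' : gdiv (lead_coef f *: 'X^((size f).-1)).
    by move=> i; rewrite coefZ dvdp_mulr.
  have := fmin (f - lead_coef f *: 'X^((size f).-1)).
  rewrite leqNgt size_sub_lead //= => abs; apply: notF; apply: abs; split.
    by rewrite rmorphB rpredB // gdivM.
  move=> h; apply: fg => i.
  by rewrite -(subrK (lead_coef f *: 'X^((size f).-1)) f) coefD dvdp_add.
exists 2%N; apply: (regular_adic2 locM gM fM zreg).
  (* After clearing denominators [g] divides [f * m * e']; by Gauss's lemma it divides the numerator
     [m] of [a]. *)
  move=> a b hab; have [m [e [eM ha]]] := span a; have [n [e' [e'M hb]]] := span b.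
  have : theta (f * m * e' - g%:P * n * e) = 0.
    rewrite rmorphB !rmorphM -ha -hb.
    rewrite (_ : _ - _ = theta e * theta e' * (theta f * a - theta g%:P * b)); last by ring.
    by rewrite hab subrr mulr0.
  move=> /inj/eqP; rewrite subr_eq0 => /eqP heq.
  have : gdiv (f * m * e') by apply/dvdp_polyCP; exists (n * e); rewrite heq mulrA.
  move=> /(dvdp_polyC_mul gprime)[/(dvdp_polyC_mul gprime)[//|/dvdp_polyCP[m' mE]]|/gdivM].
    by apply: (local_cancel (b := theta m') locM eM); rewrite ha mE rmorphM.
  by rewrite (negPf e'M).
move=> b /Mspan[r [e [rM eM h]]]; have [q [rem [n [remM szrem hr]]]] := pdiv f r fM rM fn0.
have /dvdp_polyCP[rem' remE] : gdiv rem.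
  by apply: contrapT => nrem; have := fmin rem (conj remM nrem); rewrite leqNgt szrem.
have cM : theta (lead_coef f ^+ n)%:P \notin M.
  elim: (n) => [|j IHj]; first by rewrite expr0 rmorph1 idealr1.
  by rewrite exprS polyCM rmorphM; apply: local_idealrM.
have [v cv] := locM (local_idealrM locM cM eM).
exists (theta rem' * v), (theta q * v).
have -> : b = (theta (lead_coef f ^+ n)%:P * theta e * b) * v by rewrite mulrAC cv mul1r.
by rewrite -[_ * theta e * b]mulrA h -rmorphM hr remE rmorphD !rmorphM; ring.
Qed.

End LocalizedPolynomialRing.

(** * Finitely generated algebras *)

(** A field is the case of no parameters. *)
Lemma noetherian_field (k : fieldType) : noetherian k.
Proof.
by apply: (@regular_complete_noetherian 0) => x x0; exists x^-1; rewrite mulfV.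
Qed.

(** Hilbert's basis theorem: [L n] collects the coefficients of index [n] of the members of [I] of
    degree at most [n], and generators of [L 0], ..., [L N] lift to generators of [I]. *)
Lemma noetherian_poly (R : comNzRingType) : noetherian R -> noetherian {poly R}.
Proof.
move=> noeth I II.
pose L n := [set a | exists f : {poly R}, [/\ I f, (size f <= n.+1)%N & f`_n = a]].
have LI n : is_ideal (L n).
  split=> [|a _ _ [f [If sf <-]] [g [Ig sg <-]]].
    by exists 0; rewrite size_poly0 coef0; split=> //; case: II.
  exists (a%:P * f + g); rewrite coefD coefCM; split=> //.
    by case: II => _; apply.
  rewrite (leq_trans (size_polyD _ _)) // geq_max sg andbT mul_polyC.
  exact: leq_trans (size_scale_leq _ _) sf.
have Lmono n : L n `<=` L n.+1.
  move=> _ [f [If sf <-]]; exists (f * 'X); split; first exact: is_idealMl.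
    have [->|f0] := eqVneq f 0; first by rewrite mul0r size_poly0.
    by rewrite size_mulX.
  by rewrite coefMX.
have [N LN] := noetherian_acc noeth LI Lmono.
have Lgen n : exists s : seq {poly R}, (forall g, g \in s -> I g) /\
    forall f, I f -> (size f <= n.+1)%N -> exists c : nat -> R,
      (size (f - \sum_(i < size s) (c i)%:P * s`_i)%R <= n)%N.
  have [s Ls] := noeth _ (LI n).
  have lift i : exists g : {poly R}, [/\ I g, (size g <= n.+1)%N & ((i < size s)%N -> g`_n = s`_i)].
    have [ilt|_] := boolP (i < size s)%N; last first.
      by exists 0; rewrite size_poly0; split=> //; case: II.
    have [g [Ig sg gE]] : L n s`_i by rewrite Ls; apply: ideal_gen_mem => /=; rewrite mem_nth.
    by exists g.
  have [g hg] := choice lift.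
  exists (mkseq g (size s)); rewrite size_mkseq; split=> [h /mapP[i _ ->]|f If sf].
    by have [] := hg i.
  have : L n f`_n by exists f.
  rewrite Ls => /ideal_gen_seqP[c hc]; exists c; apply/leq_sizeP => j.
  rewrite leq_eqVlt coefB coef_sum => /orP[/eqP <-|nj].
    rewrite hc -sumrB big1 // => i _; rewrite coefCM nth_mkseq //.
    by have [_ _ ->] := hg i; rewrite ?subrr.
  rewrite nth_default ?(leq_trans sf) // sub0r big1 ?oppr0 // => i _.
  rewrite coefCM nth_mkseq // nth_default ?mulr0 //.
  by have [_ sg _] := hg i; apply: leq_trans sg nj.
have [S hS] := choice Lgen.
pose G := flatten [seq S n | n <- iota 0 N.+1].
have GI := is_ideal_gen [set` G].
exists G; apply/seteqP; split; last first.
  apply: (@ideal_gen_sub _ _ I) => // g /flattenP[_ /mapP[n _ ->] gS].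
  by have [h _] := hS n; apply: h.
move=> f If; have [n sf] := ubnP (size f); elim: n f If sf => // n IH f If.
case: n IH => [|n] IH.
  by rewrite ltnS leqn0 size_poly_eq0 => /eqP ->; case: GI.
rewrite ltnS => sf; have [nN|Nn] := leqP n N.
  have [hI h] := hS n; have [c hc] := h f If sf.
  have GIS i : (i < size (S n))%N -> ideal_gen [set` G] (S n)`_i.
    move=> ilt; apply: ideal_gen_mem => /=; apply/flattenP; exists (S n).
      by apply/mapP; exists n => //; rewrite mem_iota.
    by rewrite mem_nth.
  apply: (is_idealBl (y := \sum_(i < size (S n)) (c i)%:P * (S n)`_i) GI).
    by apply: (is_ideal_sum GI) => i; apply: (is_idealM _ GI); apply: GIS.
  apply: IH; last by rewrite ltnS.
  apply: is_idealB => //; apply: is_ideal_sum => // i; apply: is_idealM => //.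
  by apply: hI; rewrite mem_nth.
(* Beyond degree [N] the leading coefficient already occurs in degree [N]; a power of ['X] moves it
   up. *)
have [g [Ig sg gE]] : L N f`_n by apply: (LN n); exists f.
apply: (is_idealBl (y := 'X^(n - N) * g) GI).
  apply: (is_idealM _ GI); apply: IH => //; rewrite ltnS; exact: leq_trans sg Nn.
apply: IH; first by apply: is_idealB => //; apply: is_idealM.
rewrite ltnS; apply/leq_sizeP => j; rewrite leq_eqVlt coefB mulrC coefMXn.
move=> /orP[/eqP <-|nj].
  by rewrite ltnNge leq_subr /= subKn ?(ltnW Nn) // gE subrr.
rewrite nth_default ?(leq_trans sf) // ltnNge (leq_trans (leq_subr _ _) (ltnW nj)) /=.
rewrite nth_default ?subrr //; apply: leq_trans sg _.
by lia.
Qed.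

Lemma noetherian_range (N K : comNzRingType) (f : {rmorphism N -> K}) (T : subringClosed K) :
  noetherian N -> (forall x, x \in T <-> exists n, f n = x) -> noetherian (subring_of T).
Proof.
move=> noeth hT; pose toT n : subring_of T := exist _ (f n) (proj2 (hT (f n)) (ex_intro _ n erefl)).
have [|x y|x y|g gE] := @ex_rmorphism N (subring_of T) toT.
- by apply: val_inj; rewrite /= rmorph1.
- by apply: val_inj; rewrite /= rmorphD.
- by apply: val_inj; rewrite /= rmorphM.
have gsurj y : exists x, g x = y.
  have /hT[n nE] := valP y; exists n; rewrite gE; exact: val_inj.
move=> I II; have [s Js] := noeth _ (is_ideal_preimage g II).
exists (map g s); apply/seteqP; split=> y; last first.
  apply: (@ideal_gen_sub _ _ I) => // _ /mapP[x xs ->].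
  have : ideal_gen [set` s] x by apply: ideal_gen_mem.
  by rewrite -Js.
have [x <-] := gsurj y => Ix; have : [set a | I (g a)] x by [].
rewrite Js => /ideal_gen_seqP[c ->]; apply/ideal_gen_seqP.
exists (fun i => g (c i)); rewrite size_map rmorph_sum; apply: eq_bigr => i _.
by rewrite rmorphM (nth_map 0).
Qed.

(* Otherwise [apply] unfolds [adjoin] into the product that defines it. *)
#[local] Opaque adjoin.

Section QuadraticSpan.
Variables (R : comNzRingType) (S : set R) (x z : R).
Hypothesis SD : forall u v, S u -> S v -> S (u + v).
Hypothesis SB : forall u v, S u -> S v -> S (u - v).
Hypothesis SM : forall u v, S u -> S v -> S (u * v).
Hypotheses (Sx : S (x ^+ 2)) (Sz : S (z ^+ 2)).

(** Stable under products because [x ^+ 2] and [z ^+ 2] lie in [S]. For [S = k[x^2, z^2]] it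
    contains all of [k[x, z]]. *)
Definition quad_span : set R := [set a | exists c0 c1 c2 c3,
  [/\ S c0, S c1, S c2, S c3 & a = c0 + c1 * x + c2 * z + c3 * (x * z)]].

Lemma quad_spanB a b : quad_span a -> quad_span b -> quad_span (a - b).
Proof.
move=> [c0 [c1 [c2 [c3 [h0 h1 h2 h3 ->]]]]] [d0 [d1 [d2 [d3 [g0 g1 g2 g3 ->]]]]].
by exists (c0 - d0), (c1 - d1), (c2 - d2), (c3 - d3); split; try exact: SB; ring.
Qed.

Lemma quad_spanM a b : quad_span a -> quad_span b -> quad_span (a * b).
Proof.
move=> [c0 [c1 [c2 [c3 [h0 h1 h2 h3 ->]]]]] [d0 [d1 [d2 [d3 [g0 g1 g2 g3 ->]]]]].
exists (c0 * d0 + x ^+ 2 * (c1 * d1) + z ^+ 2 * (c2 * d2) + x ^+ 2 * (z ^+ 2 * (c3 * d3))),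
  (c0 * d1 + c1 * d0 + z ^+ 2 * (c2 * d3) + z ^+ 2 * (c3 * d2)),
  (c0 * d2 + c2 * d0 + x ^+ 2 * (c1 * d3) + x ^+ 2 * (c3 * d1)),
  (c0 * d3 + c3 * d0 + c1 * d2 + c2 * d1).
by split; last ring; repeat (assumption || apply SD || apply SM).
Qed.

Lemma quad_span_base c : S 0 -> S c -> quad_span c.
Proof. by exists c, 0, 0, 0; split=> //; ring. Qed.

Lemma quad_span_x : S 0 -> S 1 -> quad_span x.
Proof. by exists 0, 1, 0, 0; split=> //; ring. Qed.

Lemma quad_span_z : S 0 -> S 1 -> quad_span z.
Proof. by exists 0, 0, 1, 0; split=> //; ring. Qed.

(** Used with [b = z ^+ 2]: a property of all sections vanishing on [B] is reduced to four
    products. *)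
Lemma quad_span_scale (T : set R) (b : R) :
  (forall u v, T u -> T v -> T (u + v)) -> (forall c u, S c -> T u -> T (c * u)) ->
  T b -> T (b * x) -> T (b * z) -> T (b * (x * z)) ->
  forall a, quad_span a -> T (b * a).
Proof.
move=> TD TM T0 Tx Tz Txz _ [c0 [c1 [c2 [c3 [h0 h1 h2 h3 ->]]]]].
rewrite (_ : b * _ = c0 * b + c1 * (b * x) + c2 * (b * z) + c3 * (b * (x * z))).
  by repeat (assumption || apply TD || apply TM).
by ring.
Qed.

End QuadraticSpan.

Lemma constK_rmorphism (k : fieldType) :
  exists f : {rmorphism k -> ratfun k}, f =1 @constK k.
Proof.
apply: ex_rmorphism => [|x y|x y]; first by rewrite /constK !rmorph1.
  by rewrite /constK !rmorphD.
by rewrite /constK !rmorphM.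
Qed.

Section Adjoin.
Variable k : fieldType.
Notation K := (ratfun k).
Implicit Types (s : seq K) (x y z : K).

Lemma subalgebraM (S : set K) x y : is_subalgebra S -> S x -> S y -> S (x * y).
Proof. by case=> _ _; apply. Qed.

Lemma subalgebraB (S : set K) x y : is_subalgebra S -> S x -> S y -> S (x - y).
Proof. by case=> _ h _; apply: h. Qed.

Lemma subalgebra_const (S : set K) c : is_subalgebra S -> S (constK c).
Proof. by case. Qed.

Lemma subalgebra0 (S : set K) : is_subalgebra S -> S 0.
Proof. by move=> SS; rewrite -(subrr 1); apply: subalgebraB => //; apply: subalgebra1. Qed.

Lemma adjoin_head a s : adjoin (a :: s) a.
Proof. by apply: adjoin_mem; apply: mem_head. Qed.

Lemma adjoin_cons a s x : adjoin s x -> adjoin (a :: s) x.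
Proof.
apply: adjoin_sub; first exact: is_subalgebra_adjoin.
by move=> y ys; apply: adjoin_mem; rewrite in_cons ys orbT.
Qed.

(** Adjoining one element passes from a ring mapping onto the subalgebra to its polynomial ring. *)
Lemma adjoin_noetherian s : exists (N : comNzRingType) (f : {rmorphism N -> K}),
  noetherian N /\ forall x, adjoin s x <-> exists n, f n = x.
Proof.
elim: s => [|a s [N [f [noeth fE]]]].
  have [f fE] := constK_rmorphism k.
  exists k, f; split; first exact: noetherian_field.
  move=> x; split=> [|[c <-]]; last by rewrite fE; exact: (subalgebra_const c (is_subalgebra_adjoin _)).
  apply: (@adjoin_sub _ _ [set x | exists n, f n = x]) => //.
  split=> [c|_ _ [c <-] [d <-]|_ _ [c <-] [d <-]].
  - by exists c; apply: fE.
  - by exists (c - d); rewrite rmorphB.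
  - by exists (c * d); rewrite rmorphM.
have cfa : commr_rmorph f a by move=> r; apply: mulrC.
pose g : {rmorphism {poly N} -> K} := horner_morph cfa.
have gC r : g r%:P = f r by rewrite /g /= /horner_morph map_polyC hornerC.
have gX : g 'X = a by rewrite /g /= /horner_morph map_polyX hornerX.
exists {poly N}, g; split; first exact: noetherian_poly.
move=> x; split=> [|[h <-]].
  apply: (@adjoin_sub _ _ [set x | exists n, g n = x]).
    split=> [c|_ _ [c <-] [d <-]|_ _ [c <-] [d <-]].
    - have /fE[n hn] : adjoin s (constK c) by exact: (subalgebra_const c (is_subalgebra_adjoin _)).
      by exists n%:P; rewrite gC.
    - by exists (c - d); rewrite rmorphB.
    - by exists (c * d); rewrite rmorphM.
  move=> y; rewrite inE => /orP[/eqP ->|ys]; first by exists 'X.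
  have /fE[n hn] : adjoin s y by apply: adjoin_mem.
  by exists n%:P; rewrite gC.
have SA := is_subalgebra_adjoin (a :: s).
have sub y : adjoin s y -> adjoin (a :: s) y.
  by apply: adjoin_sub => // z zs; apply: adjoin_mem; rewrite inE zs orbT.
apply: (@poly_ind _ (fun h => adjoin (a :: s) (g h))) => [|{}h c IH]; first by rewrite rmorph0; apply: subalgebra0.
rewrite rmorphD rmorphM gX gC; apply: (subalgebraD SA).
  by apply: (subalgebraM SA) => //; apply: adjoin_mem; rewrite inE eqxx.
exact: (sub _ (proj2 (fE _) (ex_intro _ c erefl))).
Qed.

Lemma noetherian_adjoin s (T : subringClosed K) :
  (forall x, x \in T <-> adjoin s x) -> noetherian (subring_of T).
Proof.
move=> TE; have [N [f [noeth fE]]] := adjoin_noetherian s.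
by apply: (noetherian_range (f := f) noeth) => x; rewrite TE.
Qed.

Hypothesis hk : 2%N \in [pchar k].

Lemma constK2 : (2%:R : K) = 0.
Proof.
have [f _] := constK_rmorphism k.
by rewrite -(rmorph_nat f) (pcharf0 hk) rmorph0.
Qed.

(** Squaring is additive in characteristic 2 and sends constants to constants. *)
Lemma adjoin_sqr x z a : adjoin [:: x; z] a -> adjoin [:: x ^+ 2; z ^+ 2] (a ^+ 2).
Proof.
have SA := is_subalgebra_adjoin [:: x ^+ 2; z ^+ 2].
apply: (@adjoin_sub _ _ [set a | adjoin [:: x ^+ 2; z ^+ 2] (a ^+ 2)]).
  split=> [c|a' b ha hb|a' b ha hb] /=.
  - have -> : constK c ^+ 2 = constK (c ^+ 2) by rewrite /constK !rmorphXn.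
    exact: subalgebra_const.
  - rewrite sqrrB -mulr_natl constK2 mul0r subr0; exact: (subalgebraD SA).
  - by rewrite exprMn; apply: (subalgebraM SA).
by move=> y; rewrite !inE => /orP[]/eqP -> /=; apply: adjoin_mem; rewrite !inE eqxx ?orbT.
Qed.

Lemma adjoin_span x z a : adjoin [:: x; z] a ->
  quad_span (adjoin [:: x ^+ 2; z ^+ 2]) x z a.
Proof.
set S := adjoin [:: x ^+ 2; z ^+ 2].
have SA : is_subalgebra S by apply: is_subalgebra_adjoin.
have S0 := subalgebra0 SA; have S1 := subalgebra1 SA.
have Sx : S (x ^+ 2) by apply: adjoin_head.
have Sz : S (z ^+ 2) by apply: adjoin_cons; apply: adjoin_head.
apply: (@adjoin_sub _ _ (quad_span S x z)).
  split=> [c|b c|b c].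
  - apply: quad_span_base S0 _; exact: (subalgebra_const c SA).
  - by apply: quad_spanB => u v; apply: (subalgebraB SA).
  - apply: quad_spanM Sx Sz b c => u v; [exact: (subalgebraD SA) | exact: (subalgebraM SA)].
move=> y; rewrite !inE => /orP[]/eqP ->; [exact: quad_span_x S0 S1 | exact: quad_span_z S0 S1].
Qed.

(** The sections vanishing on [B] are [z ^+ 2 * h], and [h] is a combination of [1, x, z, xz] over
    [k[x^2, z^2]]. Once [x ^+ 2] is a section, this yields a finite list of generators, hence
    noetherianity and the means to compare charts. *)
Lemma pushout_ring_adjoin x z (gC : seq K) :
  (forall g, g \in gC -> adjoin [:: x; z] g) ->
  pushout_ring (adjoin [:: x; z]) z (adjoin gC) (x ^+ 2) ->
  forall f, pushout_ring (adjoin [:: x; z]) z (adjoin gC) f <->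
    adjoin ([:: x ^+ 2; z ^+ 2; z ^+ 2 * x; z ^+ 2 * z; z ^+ 2 * (x * z)] ++ gC) f.
Proof.
set s := _ ++ gC => gCx hx2.
have XS := is_subalgebra_adjoin [:: x; z]; have SS := is_subalgebra_adjoin s.
have CS := is_subalgebra_adjoin gC.
have CX y : adjoin gC y -> adjoin [:: x; z] y by apply: adjoin_sub.
have PS := is_subalgebra_pushout_ring z XS CS CX.
have Xx : adjoin [:: x; z] x by apply: adjoin_head.
have Xz : adjoin [:: x; z] z by apply: adjoin_cons; apply: adjoin_head.
have Pz2 h : adjoin [:: x; z] h -> pushout_ring (adjoin [:: x; z]) z (adjoin gC) (z ^+ 2 * h).
  move=> Xh; split; first by apply: (subalgebraM XS) => //; apply: (subalgebraX _ XS).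
  by exists 0; [exact: subalgebra0 | exists h; rewrite ?subr0].
have PC g : adjoin gC g -> pushout_ring (adjoin [:: x; z]) z (adjoin gC) g.
  move=> Cg; split; first exact: CX.
  by exists g => //; exists 0; [exact: subalgebra0 | rewrite subrr mulr0].
move=> f; split.
  move=> [Xf [g Cg [h Xh e]]]; rewrite -(subrK g f) e.
  apply: (subalgebraD SS); last first.
    by apply: adjoin_sub Cg => // y yg; apply: adjoin_mem; rewrite mem_cat yg orbT.
  have sub c : adjoin [:: x ^+ 2; z ^+ 2] c -> adjoin s c.
    apply: (adjoin_sub SS) => y; rewrite !inE => /orP[]/eqP ->; first exact: adjoin_head.
    by apply: adjoin_cons; apply: adjoin_head.
  apply: (quad_span_scale _ _ _ _ _ _ (adjoin_span Xh)).
  - by move=> u v; apply: (subalgebraD SS).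
  - by move=> c u /sub Sc; apply: (subalgebraM SS).
  - by do 1!apply: adjoin_cons; apply: adjoin_head.
  - by do 2!apply: adjoin_cons; apply: adjoin_head.
  - by do 3!apply: adjoin_cons; apply: adjoin_head.
  - by do 4!apply: adjoin_cons; apply: adjoin_head.
apply: adjoin_sub => // y; rewrite mem_cat => /orP[|yC].
  rewrite !inE => /or4P[/eqP -> //|/eqP ->|/eqP ->|/orP[]/eqP ->].
  - rewrite -[z ^+ 2]mulr1; apply: Pz2; exact: subalgebra1 XS.
  - exact: Pz2.
  - exact: Pz2.
  - by apply: Pz2; apply: (subalgebraM XS).
by apply: PC; apply: adjoin_mem.
Qed.

End Adjoin.

(** * Local rings of fields of rational functions *)

Lemma lift_rmorphism (A D K : comNzRingType) (iota : {rmorphism D -> K})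
    (f : {rmorphism A -> K}) : injective iota ->
  (forall a, exists d, iota d = f a) ->
  exists g : {rmorphism A -> D}, forall a, iota (g a) = f a.
Proof.
move=> inj h; have [g0 g0E] := choice h.
have [|a b|a b|g gE] := @ex_rmorphism A D g0.
- by apply: inj; rewrite g0E !rmorph1.
- by apply: inj; rewrite rmorphD !g0E rmorphD.
- by apply: inj; rewrite rmorphM !g0E rmorphM.
by exists g => a; rewrite gE.
Qed.

Section Localizes.
Variables (K : fieldType).

(* [D] is, inside [K], the localization of [S] at the trace of [M]. *)
Definition localizes (S : set K) (D : comNzRingType) (M : idealr D)
    (iota : {rmorphism D -> K}) : Prop :=
  [/\ local_with M, injective iota, forall a, S a -> exists d, iota d = a
    & forall d, exists a b, [/\ S (iota a), S (iota b), b \notin M & b * d = a]].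

Lemma localizes_local_ring (A : subringClosed K) (p : prime_idealr (subring_of A)) :
  localizes [set x | x \in A] (local_max p) (val : {rmorphism local_ring p -> K}).
Proof.
have toD (a : subring_of A) : exists d : local_ring p, val d = val a.
  have h : val a \in localization p.
    by apply/asboolP; exists a, 1; rewrite idealr1 divr1.
  by exists (exist _ (val a) h).
split.
- move=> d dM; have /asboolP[a [b [bp dE]]] := valP d.
  have ap : a \notin p.
    by apply: contra dM => ap; apply/asboolP; exists a, b.
  have h : val b / val a \in localization p by apply/asboolP; exists b, a.
  exists (exist _ (val b / val a) h); apply: val_inj; rewrite /= dE mulf_div [val b * _]mulrC.
  by rewrite divff // mulf_neq0 ?(notin_prime_neq0 ap) ?(notin_prime_neq0 bp).
- exact: val_inj.
- by move=> a aA; have [d dE] := toD (exist _ a aA); exists d.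
- move=> d; have /asboolP[a [b [bp dE]]] := valP d.
  have [a' a'E] := toD a; have [b' b'E] := toD b; exists a', b'; split.
  + by rewrite /= a'E; apply: (valP a).
  + by rewrite /= b'E; apply: (valP b).
  + apply/negP => /asboolP[c [e [cp ep]]]; rewrite b'E => bE.
    have bec : b * e = c.
      by apply: val_inj; rewrite /= bE divfK ?(notin_prime_neq0 ep).
    by move: cp; rewrite -bec prime_idealrM (negPf bp) (negPf ep).
  + by apply: val_inj; rewrite /= dE a'E b'E mulrCA divff ?mulr1 ?(notin_prime_neq0 bp).
Qed.

Variables (D : comNzRingType) (M : idealr D) (iota : {rmorphism D -> K}).

Lemma localizes_domain S : localizes S M iota ->
  forall a b : D, a * b = 0 -> a = 0 \/ b = 0.
Proof.
move=> [_ inj _ _] a b /(congr1 iota)/eqP.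
rewrite rmorphM rmorph0 mulf_eq0 => /orP[]/eqP h; [left|right]; apply: inj;
  by rewrite h rmorph0.
Qed.

(** A stalk over one chart is a stalk over another when the elements of [S] are fractions over [T]
    whose denominators are units of [D]. *)
Lemma localizes_change (S T : set K) : localizes S M iota ->
  (forall a b, T a -> T b -> T (a * b)) -> (forall a, T a -> exists d, iota d = a) ->
  (forall a, S a -> exists b, [/\ b \notin M, T (iota b) & T (iota b * a)]) ->
  localizes T M iota.
Proof.
move=> [loc inj sD frac] TM TD ST; split=> // d.
have [a [b [Sa Sb bM e]]] := frac d.
have [a1 [a1M Ta1 Ta1a]] := ST _ Sa; have [b1 [b1M Tb1 Tb1b]] := ST _ Sb.
exists (b1 * (a1 * a)), (a1 * (b1 * b)); split.
- by rewrite !rmorphM; apply: TM => //.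
- by rewrite !rmorphM; apply: TM.
- by do 2?apply: local_idealrM.
- by rewrite -e; ring.
Qed.

(** [B] is the ring of those elements of [D] that are fractions over [S1] with denominator outside
    [M]; the trace of [M] is its maximal ideal. The last clause recognizes its elements inside
    [D]. *)
Lemma ex_sublocal (S S1 : set K) : localizes S M iota ->
  S1 1 -> (forall a b, S1 a -> S1 b -> S1 (a - b)) ->
  (forall a b, S1 a -> S1 b -> S1 (a * b)) -> (forall a, S1 a -> exists d, iota d = a) ->
  exists (B : comNzRingType) (MB : idealr B) (j : {rmorphism B -> D}),
    [/\ localizes S1 MB (iota \o j), forall r, j r \in M <-> r \in MB
      & forall a b d, S1 (iota a) -> S1 (iota b) -> b \notin M -> b * d = a -> exists r, j r = d].
Proof.
move=> [loc inj _ _] S11 S1B S1M S1D.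
pose B0 := [pred d : D | `[< exists a b, [/\ S1 (iota a), S1 (iota b), b \notin M & b * d = a] >]].
have B0cl : subring_closed B0.
  split.
  - by apply/asboolP; exists 1, 1; rewrite rmorph1 idealr1 mulr1.
  - move=> d d' /asboolP[a [b [ha hb bM e]]] /asboolP[a' [b' [ha' hb' bM' e']]].
    apply/asboolP; exists (b' * a - b * a'), (b * b'); split.
    + by rewrite rmorphB !rmorphM; apply: S1B; apply: S1M.
    + by rewrite rmorphM; apply: S1M.
    + exact: local_idealrM.
    + by rewrite -e -e'; ring.
  - move=> d d' /asboolP[a [b [ha hb bM e]]] /asboolP[a' [b' [ha' hb' bM' e']]].
    apply/asboolP; exists (a * a'), (b * b'); split.
    + by rewrite rmorphM; apply: S1M.
    + by rewrite rmorphM; apply: S1M.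
    + exact: local_idealrM.
    + by rewrite -e -e'; ring.
pose B : subringClosed D := HB.pack_for (subringClosed D) (B0 : D -> bool)
  (GRing.isSubringClosed.Build D B0 B0cl).
have [j jE] : exists j : {rmorphism subring_of B -> D}, forall r, j r = val r.
  by exists val.
have jinj : injective j by move=> r r'; rewrite !jE; apply: val_inj.
have jB r : exists a b, [/\ S1 (iota a), S1 (iota b), b \notin M & b * j r = a].
  by have /asboolP := valP r; rewrite jE.
have [||MB MBE] := @ex_idealr (subring_of B) [set r | j r \in M].
- exact: is_ideal_preimage (is_ideal_idealr M).
- by rewrite /= rmorph1 idealr1.
have MBP r : j r \in M <-> r \in MB by rewrite -[is_true (r \in MB)]/([set` MB] r) MBE.
have lift a b d : S1 (iota a) -> S1 (iota b) -> b \notin M -> b * d = a -> exists r, j r = d.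
  move=> ha hb bM e; have h : d \in B by apply/asboolP; exists a, b.
  by exists (exist _ d h); rewrite jE.
have lift1 a : S1 (iota a) -> exists r, j r = a.
  by move=> ha; apply: (lift a 1); rewrite ?rmorph1 ?idealr1 ?mul1r.
exists (subring_of B), MB, j; split=> //; split.
- move=> r rM; have jrM : j r \notin M by apply/negP => /MBP; apply/negP.
  have [a [b [ha hb bM e]]] := jB r.
  have [d hd] := loc _ jrM.
  have aM : a \notin M by rewrite -e; apply: local_idealrM.
  have [|r' r'E] := lift b a d hb ha aM; first by rewrite -e -mulrA hd mulr1.
  by exists r'; apply: jinj; rewrite rmorphM r'E hd rmorph1.
- by move=> r r' /inj/jinj.
- by move=> a ha; have [d dE] := S1D a ha; have [r rE] := lift1 d ltac:(by rewrite dE);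
    exists r; rewrite /= rE.
- move=> r; have [a [b [ha hb bM e]]] := jB r.
  have [a' a'E] := lift1 a ha; have [b' b'E] := lift1 b hb.
  exists a', b'; rewrite /= a'E b'E; split=> //.
    by apply/negP => /MBP; rewrite b'E; apply/negP.
  by apply: jinj; rewrite rmorphM a'E b'E.
Qed.

End Localizes.

Section PolynomialEmbedding.
Variables (k : fieldType) (D : comNzRingType) (M : idealr D).
Notation K := (ratfun k).
Variable iota : {rmorphism D -> K}.

Lemma ex_eval2 (x z : K) : exists e : {rmorphism {poly {poly k}} -> K},
  [/\ forall c, e c%:P%:P = constK c, e 'X%:P = x & e 'X = z].
Proof.
have [c cE] := constK_rmorphism k.
have cfx : commr_rmorph c x by move=> r; apply: mulrC.
have cfz : commr_rmorph (horner_morph cfx) z by move=> r; apply: mulrC.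
exists (horner_morph cfz); split.
- by move=> a; rewrite /= !horner_morphC /= horner_morphC cE.
- by rewrite /= horner_morphC /= horner_morphX.
- by rewrite /= horner_morphX.
Qed.

Lemma eval2_adjoin (e : {rmorphism {poly {poly k}} -> K}) (S : set K) :
  (forall c, e c%:P%:P = constK c) -> is_subalgebra S -> S (e 'X%:P) -> S (e 'X) ->
  forall f, S (e f).
Proof.
move=> eC SS Sx Sz; have S0 := subalgebra0 SS.
apply: (@poly_ind _ (fun f => S (e f))) => [|f c IH]; first by rewrite rmorph0.
rewrite rmorphD rmorphM; apply: (subalgebraD SS); first exact: (subalgebraM SS).
elim/poly_ind: c => [|g c IHg]; first by rewrite !rmorph0.
rewrite polyCD polyCM rmorphD rmorphM; apply: (subalgebraD SS).
  exact: (subalgebraM SS).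
by rewrite eC; apply: subalgebra_const.
Qed.

Lemma adjoin_eval2 (e : {rmorphism {poly {poly k}} -> K}) :
  (forall c, e c%:P%:P = constK c) ->
  forall a, adjoin [:: e 'X%:P; e 'X] a -> exists f, e f = a.
Proof.
move=> eC; apply: adjoin_sub.
  split=> [c|_ _ [c <-] [d <-]|_ _ [c <-] [d <-]].
  - by exists c%:P%:P.
  - by exists (c - d); rewrite rmorphB.
  - by exists (c * d); rewrite rmorphM.
by move=> y; rewrite !inE => /orP[]/eqP ->; [exists 'X%:P | exists 'X].
Qed.

Lemma ciq_regular_point (e : {rmorphism {poly {poly k}} -> K}) :
  (forall c, e c%:P%:P = constK c) -> injective e ->
  localizes (adjoin [:: e 'X%:P; e 'X]) M iota ->
  complete_intersection_quotient (completion M).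
Proof.
move=> eC einj loc; have dom := localizes_domain loc.
have [locM inj SD frac] := loc.
have SS := is_subalgebra_adjoin [:: e 'X%:P; e 'X].
have Se f : adjoin [:: e 'X%:P; e 'X] (e f).
  by apply: eval2_adjoin => //; apply: adjoin_mem; rewrite !inE eqxx ?orbT.
have [theta thetaE] := lift_rmorphism inj (fun f => SD _ (Se f)).
have [d dreg] : exists d, regular_adic d M.
  apply: (regular_adic_localization locM (theta := theta) dom).
    by move=> f f0; apply: einj; rewrite -thetaE f0 !rmorph0.
  move=> d; have [a [b [/(adjoin_eval2 eC)[f fE] /(adjoin_eval2 eC)[g gE] bM h]]] := frac d.
  exists f, g; have -> : theta g = b by apply: inj; rewrite thetaE.
  by split=> //; rewrite h; apply: inj; rewrite thetaE.
exact: ciq_regular dreg.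
Qed.

End PolynomialEmbedding.

(* The local ring [D] equals [B + B y] where [B] is the localization of [S1]. The
   regularity of [B] comes from [Z]: modulo [e Z] every element of [S1] is a
   polynomial in the image of [thetaW]. *)
Section DoublePoint.
Variables (k K : fieldType) (e : {rmorphism {poly {poly k}} -> K}).
Variables (thetaW : {rmorphism {poly k} -> {poly {poly k}}}).
Variables (rho : {rmorphism {poly {poly k}} -> {poly k}}) (Z : {poly {poly k}}).
Variables (S S1 : set K) (y b1 b2 : K).
Variables (D : comNzRingType) (M : idealr D) (iota : {rmorphism D -> K}).

Hypothesis einj : injective e.
Hypothesis loc : localizes S M iota.
Hypothesis SM : forall a b, S a -> S b -> S (a * b).
Hypothesis S1S : forall a, S1 a -> S a.
Hypothesis S11 : S1 1.
Hypothesis S1B : forall a b, S1 a -> S1 b -> S1 (a - b).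
Hypothesis S1M : forall a b, S1 a -> S1 b -> S1 (a * b).
Hypothesis S_sqr : forall a, S a -> S1 (a ^+ 2).
Hypothesis S1theta : forall g, S1 (e (thetaW g)).
Hypothesis S1poly : forall a, S1 a -> exists F, e F = a.
Hypothesis S1mod : forall a, S1 a -> exists g c, S1 c /\ a = e (thetaW g) + e Z * c.
Hypotheses (Z0 : Z != 0) (S1Z : S1 (e Z)) (rhoZ : rho Z = 0).
Hypothesis rho_theta : forall g, rho (thetaW g) = 0 -> g = 0.
Hypothesis ZM : forall d, iota d = e Z -> d \in M.
Hypotheses (Sy : S y) (yb : y ^+ 2 = b1 * b2) (Sb1 : S1 b1) (Sb2 : S1 b2).
Hypotheses (b1M : forall d, iota d = b1 -> d \in M) (b2M : forall d, iota d = b2 -> d \in M).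
Hypothesis free : forall r0 r1, S1 r0 -> S1 r1 -> r0 + r1 * y = 0 -> r1 = 0.
Hypothesis span : forall a, S a -> exists q r0 r1,
  [/\ S1 q, S1 r0, S1 r1, forall d, iota d = q -> d \notin M & q * a = r0 + r1 * y].

Lemma ciq_double_point : complete_intersection_quotient (completion M).
Proof.
have dom := localizes_domain loc; have [locM inj SD frac] := loc.
have S1D a : S1 a -> exists d, iota d = a by move=> /S1S/SD.
have [B [MB [j [locB jM jlift]]]] := ex_sublocal loc S11 S1B S1M S1D.
have [locMB inj' S1B' fracB] := locB.
have domB := localizes_domain locB.
have jinj : injective j by move=> r r' h; apply: inj'; rewrite /= h.
have [theta thetaE] := lift_rmorphism inj' (f := e \o thetaW) (fun g => S1B' _ (S1theta g)).
have [zeta zetaE] := S1B' _ S1Z.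
have zetaM : zeta \in MB by apply/jM/ZM.
have eZ0 : e Z != 0 by apply: contra Z0 => /eqP h; apply/eqP/einj; rewrite h rmorph0.
have [d regB] : exists d, regular_adic d MB.
  have modZ (a : B) : S1 (iota (j a)) -> exists g c,
      S1 (iota (j c)) /\ a = theta g + zeta * c.
    move=> /S1mod[g [c [Sc aE]]]; have [c' c'E] := S1B' _ Sc.
    exists g, c'; rewrite -c'E in Sc; split=> //; apply: inj'.
    by rewrite rmorphD rmorphM thetaE zetaE c'E.
  apply: (regular_adic_curve locMB (theta := theta) (z := zeta) zetaM).
  - move=> a /domB[h|//]; move/eqP: eZ0; case; by rewrite -zetaE h rmorph0.
  - move=> b; have [a [b' [Sa Sb' bM h]]] := fracB b.
    have [f [c [_ aE]]] := modZ _ Sa; have [g [c' [_ bE]]] := modZ _ Sb'.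
    exists f, g, (c - c' * b); split.
      apply: contra bM => gM; rewrite bE rpredD // mulrC; exact: idealMr.
    by apply/eqP; rewrite -subr_eq0; apply/eqP; rewrite -(subrr a) -{1}h aE bE; ring.
  (* With the denominator of [c] cleared, a polynomial in [W] becomes a multiple of [Z]; [rho] kills
     [Z] and is injective on polynomials in [W]. *)
  - move=> f c hf; have [a [b' [Sa Sb' bM h]]] := fracB c.
    have [g [c' [Sc' bE]]] := modZ _ Sb'.
    have [F FE] := S1poly Sa; have [G GE] := S1poly Sc'.
    have key : thetaW (f * g) = Z * (F - thetaW f * G).
      apply: einj; rewrite !(rmorphM, rmorphB) /= FE GE.
      have tE p : e (thetaW p) = iota (j (theta p)) by have := thetaE p.

      rewrite !tE -[e Z]zetaE /= -!(rmorphM, rmorphB) /=; congr (iota (j _)).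
      rewrite rmorphM; have -> : theta g = b' - zeta * c' by rewrite bE addrK.
      by rewrite -h hf; ring.
    have /eqP : f * g = 0.
      by apply: rho_theta; rewrite key rmorphM rhoZ mul0r.
    rewrite mulf_eq0 => /orP[/eqP //|/eqP g0].
    by move: bM; rewrite bE g0 rmorph0 add0r mulrC idealMr.
have [eta etaE] := SD _ Sy.
have [beta1 beta1E] := S1B' _ Sb1; have [beta2 beta2E] := S1B' _ Sb2.
have eta2 : eta ^+ 2 = j (beta1 * beta2).
  by apply: inj; rewrite rmorphXn etaE yb -beta1E -beta2E /= !rmorphM.
have beta1M : beta1 \in MB by apply/jM/b1M.
have beta2M : beta2 \in MB by apply/jM/b2M.
have beta2pow : ideal_pow [set` MB] 2 (beta1 * beta2).
  by apply: ideal_powS_mul => //; apply/ideal_pow1E.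
have etaM : eta \in M.
  apply: contraT => h; have := local_idealrM locM h h.
  rewrite -expr2 eta2 => /negP; case; apply/jM; exact: idealMr.
apply: (ciq_hypersurface regB beta2pow eta2 etaM jM).
- move=> d0; have [a [b [Sa Sb bM h]]] := frac d0.
  (* Writing [d0] as [a * b] over [b * b] moves the denominator into [S1], where squares of sections
     lie. *)
  have [q [r0 [r1 [Sq Sr0 Sr1 qM hq]]]] := span (SM Sa Sb).
  have [q' q'E] := S1D _ Sq.
  have q'M := qM _ q'E.
  have b2S : S1 (iota (b * b)) by rewrite -expr2 rmorphXn; apply: S_sqr.
  have [u0 u0E] := S1D _ Sr0; have [u1 u1E] := S1D _ Sr1.
  have uM : q' * (b * b) \notin M by do 2?apply: local_idealrM.
  have uS : S1 (iota (q' * (b * b))) by rewrite rmorphM q'E; apply: S1M.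
  have [v uv] := locM _ uM.
  have [s0 s0E] := jlift u0 _ (v * u0) ltac:(by rewrite u0E) uS uM ltac:(by rewrite mulrA uv mul1r).
  have [s1 s1E] := jlift u1 _ (v * u1) ltac:(by rewrite u1E) uS uM ltac:(by rewrite mulrA uv mul1r).
  exists s0, s1; rewrite s0E s1E -mulrA -mulrDr.
  have <- : q' * (b * b) * d0 = u0 + u1 * eta.
    by apply: inj; rewrite rmorphD [iota (u1 * _)]rmorphM u0E u1E etaE -hq -q'E -h -!rmorphM; congr (iota _); ring.
  by rewrite mulrA [v * _]mulrC uv mul1r.
(* Multiplying by both denominators gives a relation over [S1], to which [free] applies. *)
- move=> r0 r1 h.
  have [a0 [c0 [Sa0 Sc0 c0M e0]]] := fracB r0.
  have [a1 [c1 [Sa1 Sc1 c1M e1]]] := fracB r1.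
  have notM0 c : c \notin MB -> c != 0 by apply: contra => /eqP ->; apply: rpred0.
  have jc1 : iota (j (c0 * a1)) = 0.
    apply: (free (r0 := iota (j (c1 * a0)))).
    - by rewrite !rmorphM; apply: S1M.
    - by rewrite !rmorphM; apply: S1M.
    rewrite -etaE -rmorphM -rmorphD -e0 -e1.
    rewrite (_ : _ + _ = j (c0 * c1) * (j r0 + j r1 * eta)); first by rewrite h mulr0 rmorph0.
    by rewrite !rmorphM; ring.
  have r10 : r1 = 0.
    have /domB[h0|] : c0 * a1 = 0 by apply: inj'; rewrite /= jc1 !rmorph0.
      by have := notM0 _ c0M; rewrite h0 eqxx.
    by rewrite -e1 => /domB[h1|//]; have := notM0 _ c1M; rewrite h1 eqxx.
  split=> //; apply: jinj; move: h; rewrite r10 !rmorph0 mul0r addr0 => ->; done.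
Qed.

End DoublePoint.

(** * The Jacobian derivation *)

Section Jacobian.
Variables (k : fieldType) (W : {poly {poly k}}).
Implicit Types F G : {poly {poly k}}.

(** The partial derivative in the inner variable [x]; [deriv] is the one in the outer variable
    [z]. *)
Definition inner_deriv F : {poly {poly k}} := map_poly (@deriv k) F.

Lemma inner_derivB F G : inner_deriv (F - G) = inner_deriv F - inner_deriv G.
Proof. by apply/polyP => i; rewrite coefB !coef_map coefB /= derivB. Qed.

Lemma inner_derivD F G : inner_deriv (F + G) = inner_deriv F + inner_deriv G.
Proof. by apply/polyP => i; rewrite coefD !coef_map coefD /= derivD. Qed.

Lemma inner_derivM F G :
  inner_deriv (F * G) = inner_deriv F * G + F * inner_deriv G.
Proof.
apply/polyP => i; rewrite coefD coef_map !coefM /= linear_sum -big_split /=.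
by apply: eq_bigr => j _; rewrite derivM !coef_map.
Qed.

Lemma inner_derivC (c : {poly k}) : inner_deriv c%:P = c^`()%:P.
Proof. exact: map_polyC. Qed.

(* The Jacobian determinant of [(F, W)]: a derivation that vanishes at [W]. *)
Definition jac F := W^`() * inner_deriv F - inner_deriv W * F^`().

Lemma jacB F G : jac (F - G) = jac F - jac G.
Proof. by rewrite /jac inner_derivB derivB; ring. Qed.

Lemma jacM F G : jac (F * G) = jac F * G + F * jac G.
Proof. by rewrite /jac inner_derivM derivM; ring. Qed.

Lemma jacW : jac W = 0.
Proof. by rewrite /jac; ring. Qed.

Lemma jacC (c : k) : jac c%:P%:P = 0.
Proof. by rewrite /jac inner_derivC !derivC !mulr0 subrr. Qed.

Lemma inner_derivXn n : inner_deriv 'X^n = 0.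
Proof.
apply/polyP => i; rewrite coef_map coefXn coef0 /=.
by case: (i == n); rewrite /= ?linear0 // -polyC1 derivC.
Qed.

Lemma poly_char2 (R : nzRingType) (F : {poly {poly R}}) : 2%N \in [pchar R] -> F + F = 0.
Proof.
move=> hR; apply/polyP => i; apply/polyP => j; rewrite !coefD !coef0.
by rewrite -mulr2n -mulr_natr (pcharf0 hR) mulr0.
Qed.

Lemma jac_sqr F : 2%N \in [pchar k] -> jac (F ^+ 2) = 0.
Proof. by move=> hk; rewrite expr2 jacM [jac F * F]mulrC poly_char2. Qed.

End Jacobian.

Lemma sqrD_char2 (R : comNzRingType) (a b : R) : 2%:R = 0 :> R ->
  (a + b) ^+ 2 = a ^+ 2 + b ^+ 2.
Proof. by move=> h; rewrite sqrrD -mulr_natl h mul0r addr0. Qed.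

Lemma mul_mod (R : comNzRingType) (A B Z c d : R) :
  (A + Z * c) * (B + Z * d) = A * B + Z * (A * d + B * c + Z * (c * d)).
Proof. by ring. Qed.

Lemma combine_span (R : comNzRingType) (a b y q p r0 r1 s0 s1 : R) :
  q * a = r0 + r1 * y -> p * b = s0 + s1 * y ->
  q * p * (a + b) = p * r0 + q * s0 + (p * r1 + q * s1) * y.
Proof.
move=> qa pb; rewrite (_ : _ * (a + b) = p * (q * a) + q * (p * b)); last by ring.
by rewrite qa pb; ring.
Qed.

(** * Reduction of a chart along the line to finitely many identities *)

Section DoubleChart.
Variable (k : fieldType).
Notation K := (ratfun k).
Variables (e : {rmorphism {poly {poly k}} -> K}) (W yP Z : {poly {poly k}}).
Variables (rho : {rmorphism {poly {poly k}} -> {poly k}}) (c0 : k) (gC : seq K).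
Variables (b1 b2 : K).
Variables (D : comNzRingType) (M : idealr D) (iota : {rmorphism D -> K}).
Let x := e 'X%:P.
Let z := e 'X.
Let S1 := adjoin [:: x ^+ 2; z ^+ 2; e W].
Let S := pushout_ring (adjoin [:: x; z]) z (adjoin gC).
Hypothesis hk : 2%N \in [pchar k].
Hypothesis eC : forall c, e c%:P%:P = constK c.
Hypothesis einj : injective e.
Hypothesis loc : localizes S M iota.
Hypothesis gCS1 : forall g, g \in gC -> S1 g.
Hypothesis gCX : forall g, g \in gC -> adjoin [:: x; z] g.
Hypothesis S1gen : S (x ^+ 2) /\ S (e W).
Hypotheses (rhoC : forall c, rho c%:P%:P = c%:P) (rhoW : rho W = c0 *: 'X) (c00 : c0 != 0).
Hypotheses (rhoZ : rho Z = 0) (Z0 : Z != 0) (S1Z : S1 (e Z)).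
Hypothesis ZM : forall d, iota d = e Z -> d \in M.
Hypothesis modx : exists (g : {poly k}) c, S1 c /\
  x ^+ 2 = e (map_poly (polyC \o polyC) g).[W] + e Z * c.
Hypothesis modz : exists (g : {poly k}) c, S1 c /\
  z ^+ 2 = e (map_poly (polyC \o polyC) g).[W] + e Z * c.
Hypotheses (Sy : S (e yP)) (yb : e yP ^+ 2 = b1 * b2) (Sb1 : S1 b1) (Sb2 : S1 b2).
Hypotheses (b1M : forall d, iota d = b1 -> d \in M) (b2M : forall d, iota d = b2 -> d \in M).
Hypothesis jac_y : jac W yP != 0.

(** Membership in [B + B y] expressed over [S1]: the factor [q] is a denominator, invertible at the
    point. *)
Definition double_span : set K := [set a | exists q r0 r1,
  [/\ S1 q, S1 r0, S1 r1, forall d, iota d = q -> d \notin M & q * a = r0 + r1 * e yP]].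

Lemma S1_subalgebra : is_subalgebra S1.
Proof. exact: is_subalgebra_adjoin. Qed.

Lemma adjoin_gC a : adjoin gC a -> adjoin [:: x; z] a.
Proof. by apply: adjoin_sub => //; apply: is_subalgebra_adjoin. Qed.

Lemma S_subalgebra : is_subalgebra S.
Proof.
apply: is_subalgebra_pushout_ring; [exact: is_subalgebra_adjoin..|].
exact: adjoin_gC.
Qed.

Lemma S_z2 h : adjoin [:: x; z] h -> S (z ^+ 2 * h).
Proof.
have XS := is_subalgebra_adjoin [:: x; z].
move=> Xh; split.
  apply: (subalgebraM XS _ Xh); apply: (subalgebraX _ XS).
  by apply: adjoin_cons; apply: adjoin_head.
exists 0; first exact: (subalgebra0 (is_subalgebra_adjoin _)).
by exists h; rewrite ?subr0.
Qed.

Lemma S1_sub a : S1 a -> S a.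
Proof.
apply: (adjoin_sub S_subalgebra) => b; rewrite !inE => /or3P[]/eqP ->.
- by have [] := S1gen.
- rewrite -[z ^+ 2]mulr1; apply: S_z2; exact: (subalgebra1 (is_subalgebra_adjoin _)).
- by have [] := S1gen.
Qed.

(** The derivation [jac W] kills the three generators, two of them being squares in characteristic
    2. *)
Lemma S1_jac a : S1 a -> exists F, e F = a /\ jac W F = 0.
Proof.
apply: (@adjoin_sub _ _ [set a | exists F, e F = a /\ jac W F = 0]).
  split=> [c|_ _ [F [<- hF]] [G [<- hG]]|_ _ [F [<- hF]] [G [<- hG]]].
  - by exists c%:P%:P; rewrite eC jacC.
  - by exists (F - G); rewrite rmorphB jacB hF hG subrr.
  - by exists (F * G); rewrite rmorphM jacM hF hG mulr0 mul0r addr0.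
move=> b; rewrite !inE => /or3P[]/eqP ->.
- by exists ('X%:P ^+ 2); rewrite rmorphXn jac_sqr.
- by exists ('X ^+ 2); rewrite rmorphXn jac_sqr.
- by exists W; rewrite jacW.
Qed.

(** Applying [jac W] to the relation leaves [r1] times the nonzero [jac W yP]. *)
Lemma double_free r0 r1 : S1 r0 -> S1 r1 -> r0 + r1 * e yP = 0 -> r1 = 0.
Proof.
move=> /S1_jac[R0 [<- h0]] /S1_jac[R1 [<- h1]].
rewrite -rmorphM -rmorphD -[RHS](rmorph0 e) => /einj h.
have : jac W (R0 + R1 * yP) = 0 by rewrite h -polyC0 -polyC0 jacC.
have jacD F G : jac W (F + G) = jac W F + jac W G.
  by rewrite -{1}[G]opprK jacB -[- G]add0r jacB -polyC0 -polyC0 jacC sub0r opprK.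
rewrite jacD jacM h0 h1 mul0r !add0r => /eqP.
by rewrite mulf_eq0 (negPf jac_y) orbF => /eqP ->; rewrite rmorph0.
Qed.

Lemma double_spanD a b : double_span a -> double_span b -> double_span (a + b).
Proof.
have [locM inj SD _] := loc; have SS := S1_subalgebra.
move=> [q [r0 [r1 [Sq Sr0 Sr1 qM qa]]]] [p [s0 [s1 [Sp Ss0 Ss1 pM pb]]]].
exists (q * p), (p * r0 + q * s0), (p * r1 + q * s1); split.
- exact: (subalgebraM SS Sq Sp).
- exact: (subalgebraD SS (subalgebraM SS Sp Sr0) (subalgebraM SS Sq Ss0)).
- exact: (subalgebraD SS (subalgebraM SS Sp Sr1) (subalgebraM SS Sq Ss1)).
- have [q' q'E] := SD _ (S1_sub Sq); have [p' p'E] := SD _ (S1_sub Sp).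
  rewrite -q'E -p'E -rmorphM => d /inj ->.
  exact: (local_idealrM locM (qM _ q'E) (pM _ p'E)).
- exact: combine_span qa pb.
Qed.

Lemma double_spanM c a : S1 c -> double_span a -> double_span (c * a).
Proof.
have SS := S1_subalgebra.
move=> Sc [q [r0 [r1 [Sq Sr0 Sr1 qM qa]]]].
exists q, (c * r0), (c * r1); split=> //.
- exact: (subalgebraM SS Sc Sr0).
- exact: (subalgebraM SS Sc Sr1).
- by rewrite mulrCA qa mulrDr mulrA.
Qed.

Lemma notin_ideal1 d : iota d = 1 -> d \notin M.
Proof.
have [_ inj _ _] := loc.
by rewrite -(rmorph1 iota) => /inj ->; rewrite idealr1.
Qed.

Lemma double_span1 a : S1 a -> double_span a.
Proof.
move=> Sa; have SS := S1_subalgebra.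
exists 1, a, 0; split=> //; [exact: (subalgebra1 SS)|exact: (subalgebra0 SS)|
  exact: notin_ideal1|by rewrite mul1r mul0r addr0].
Qed.

Lemma double_spany : double_span (e yP).
Proof.
have SS := S1_subalgebra.
exists 1, 0, 1; split=> //; [exact: (subalgebra1 SS)|exact: (subalgebra0 SS)|
  exact: (subalgebra1 SS)|exact: notin_ideal1|by rewrite mul1r add0r].
Qed.

Hypothesis span_x : double_span (z ^+ 2 * x).
Hypothesis span_z : double_span (z ^+ 2 * z).
Hypothesis span_xz : double_span (z ^+ 2 * (x * z)).

(** A section is an element of [k[gC]], which lies in [S1], plus some [z ^+ 2 * h]; the latter needs
    only [h = 1, x, z, xz]. *)
Lemma double_span_all a : S a -> double_span a.
Proof.
have SS := S1_subalgebra.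
have S1z : S1 (z ^+ 2) by apply: adjoin_cons; apply: adjoin_head.
move=> [_ [g Cg [h Xh hE]]]; rewrite -(subrK g a) hE.
apply: double_spanD; last first.
  by apply: double_span1; apply: adjoin_sub Cg.
apply: (quad_span_scale _ _ _ _ _ _ (adjoin_span Xh)) => //.
- exact: double_spanD.
- move=> c b Sc; apply: double_spanM; apply: adjoin_sub Sc => // y.
  rewrite !inE => /orP[]/eqP ->; first exact: adjoin_head.
  by apply: adjoin_cons; apply: adjoin_head.
- exact: double_span1.
Qed.

Lemma ciq_double_chart : complete_intersection_quotient (completion M).
Proof.
have SS := S1_subalgebra; have SSS := S_subalgebra.
have cfW : commr_rmorph (polyC \o polyC) W by move=> r; apply: mulrC.
pose thetaW : {rmorphism {poly k} -> {poly {poly k}}} := horner_morph cfW.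
have thetaC c : thetaW c%:P = c%:P%:P by rewrite /thetaW /= horner_morphC.
have thetaX : thetaW 'X = W by rewrite /thetaW /= horner_morphX.
have S1theta g : S1 (e (thetaW g)).
  apply: (@poly_ind _ (fun g => S1 (e (thetaW g)))) => [|{}g c IH].
    by rewrite !rmorph0; apply: (subalgebra0 SS).
  rewrite !rmorphD !rmorphM thetaC thetaX eC; apply: (subalgebraD SS).
    by apply: (subalgebraM SS) => //; do 2!apply: adjoin_cons; apply: adjoin_head.
  exact: (subalgebra_const c SS).
(* On polynomials in [W], [rho] is the substitution of [c0 *: 'X], injective because [c0] is
   nonzero. *)
have rho_theta g : rho (thetaW g) = g \Po (c0 *: 'X).
  apply: (@poly_ind _ (fun g => rho (thetaW g) = g \Po (c0 *: 'X))) => [|{}g c IH].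
    by rewrite comp_poly0 !rmorph0.
  rewrite comp_polyD comp_polyM comp_polyX comp_polyC -IH.
  by rewrite !rmorphD !rmorphM thetaC thetaX rhoC rhoW.
apply: (@ciq_double_point k K e thetaW rho Z S S1 (e yP) b1 b2 D M iota) => //.
- by move=> a b; apply: (subalgebraM SSS).
- exact: S1_sub.
- exact: (subalgebra1 SS).
- by move=> a b; apply: (subalgebraB SS).
- by move=> a b; apply: (subalgebraM SS).
- move=> a [Xa _]; have := adjoin_sqr hk Xa; apply: adjoin_sub => // y.
  rewrite !inE => /orP[]/eqP ->; first exact: adjoin_head.
  by apply: adjoin_cons; apply: adjoin_head.
- by move=> a /S1_jac[F [FE _]]; exists F.
- apply: (@adjoin_sub _ _ [set a | exists g c, S1 c /\ a = e (thetaW g) + e Z * c]).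
    split.
    + move=> c; exists c%:P, 0; rewrite mulr0 addr0 thetaC eC; split=> //.
      exact: (subalgebra0 SS).
    + move=> _ _ [g [c [Sc ->]]] [g' [c' [Sc' ->]]]; exists (g - g'), (c - c').
      split; first exact: (subalgebraB SS).
      by rewrite mulrBr !rmorphB opprD addrACA.
    + move=> _ _ [g [c [Sc ->]]] [g' [c' [Sc' ->]]].
      exists (g * g'), (e (thetaW g) * c' + e (thetaW g') * c + e Z * (c * c')); split.
        apply: (subalgebraD SS); last by apply: (subalgebraM SS) => //; apply: (subalgebraM SS).
        by apply: (subalgebraD SS); apply: (subalgebraM SS).
      by rewrite !rmorphM; apply: mul_mod.
  move=> b; rewrite !inE => /or3P[]/eqP -> //.
  by exists 'X, 0; rewrite thetaX mulr0 addr0; split=> //; apply: (subalgebra0 SS).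
- move=> g; rewrite rho_theta => /eqP; rewrite comp_poly_eq0 ?size_scale ?size_polyX //.
  by move/eqP.
- exact: double_free.
- exact: double_span_all.
Qed.

End DoubleChart.

(** * Injectivity of the evaluations in the affine charts *)

Section Monomials.
Variable k : fieldType.
Notation K := (ratfun k).

(** Since [(ea, eb)] is injective, no two terms share a monomial, and each [c i j] is a coefficient
    of the sum. *)
Lemma monomials_free (N : nat) (c : nat -> nat -> k) (ea eb : nat -> nat -> nat) :
  (forall i j i' j', (i < N)%N -> (j < N)%N -> (i' < N)%N -> (j' < N)%N ->
     ea i j = ea i' j' -> eb i j = eb i' j' -> i = i' /\ j = j') ->
  \sum_(j < N) \sum_(i < N) constK (c i j) * (uK k ^+ ea i j * vK k ^+ eb i j) = 0 ->
  forall i j, (i < N)%N -> (j < N)%N -> c i j = 0.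
Proof.
move=> eainj sum0 i j iN jN.
pose F : {poly {poly k}} :=
  \sum_(j < N) \sum_(i < N) (c i j *: 'X^(ea i j))%:P * 'X^(eb i j).
have : tofrac F = 0.
  rewrite -[RHS]sum0 rmorph_sum; apply: eq_bigr => j' _.
  rewrite rmorph_sum; apply: eq_bigr => i' _.
  by rewrite -mul_polyC polyCM !rmorphM /= !rmorphXn /= -mulrA.
move/eqP; rewrite tofrac_eq0 => /eqP F0.
have : F`_(eb i j)`_(ea i j) = 0 by rewrite F0 !coef0.
have coefE (a : k) l m n p :
    ((a *: 'X^l)%:P * 'X^m : {poly {poly k}})`_n`_p = a * ((p == l) && (n == m))%:R.
  rewrite coefCM coefXn; case: eqP => _; last by rewrite andbF !mulr0 coef0.
  by rewrite andbT mulr1 coefZ coefXn.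
rewrite /F coef_sum coef_sum (bigD1 (Ordinal jN)) //= [X in _ + X]big1 => [|j' nj].
  rewrite addr0 coef_sum coef_sum (bigD1 (Ordinal iN)) //= [X in _ + X]big1 => [|i' ni].
    by rewrite coefE !eqxx mulr1 addr0.
  rewrite coefE; case: andP => [[/eqP h1 /eqP h2]|_]; last by rewrite mulr0.
  have [e1 _] := eainj _ _ _ _ iN jN (ltn_ord i') jN h1 h2.
  by move: ni; rewrite -val_eqE /= e1 eqxx.
rewrite coef_sum coef_sum big1 // => i' _.
rewrite coefE; case: andP => [[/eqP h1 /eqP h2]|_]; last by rewrite mulr0.
have [_ e2] := eainj _ _ _ _ iN jN (ltn_ord i') (ltn_ord j') h1 h2.
by move: nj; rewrite -val_eqE /= e2 eqxx.
Qed.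

Lemma eval2_sum (e : {rmorphism {poly {poly k}} -> K}) (f : {poly {poly k}}) N :
  (forall c, e c%:P%:P = constK c) ->
  (size f <= N)%N -> (forall j, (size (f`_j)%R <= N)%N) ->
  e f = \sum_(j < N) \sum_(i < N) constK (f`_j`_i) * (e 'X%:P ^+ i * e 'X ^+ j).
Proof.
move=> eC sf sfj.
have polyE (A : nzRingType) (p : {poly A}) : (size p <= N)%N -> p = \sum_(i < N) (p`_i)%:P * 'X^i.
  move=> sp; rewrite -[LHS]coefK poly_def (big_ord_widen N (fun i => p`_i *: 'X^i)) //.
  rewrite big_mkcond; apply: eq_bigr => i _; rewrite mul_polyC; case: ltnP => // h.
  by rewrite nth_default // scale0r.
rewrite {1}(polyE _ f sf) rmorph_sum; apply: eq_bigr => j _.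
rewrite rmorphM rmorphXn {1}(polyE _ f`_j (sfj j)) rmorph_sum rmorph_sum mulr_suml.
apply: eq_bigr => i _.
by rewrite !rmorphM /= !rmorphXn /= eC mulrA.
Qed.

Lemma ex_size_bound (f : {poly {poly k}}) : exists N,
  (size f <= N)%N /\ forall j, (size (f`_j)%R <= N)%N.
Proof.
exists (maxn (size f) (\max_(j < size f) size (f`_j)%R)); rewrite leq_maxl; split=> // j.
have [jl|jl] := ltnP j (size f); last by rewrite nth_default // size_poly0.
by rewrite leq_max (leq_bigmax (Ordinal jl)) orbT.
Qed.

(** The coordinates at infinity have negative exponents; multiplying by [h ^+ (N + N)] turns all
    monomials of degree below [N] in each variable into distinct monomials in [u] and [v]. *)
Lemma eval2_inj (e : {rmorphism {poly {poly k}} -> K}) (h : K)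
    (ea eb : nat -> nat -> nat -> nat) :
  (forall c, e c%:P%:P = constK c) -> 
  (forall N i j, (i < N)%N -> (j < N)%N ->
     h ^+ (N + N) * (e 'X%:P ^+ i * e 'X ^+ j) = uK k ^+ ea N i j * vK k ^+ eb N i j) ->
  (forall N i j i' j', (i < N)%N -> (j < N)%N -> (i' < N)%N -> (j' < N)%N ->
     ea N i j = ea N i' j' -> eb N i j = eb N i' j' -> i = i' /\ j = j') ->
  injective e.
Proof.
move=> eC hmon einj f g /eqP; rewrite -subr_eq0 -rmorphB => /eqP.
have [d dE] : exists d, f - g = d by exists (f - g).
rewrite dE => ed.
suff d0 : d = 0 by apply/eqP; rewrite -subr_eq0 dE d0.
have [N [sd sdj]] := ex_size_bound d.
apply/polyP => j; apply/polyP => i; rewrite !coef0.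
have [jN|jN] := ltnP j N; last by rewrite [d`_j]nth_default ?coef0 // (leq_trans sd).
have [iN|iN] := ltnP i N; last by rewrite nth_default // (leq_trans (sdj j)).
apply: (@monomials_free N (fun i j => d`_j`_i) (ea N) (eb N) _ _ i j iN jN).
  exact: einj.
have := congr1 (fun a => h ^+ (N + N) * a) ed.
rewrite mulr0 (eval2_sum eC sd sdj) => s0; rewrite -[RHS]s0 mulr_sumr; apply: eq_bigr => j' _.
rewrite mulr_sumr; apply: eq_bigr => i' _.
by rewrite [RHS]mulrCA hmon.
Qed.

Lemma vK_neq0 : vK k != 0.
Proof. by rewrite /vK tofrac_eq0 polyX_eq0. Qed.

Lemma mul_expr_inv (F : fieldType) (a b : F) N i j : a != 0 -> (i < N)%N -> (j < N)%N ->
  a ^+ (N + N) * (a^-1 ^+ i * (b * a^-1) ^+ j) = a ^+ (N + N - i - j) * b ^+ j.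
Proof.
move=> a0 iN jN; rewrite {1}(_ : (N + N)%N = (N + N - i - j) + i + j)%N; last by lia.
rewrite !exprD exprMn !exprVn; field.
by rewrite !expf_neq0.
Qed.

Lemma mul_expr_inv2 (F : fieldType) (a b : F) N i j : a != 0 -> (i < N)%N -> (j < N)%N ->
  a ^+ (N + N) * ((b * a^-1) ^+ i * a^-1 ^+ j) = b ^+ i * a ^+ (N + N - i - j).
Proof.
move=> a0 iN jN; rewrite {1}(_ : (N + N)%N = (N + N - i - j) + i + j)%N; last by lia.
rewrite !exprD exprMn !exprVn; field.
by rewrite !expf_neq0.
Qed.

Lemma ex_eval_chart' : exists e : {rmorphism {poly {poly k}} -> K},
  [/\ forall c, e c%:P%:P = constK c, e 'X%:P = (uK k)^-1, e 'X = vK k * (uK k)^-1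
    & injective e].
Proof.
have [e [eC ex ez]] := ex_eval2 (uK k)^-1 (vK k * (uK k)^-1).
exists e; split=> //.
apply: (@eval2_inj e (uK k) (fun N i j => (N + N - i - j)%N) (fun N i j => j) eC).
  by move=> N i j iN jN; rewrite ex ez mul_expr_inv // uK_neq0.
by move=> N i j i' j'; lia.
Qed.

Lemma ex_eval_chart'' : exists e : {rmorphism {poly {poly k}} -> K},
  [/\ forall c, e c%:P%:P = constK c, e 'X%:P = uK k * (vK k)^-1, e 'X = (vK k)^-1
    & injective e].
Proof.
have [e [eC ex ez]] := ex_eval2 (uK k * (vK k)^-1) (vK k)^-1.
exists e; split=> //.
apply: (@eval2_inj e (vK k) (fun N i j => i) (fun N i j => (N + N - i - j)%N) eC).
  by move=> N i j iN jN; rewrite ex ez mul_expr_inv2 // vK_neq0.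
by move=> N i j i' j'; lia.
Qed.

Lemma ex_eval_chart : exists e : {rmorphism {poly {poly k}} -> K},
  [/\ forall c, e c%:P%:P = constK c, e 'X%:P = uK k, e 'X = vK k & injective e].
Proof.
exists (@tofrac {poly {poly k}}); split=> // f g /eqP.
by rewrite tofrac_eq => /eqP.
Qed.

End Monomials.

(* In both charts [z = 0] is the line, [w] is the lift of the generator of the
   coordinate ring of [C] that depends on [P], and [T] contains [x ^ 2], [z ^ 2]
   and [w]. At infinity [y = z ^ 3]; over the cusp [y = z ^ 2 * (x + a2 * z)]. The
   coefficients that are inverted below are units near the line. *)
Section SpanIdentities.
Variables (R : comNzRingType) (T : set R).
Hypothesis T0 : T 0.
Hypothesis TD : forall a b, T a -> T b -> T (a + b).
Hypothesis TB : forall a b, T a -> T b -> T (a - b).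
Hypothesis TM : forall a b, T a -> T b -> T (a * b).
Variables (x z a3 a2 a1 a0 : R).
Hypotheses (T3 : T a3) (T2 : T a2) (Ta1 : T a1) (Ta0 : T a0).
Hypotheses (Ts : T (x ^+ 2)) (Tt : T (z ^+ 2)).

Local Ltac closed := repeat (assumption || apply TB || apply TD || apply TM).

Lemma span_identities_infty w : T w ->
  w = x + z * (a3 + a2 * x + a1 * x ^+ 2 + a0 * x ^+ 3) ->
  exists c d, [/\ T c, T d,
    z ^+ 2 * x = z ^+ 2 * w - d * z ^+ 3 - c * (z ^+ 2 * (x * z)) &
    exists r0 r1, [/\ T r0, T r1 &
      (1 - z ^+ 2 * (c * c)) * (z ^+ 2 * (x * z)) = r0 + r1 * z ^+ 3]].
Proof.
move=> Tw wE; have Ts' := Ts; have Tt' := Tt.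
set s := x ^+ 2 in Ts' *; set t := z ^+ 2 in Tt' *.
(* The odd and even parts of the cubic: [w = x + d z + c x z]. Multiplying by [z^2] and by [z^3]
   gives two relations; eliminating [z^2 x] leaves the factor [1 - z^2 c^2] on [z^2 xz]. *)
exists (a2 + a0 * s), (a3 + a1 * s); split; [by closed|by closed|by rewrite wE /t /s; ring|].
exists (0 - (a3 + a1 * s) * t * t - (a2 + a0 * s) * t * t * w),
  (w + (a2 + a0 * s) * (a3 + a1 * s) * t); split; [by closed|by closed|].
by rewrite wE /t /s; ring.
Qed.

Lemma span_identities_origin w : T w ->
  w = x ^+ 3 + z * (a3 * x ^+ 3 + a2 * x ^+ 2 + a1 * x + a0) ->
  exists g1 g2, [/\ T g1, T g2,
    exists r0 r1, [/\ T r0, T r1 &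
      (a0 * a0 + x ^+ 2 * g1 + z ^+ 2 * g2) * (z ^+ 2 * (x * z)) =
      r0 + r1 * (z ^+ 2 * (x + a2 * z))],
    exists r0 r1 r2, [/\ T r0, T r1, T r2 &
      a0 * (z ^+ 2 * x) = r0 + r1 * (z ^+ 2 * (x + a2 * z)) + r2 * (z ^+ 2 * (x * z))]
    & exists r0 r1 r2, [/\ T r0, T r1, T r2 &
      a0 * (z ^+ 2 * z) = r0 + r1 * (z ^+ 2 * (x + a2 * z)) + r2 * (z ^+ 2 * (x * z))]].
Proof.
move=> Tw wE; have Ts' := Ts; have Tt' := Tt.
set s := x ^+ 2 in Ts' *; set t := z ^+ 2 in Tt' *.
(* Even and odd parts again: [w = s x + c z + d x z]. Since [c - a2 s = a0], substituting
   [z^2 x = y - a2 z^3] in [z^2 w] leaves the coefficient [a0] on [z^3]. *)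
pose c := a2 * s + a0; pose d := a3 * s + a1.
have Tc : T c by rewrite /c; closed.
have Td : T d by rewrite /d; closed.
(* Obtained by expanding [a0 w y] and substituting for [a0 z^2 x] and [a0 z^3] the expressions of
   the last two clauses. *)
exists (a0 * a2 + a0 * a2 - d * d), (a2 * a2 * (d * d)); split; [by closed|by closed| | |].
- exists (0 - a0 * (t * s * s + a2 * c * t * t) - d * s * t * w + d * a2 * a2 * t * t * w),
    (a0 * w + d * s * s - d * a2 * t * c); split; [by closed|by closed|].
  by rewrite wE /d /c /t /s; ring.
- exists (0 - a2 * t * w), c, (a2 * d); split; [by closed|by closed|by closed|].
  by rewrite wE /d /c /t /s; ring.
- exists (t * w), (0 - s), (0 - d); split; [by closed|by closed|by closed|].
  by rewrite wE /d /c /t /s; ring.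
Qed.

End SpanIdentities.

(** * The charts of the surface *)

Section Units.
Variables (k : fieldType) (S : set (ratfun k)) (D : comNzRingType) (M : idealr D).
Variable iota : {rmorphism D -> ratfun k}.
Hypotheses (loc : localizes S M iota) (SS : is_subalgebra S).

Lemma constK_notin c d : c != 0 -> iota d = constK c -> d \notin M.
Proof.
move=> c0 dE; have [_ inj SD _] := loc; have [f fE] := constK_rmorphism k.
have [d' d'E] := SD _ (subalgebra_const c^-1 SS).
have dd' : d * d' = 1.
  by apply: inj; rewrite rmorphM dE d'E -!fE -rmorphM mulfV // !rmorph1.
by apply/negP => dM; have := idealMr d' dM; rewrite mulrC dd' idealr1.
Qed.

(** Adding multiples of elements of the maximal ideal to a unit keeps it a unit; this makes the
    factors in the span identities invertible. *)
Lemma perturb_notin a s t g1 g2 :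
  (forall d, iota d = a -> d \notin M) ->
  (forall d, iota d = s -> d \in M) -> (forall d, iota d = t -> d \in M) ->
  S a -> S s -> S t -> S g1 -> S g2 ->
  forall d, iota d = a + s * g1 + t * g2 -> d \notin M.
Proof.
have [_ inj SD _] := loc => aM sM tM.
move=> /SD[a' a'E] /SD[s' s'E] /SD[t' t'E] /SD[h1 <-] /SD[h2 <-] d.
rewrite -a'E -s'E -t'E -!rmorphM -!rmorphD => /inj ->.
apply: contra (aM _ a'E) => h.
rewrite (_ : a' = a' + s' * h1 + t' * h2 - h1 * s' - h2 * t'); last by ring.
by rewrite !rpredB ?idealMr ?(sM _ s'E) ?(tM _ t'E).
Qed.

End Units.

Lemma map_polyCC_sqr (k : fieldType) (c : k) (W : {poly {poly k}}) :
  (map_poly (polyC \o polyC) (c%:P * 'X^2)).[W] = c%:P%:P * W ^+ 2.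
Proof. by rewrite rmorphM rmorphXn /= map_polyX map_polyC hornerM hornerC hornerXn. Qed.

Lemma sqr_mul_add (R : comNzRingType) (A x z : R) : 2%:R = 0 :> R ->
  (z ^+ 2 * (x + A * z)) ^+ 2 = z ^+ 2 * (z ^+ 2 * (x ^+ 2 + A ^+ 2 * z ^+ 2)).
Proof. by move=> h2; rewrite exprMn (sqrD_char2 _ _ h2); ring. Qed.

(** In characteristic 2, [w^2 = x^6 + z^2 (A^2 + x^2 r^2)]; multiply by [B^2] and solve for
    [z^2]. *)
Lemma sqr_identity (R : comNzRingType) (A B x z w r : R) : 2%:R = 0 :> R -> B * A = 1 ->
  w = x ^+ 3 + z * (A + x * r) ->
  z ^+ 2 = B ^+ 2 * w ^+ 2 + x ^+ 2 * (0 - B ^+ 2 * (x ^+ 2 * x ^+ 2 + r ^+ 2 * z ^+ 2)).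
Proof.
move=> h2 BA ->; rewrite (sqrD_char2 _ _ h2) [(z * _) ^+ 2]exprMn (sqrD_char2 _ _ h2).
rewrite -[LHS]mulr1 -[1](expr1n R 2) -BA; ring.
Qed.

Section Charts.
Variable k : fieldType.
Variables a3 a2 a1 a0 : k.
Hypothesis hk : 2%N \in [pchar k].
Notation K := (ratfun k).
Variables (D : comNzRingType) (M : idealr D) (iota : {rmorphism D -> K}).

Lemma sqrK_add (a b : K) : (a + b) ^+ 2 = a ^+ 2 + b ^+ 2.
Proof. by apply: sqrD_char2; apply: constK2. Qed.

(** The reversed polynomial [x^3 P(1/x)], that is, [P] in the coordinate [x = u^-1] up to the factor
    [u^3]. *)
Definition infty_poly : {poly k} := a3%:P + a2%:P * 'X + a1%:P * 'X^2 + a0%:P * 'X^3.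

(** Up to sign the Jacobian is [z^2] times the derivative of [W] in [x], and that derivative is [1]
    on the line. *)
Lemma jac_infty : jac ('X%:P + 'X * infty_poly%:P) 'X^3 != 0.
Proof.
rewrite /jac inner_derivXn mulr0 sub0r oppr_eq0 derivXn /=.
have -> : ('X^2 *+ 3 : {poly {poly k}}) = 'X^2 by rewrite mulrS mulr2n poly_char2 // addr0.
rewrite mulf_neq0 ?expf_neq0 ?polyX_eq0 //.
apply/eqP => /(congr1 (fun F : {poly {poly k}} => F`_0)).
rewrite coef_map coefD coefC mulrC coefMX addr0 coef0 /= derivX => /eqP.
by rewrite oner_eq0.
Qed.

Lemma ciq_infty : localizes (sectionsV' a3 a2 a1 a0) M iota ->
  (forall d, iota d = (vK k * (uK k)^-1) ^+ 2 -> d \in M) ->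
  complete_intersection_quotient (completion M).
Proof.
have [e [eC ex ez einj]] := ex_eval_chart' k.
pose W : {poly {poly k}} := 'X%:P + 'X * infty_poly%:P.
have eQ : e infty_poly%:P = constK a3 + constK a2 * e 'X%:P + constK a1 * e 'X%:P ^+ 2
    + constK a0 * e 'X%:P ^+ 3.
  by rewrite /infty_poly !(rmorphD, rmorphM, rmorphXn) /= !eC.
have eW : (uK k)^-1 + vK k * uK k ^- 4 * polyK (glueing_poly a3 a2 a1 a0) = e W.
  rewrite rmorphD rmorphM eQ ex ez polyK_glueing; congr (_ + _).
  by apply: mul_cubic_inv; apply: uK_neq0.
rewrite /sectionsV' eW -ez -ex.
set x := e 'X%:P; set z := e 'X; set X := adjoin [:: x; z] => loc zM.
have XX : is_subalgebra X := is_subalgebra_adjoin _.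
have Xe F : X (e F).
  apply: eval2_adjoin => //; first exact: adjoin_head.
  by apply: adjoin_cons; apply: adjoin_head.
pose S1 := adjoin [:: x ^+ 2; z ^+ 2; e W].
have SS : is_subalgebra S1 := is_subalgebra_adjoin _.
have S1x : S1 (x ^+ 2) by apply: adjoin_head.
have S1z : S1 (z ^+ 2) by apply: adjoin_cons; apply: adjoin_head.
have S1w : S1 (e W) by do 2!apply: adjoin_cons; apply: adjoin_head.
have S1sq F : S1 (e F ^+ 2).
  have := adjoin_sqr hk (Xe F); apply: (adjoin_sub SS) => y.
  by rewrite !inE => /orP[]/eqP ->.
(* Squaring [w = x + z Q] in characteristic 2 solves for [x^2] at infinity. *)
have w2 : x ^+ 2 = e W ^+ 2 - z ^+ 2 * e infty_poly%:P ^+ 2.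
  by rewrite rmorphD rmorphM sqrK_add exprMn addrK.
have CX g : g \in [:: e W] -> X g by rewrite inE => /eqP ->.
have CC : is_subalgebra (adjoin [:: e W]) := is_subalgebra_adjoin _.
have Cw : adjoin [:: e W] (e W) by apply: adjoin_head.
have SSS : is_subalgebra (pushout_ring X z (adjoin [:: e W])).
  exact: (is_subalgebra_pushout_ring z XX CC (adjoin_sub XX CX)).
have Sw : pushout_ring X z (adjoin [:: e W]) (e W).
  split=> //; exists (e W) => //; exists 0; first exact: (subalgebra0 XX).
  by rewrite subrr mulr0.
have Sx : pushout_ring X z (adjoin [:: e W]) (x ^+ 2).
  split; first by rewrite -rmorphXn.
  exists (e W ^+ 2); first exact: (subalgebraX _ CC).
  exists (- e infty_poly%:P ^+ 2); first by rewrite -rmorphXn -rmorphN.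
  by rewrite {1}w2 addrAC subrr add0r mulrN.
have Sz h : X h -> pushout_ring X z (adjoin [:: e W]) (z ^+ 2 * h).
  move=> Xh; split; first by apply: (subalgebraM XX); rewrite -?rmorphXn.
  by exists 0; [exact: (subalgebra0 CC) | exists h; rewrite ?subr0].
have z4M d : iota d = z ^+ 2 * z ^+ 2 -> d \in M.
  have [_ inj SD _] := loc.
  have [t tE] := SD _ (Sz 1 (subalgebra1 XX)); rewrite mulr1 in tE.
  by rewrite -tE -rmorphM => /inj ->; rewrite idealMr // zM.
have S1c c : S1 (constK c) by apply: (subalgebra_const c SS).
have eWE : e W = x + z * (constK a3 + constK a2 * x + constK a1 * x ^+ 2 + constK a0 * x ^+ 3).
  by rewrite rmorphD rmorphM eQ.
have hD a b : S1 a -> S1 b -> S1 (a + b) by apply: (subalgebraD SS).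
have hB a b : S1 a -> S1 b -> S1 (a - b) by apply: (subalgebraB SS).
have hM a b : S1 a -> S1 b -> S1 (a * b) by apply: (subalgebraM SS).
have [c [d [Sc Sd idx [r0 [r1 [Sr0 Sr1 idxz]]]]]] := span_identities_infty
  (subalgebra0 SS) hD hB hM
  (S1c a3) (S1c a2) (S1c a1) (S1c a0) S1x S1z S1w eWE.
have e3 : e 'X^3 = z ^+ 3 by rewrite rmorphXn.
have e2 : e 'X^2 = z ^+ 2 by rewrite rmorphXn.
have S_S1 a : S1 a -> pushout_ring X z (adjoin [:: e W]) a.
  apply: (adjoin_sub SSS) => b; rewrite !inE => /or3P[]/eqP -> //.
  by rewrite -[z ^+ 2]mulr1; apply: Sz; apply: (subalgebra1 XX).
pose dspan := double_span e W 'X^3 M iota.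
have dspanM a b : S1 a -> dspan b -> dspan (a * b) by apply: double_spanM.
have dspanD a b : dspan a -> dspan b -> dspan (a + b).
  by apply: (double_spanD loc) => //; split.
have Scc : S1 (0 - c * c) by apply: (hB); [exact: (subalgebra0 SS) | exact: hM].
have span_xz : dspan (z ^+ 2 * (x * z)).
  exists (1 - z ^+ 2 * (c * c)), r0, r1; split=> //; last by rewrite idxz e3.
    by apply: (hB); [exact: (subalgebra1 SS) | apply: (hM) => //; exact: hM].
  have -> : 1 - z ^+ 2 * (c * c) = 1 + z ^+ 2 * (0 - c * c) + z ^+ 2 * 0.
    by rewrite mulr0 addr0 sub0r mulrN.
  apply: (perturb_notin loc) => //.
  - by apply: (notin_ideal1 loc).
  - exact: (subalgebra1 SSS).
  - exact: S_S1.
  - exact: S_S1.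
  - exact: S_S1.
  - exact: (subalgebra0 SSS).
have span_z : dspan (z ^+ 2 * z).
  by rewrite -exprSr -e3; apply: (double_spany W 'X^3 loc).
have span_x : dspan (z ^+ 2 * x).
  have -> : z ^+ 2 * x = z ^+ 2 * e W + (0 - d) * (z ^+ 2 * z) + (0 - c) * (z ^+ 2 * (x * z)).
    by rewrite idx !sub0r !mulNr -exprSr.
  have S1N a : S1 a -> S1 (0 - a) by move=> Sa; apply: (hB) => //; exact: (subalgebra0 SS).
  apply: (dspanD); [apply: dspanD|]; [|apply: (dspanM)|apply: (dspanM)] => //; try exact: S1N.
  by apply: (double_span1 _ loc); apply: (hM).
(* Here [Z = z^2] and [rho] sets [z = 0], where [W] becomes [x], so [c0 = 1]; the square of
   [y = z^3] is split as [z^2] times [z^4]. *)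
apply: (@ciq_double_chart k e W 'X^3 'X^2 (horner_eval (0 : {poly k})) 1 [:: e W]
  (z ^+ 2) (z ^+ 2 * z ^+ 2) D M iota hk eC einj loc).
- by move=> g; rewrite inE => /eqP ->.
- exact: CX.
- by split.
- by move=> a; rewrite /= /horner_eval hornerC.
- by rewrite /= /horner_eval hornerD hornerM hornerX mul0r addr0 hornerC scale1r.
- exact: oner_neq0.
- by rewrite /= /horner_eval hornerXn expr0n.
- by rewrite expf_neq0 // polyX_eq0.
- by rewrite e2.
- by rewrite e2.
- exists 'X^2, (- e infty_poly%:P ^+ 2); split.
    by rewrite -sub0r; apply: (hB); [exact: (subalgebra0 SS) | exact: S1sq].
  by rewrite map_polyXn hornerXn e2 rmorphXn mulrN w2.
- exists 0, 1; split; first exact: (subalgebra1 SS).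
  by rewrite map_poly0 horner0 rmorph0 add0r mulr1 e2.
- by rewrite e3 exprSr; apply: Sz; rewrite /X /z; apply: adjoin_cons; apply: adjoin_head.
- by rewrite e3 -exprM -!exprD.
- exact: S1z.
- exact: hM.
- exact: zM.
- exact: z4M.
- exact: jac_infty.
- exact: span_x.
- exact: span_z.
- exact: span_xz.
Qed.

Definition origin_poly : {poly k} := a1%:P + a2%:P * 'X + a3%:P * 'X^2.

Lemma glueing_poly_split : glueing_poly a3 a2 a1 a0 = a0%:P + 'X * origin_poly.
Proof. by rewrite /glueing_poly /origin_poly -!mul_polyC; ring. Qed.

Notation W0 := ('X%:P ^+ 3 + 'X * (glueing_poly a3 a2 a1 a0)%:P : {poly {poly k}}).
Notation y0 := ('X ^+ 2 * ('X%:P + a2%:P%:P * 'X) : {poly {poly k}}).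

Hypothesis ha0 : a0 != 0.

(** The Jacobian is [z^2] times [P] minus [a2] times the derivative of [W] in [x]; at the origin the
    second factor is [a0]. *)
Lemma jac_origin : jac W0 y0 != 0.
Proof.
set P := glueing_poly _ _ _ _.
have dy : inner_deriv y0 = 'X^2.
  rewrite inner_derivM inner_derivXn mul0r add0r inner_derivD inner_derivC derivX.
  by rewrite inner_derivM inner_derivC derivC mul0r add0r (inner_derivXn k 1) mulr0 addr0 mulr1.
have y' : y0^`() = 'X^2 * a2%:P%:P.
  rewrite derivM derivXn /= mulr2n poly_char2 // mul0r add0r derivD derivC add0r.
  by rewrite derivM derivC mul0r add0r derivX mulr1.
have W' : W0^`() = P%:P.
  by rewrite derivD -polyC_exp derivC add0r derivM derivX derivC mul1r mulr0 addr0.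
have -> : jac W0 y0 = 'X^2 * (P%:P - inner_deriv W0 * a2%:P%:P).
  by rewrite /jac dy y' W'; ring.
rewrite mulf_neq0 ?expf_neq0 ?polyX_eq0 //.
apply/eqP => /(congr1 (fun F : {poly {poly k}} => (F`_0).[0])).
rewrite coefB coefC coefMC coef_map /= coefD -polyC_exp coefC coefXM addr0 /=.
rewrite derivXn coef0 horner0 hornerD hornerN hornerM hornerMn hornerXn expr0n mul0rn mul0r subr0.
rewrite /P glueing_poly_split hornerD hornerM hornerX mul0r addr0 hornerC => /eqP.
by rewrite (negPf ha0).
Qed.

Lemma ciq_origin : localizes (sectionsV a3 a2 a1 a0) M iota ->
  (forall d, iota d = (uK k) ^+ 2 -> d \in M) -> (forall d, iota d = (vK k) ^+ 2 -> d \in M) ->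
  complete_intersection_quotient (completion M).
Proof.
have [e [eC ex ez einj]] := ex_eval_chart k.
have eP : e (glueing_poly a3 a2 a1 a0)%:P = polyK (glueing_poly a3 a2 a1 a0).
  rewrite polyK_glueing /glueing_poly -!mul_polyC.
  by rewrite !(rmorphD, rmorphM, rmorphXn) /= !eC ex.
have ePE : e (glueing_poly a3 a2 a1 a0)%:P = constK a3 * e 'X%:P ^+ 3 + constK a2 * e 'X%:P ^+ 2
    + constK a1 * e 'X%:P + constK a0.
  by rewrite eP polyK_glueing ex.
have eWg (P : {poly k}) : e ('X%:P ^+ 3 + 'X * P%:P) = e 'X%:P ^+ 3 + e 'X * e P%:P.
  by rewrite !(rmorphD, rmorphM, rmorphXn).
have eW : (uK k) ^+ 3 + vK k * polyK (glueing_poly a3 a2 a1 a0) = e W0.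
  by rewrite eWg ex ez eP.
rewrite /sectionsV eW -ez -ex.
have eWE := eWg (glueing_poly a3 a2 a1 a0).
have eyE : e y0 = e 'X ^+ 2 * (e 'X%:P + constK a2 * e 'X).
  by rewrite !(rmorphD, rmorphM, rmorphXn) /= eC.
have rhoW : map_poly (horner_eval (0 : k)) W0 = a0 *: 'X.
  rewrite rmorphD rmorphM !rmorphXn /= map_polyX !map_polyC /= /horner_eval hornerX.
  rewrite expr0n add0r glueing_poly_split hornerD hornerM hornerX mul0r addr0 hornerC.
  by rewrite mulrC mul_polyC.
have eR : e (glueing_poly a3 a2 a1 a0)%:P = constK a0 + e 'X%:P * e origin_poly%:P.
  by rewrite glueing_poly_split !(rmorphD, rmorphM) /= eC.
(* From here on only the recorded properties of [W] and [y] are used. *)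
move: W0 y0 eWE eyE jac_origin rhoW => W yP eWE eyE jac_y rhoW.
set x := e 'X%:P; set z := e 'X; set X := adjoin [:: x; z] => loc sM tM.
have XX : is_subalgebra X := is_subalgebra_adjoin _.
have Xe F : X (e F).
  apply: eval2_adjoin => //; first exact: adjoin_head.
  by apply: adjoin_cons; apply: adjoin_head.
pose S1 := adjoin [:: x ^+ 2; z ^+ 2; e W].
have SS : is_subalgebra S1 := is_subalgebra_adjoin _.
have S1x : S1 (x ^+ 2) by apply: adjoin_head.
have S1z : S1 (z ^+ 2) by apply: adjoin_cons; apply: adjoin_head.
have S1w : S1 (e W) by do 2!apply: adjoin_cons; apply: adjoin_head.
have S1sq F : S1 (e F ^+ 2).
  have := adjoin_sqr hk (Xe F); apply: (adjoin_sub SS) => y.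
  by rewrite !inE => /orP[]/eqP ->; [exact: S1x | exact: S1z].
pose gC := [:: x ^+ 2; e W].
have CX g : g \in gC -> X g.
  by rewrite !inE => /orP[]/eqP ->; [exact: (subalgebraX 2 XX (Xe _)) | exact: Xe].
have CC : is_subalgebra (adjoin gC) := is_subalgebra_adjoin _.
have Cx : adjoin gC (x ^+ 2) by apply: adjoin_head.
have Cw : adjoin gC (e W) by apply: adjoin_cons; apply: adjoin_head.
have SSS : is_subalgebra (pushout_ring X z (adjoin gC)).
  exact: (is_subalgebra_pushout_ring z XX CC (adjoin_sub XX CX)).
have SC g : X g -> adjoin gC g -> pushout_ring X z (adjoin gC) g.
  move=> Xg Cg; split; first exact: Xg.
  exists g; first exact: Cg.
  exists 0; first exact: (subalgebra0 XX).
  by rewrite subrr mulr0.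
have Sw : pushout_ring X z (adjoin gC) (e W) := SC _ (Xe W) Cw.
have Sx : pushout_ring X z (adjoin gC) (x ^+ 2).
  exact: (SC _ (subalgebraX 2 XX (Xe _)) Cx).
have Sz h : X h -> pushout_ring X z (adjoin gC) (z ^+ 2 * h).
  move=> Xh; split; first exact: (subalgebraM XX (subalgebraX 2 XX (Xe _)) Xh).
  by exists 0; [exact: (subalgebra0 CC) | exists h; [exact: Xh | rewrite subr0]].
have S_S1 a : S1 a -> pushout_ring X z (adjoin gC) a.
  apply: (adjoin_sub SSS) => b; rewrite !inE => /or3P[]/eqP ->.
  - exact: Sx.
  - by rewrite -[z ^+ 2]mulr1; apply: (Sz); apply: (subalgebra1 XX).
  - exact: Sw.
have S1c c : S1 (constK c) by apply: (subalgebra_const c SS).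
have hD a b : S1 a -> S1 b -> S1 (a + b) by apply: (subalgebraD SS).
have hB a b : S1 a -> S1 b -> S1 (a - b) by apply: (subalgebraB SS).
have hM a b : S1 a -> S1 b -> S1 (a * b) by apply: (subalgebraM SS).
have [f fE] := constK_rmorphism k.
have inv0 : constK a0^-1 * constK a0 = 1.
  by rewrite -!fE -(rmorphM f) (mulVf ha0) (rmorph1 f).
have eWE' : e W = x ^+ 3 + z * (constK a3 * x ^+ 3 + constK a2 * x ^+ 2 + constK a1 * x + constK a0).
  by rewrite eWE ePE.
have [g1 [g2 [Sg1 Sg2 [r0 [r1 [Sr0 Sr1 idxz]]] [p0 [p1 [p2 [Sp0 Sp1 Sp2 idx]]]]
  [q0 [q1 [q2 [Sq0 Sq1 Sq2 idz]]]]]]] := span_identities_origin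
  (subalgebra0 SS) hD hB hM (S1c a3) (S1c a2) (S1c a1) (S1c a0) S1x S1z S1w eWE'.
rewrite -eyE in idxz idx idz.
pose dspan := double_span e W yP M iota.
have dspanM a b : S1 a -> dspan b -> dspan (a * b) by apply: double_spanM.
have dspanD a b : dspan a -> dspan b -> dspan (a + b).
  by apply: (double_spanD loc); [exact: CX | split; [exact: Sx | exact: Sw]].
have span_y : dspan (e yP) := double_spany W yP loc.
have span_xz : dspan (z ^+ 2 * (x * z)).
  exists (constK a0 * constK a0 + x ^+ 2 * g1 + z ^+ 2 * g2), r0, r1; split.
  - exact: (hD _ _ (hD _ _ (hM _ _ (S1c a0) (S1c a0)) (hM _ _ S1x Sg1)) (hM _ _ S1z Sg2)).
  - exact: Sr0.
  - exact: Sr1.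
  - apply: (perturb_notin loc _ sM tM _ Sx (S_S1 _ S1z) (S_S1 _ Sg1) (S_S1 _ Sg2)).
      move=> d; rewrite -!fE -rmorphM fE; apply: (constK_notin loc SSS).
      by rewrite mulf_neq0.
    by apply: (subalgebraM SSS); apply: (subalgebra_const _ SSS).
  - exact: idxz.
(* As [a0] is a nonzero constant, its inverse lies in [S1], and this division introduces no new
   denominator. *)
have span_comb r s t a : S1 r -> S1 s -> S1 t ->
    constK a0 * a = r + s * e yP + t * (z ^+ 2 * (x * z)) -> dspan a.
  move=> Sr Ss St hE; rewrite -[a]mul1r -inv0 -mulrA hE.
  apply: (dspanM _ _ (S1c _)); apply: (dspanD); last exact: (dspanM _ _ St span_xz).
  by apply: (dspanD); [exact: (double_span1 _ loc Sr) | exact: (dspanM _ _ Ss span_y)].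
have span_x : dspan (z ^+ 2 * x) := span_comb _ _ _ _ Sp0 Sp1 Sp2 idx.
have span_z : dspan (z ^+ 2 * z) := span_comb _ _ _ _ Sq0 Sq1 Sq2 idz.
have eX2 : e ('X%:P ^+ 2) = x ^+ 2 by rewrite rmorphXn.
have Sb : S1 (x ^+ 2 + constK a2 ^+ 2 * z ^+ 2).
  exact: (hD _ _ S1x (hM _ _ (subalgebraX 2 SS (S1c a2)) S1z)).
have Sb2 : S1 (z ^+ 2 * (x ^+ 2 + constK a2 ^+ 2 * z ^+ 2)) := hM _ _ S1z Sb.
(* Here [Z = x^2] and [rho] sets [x = 0], where [W] becomes [a0 z], so [c0 = a0]. *)
apply: (@ciq_double_chart k e W yP ('X%:P ^+ 2) (map_poly (horner_eval (0 : k))) a0 gC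
  (z ^+ 2) (z ^+ 2 * (x ^+ 2 + constK a2 ^+ 2 * z ^+ 2)) D M iota hk eC einj loc).
- by move=> g; rewrite !inE => /orP[]/eqP ->; [exact: S1x | exact: S1w].
- exact: CX.
- by split; [exact: Sx | exact: Sw].
- by move=> a; rewrite /= map_polyC /= /horner_eval hornerC.
- exact: rhoW.
- exact: ha0.
- by rewrite rmorphXn /= map_polyC /= /horner_eval hornerX expr0n.
- by rewrite expf_neq0 // polyC_eq0 polyX_eq0.
- rewrite eX2; exact: S1x.
- rewrite eX2; exact: sM.
- exists 0, 1; split; first exact: (subalgebra1 SS).
  by rewrite map_poly0 horner0 rmorph0 add0r mulr1 eX2.
(* At the cusp [z^2] is the one solved for: modulo [x^2] it is [a0^-2 w^2]. *)
- exists ((a0^-1 ^+ 2)%:P * 'X^2),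
    (0 - constK a0^-1 ^+ 2 * (x ^+ 2 * x ^+ 2 + e origin_poly%:P ^+ 2 * z ^+ 2)); split.
    apply: (hB); first exact: (subalgebra0 SS).
    apply: (hM); first exact: (subalgebraX _ SS).
    exact: (hD _ _ (hM _ _ S1x S1x) (hM _ _ (S1sq _) S1z)).
  rewrite map_polyCC_sqr (rmorphM e) (rmorphXn e) eX2 eC.
  rewrite -[constK (_ ^+ 2)]fE rmorphXn fE.
  by apply: (sqr_identity (constK2 hk) inv0); rewrite -eR.
- rewrite eyE; apply: (Sz); apply: (subalgebraD XX (Xe _)).
  exact: (subalgebraM XX (subalgebra_const _ XX) (Xe _)).
- rewrite eyE; exact: (sqr_mul_add _ _ _ (constK2 hk)).
- exact: S1z.
- exact: Sb2.
- exact: tM.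
- move=> d; have [_ inj SD _] := loc.
  have [t tE] := SD _ (S_S1 _ S1z).
  have [b bE] : exists b, iota b = x ^+ 2 + constK a2 ^+ 2 * z ^+ 2.
    exact: (SD _ (S_S1 _ Sb)).
  by rewrite -bE -tE -rmorphM => /inj ->; rewrite mulrC idealMr ?(tM _ tE).
- exact: jac_y.
- exact: span_x.
- exact: span_z.
- exact: span_xz.
Qed.

End Charts.

(** Each generator at infinity is a generator over the cusp divided by a power of [u^2]; [z^3]
    corresponds to [v^2 * (u * v)] and [z^2 xz] to [v^3]. *)
Lemma chart_change_identities (F : fieldType) (u v P : F) : u != 0 ->
  [/\ u^-1 ^+ 2 = (u ^+ 2)^-1, (v * u^-1) ^+ 2 = v ^+ 2 * (u ^+ 2)^-1,
      (v * u^-1) ^+ 2 * u^-1 = v ^+ 2 * u * (u ^+ 2)^-1 ^+ 2,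
      (v * u^-1) ^+ 2 * (v * u^-1) = v ^+ 2 * (u * v) * (u ^+ 2)^-1 ^+ 2 &
      (v * u^-1) ^+ 2 * (u^-1 * (v * u^-1)) = v ^+ 2 * v * (u ^+ 2)^-1 ^+ 2 /\
      u^-1 + v * u ^- 4 * P = (u ^+ 3 + v * P) * (u ^+ 2)^-1 ^+ 2].
Proof. by move=> u0; split; last split; field. Qed.

Section FinalCharts.
Variable k : fieldType.
Variables a3 a2 a1 a0 : k.
Hypothesis hk : 2%N \in [pchar k].
Notation K := (ratfun k).
Local Notation u := (uK k).
Local Notation v := (vK k).
Local Notation P := (polyK (glueing_poly a3 a2 a1 a0)).

Lemma sectionsV_adjoin f : sectionsV a3 a2 a1 a0 f <->
  adjoin ([:: u ^+ 2; v ^+ 2; v ^+ 2 * u; v ^+ 2 * v; v ^+ 2 * (u * v)]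
    ++ [:: u ^+ 2; u ^+ 3 + v * P]) f.
Proof.
have XX := is_subalgebra_adjoin [:: u; v].
have Xu : adjoin [:: u; v] u by apply: adjoin_head.
have Xv : adjoin [:: u; v] v by apply: adjoin_cons; apply: adjoin_head.
have Xu2 n : adjoin [:: u; v] (u ^+ n) by apply: (subalgebraX _ XX).
apply: (pushout_ring_adjoin (gC := [:: u ^+ 2; u ^+ 3 + v * P])) => [g|].
  rewrite !inE => /orP[]/eqP -> //; apply: (subalgebraD XX) => //.
  apply: (subalgebraM XX) => //; rewrite polyK_glueing.
  do 3?[apply: (subalgebraD XX)]; try apply: (subalgebraM XX) => //;
    exact: (subalgebra_const _ XX).
split=> //; exists (u ^+ 2); first exact: adjoin_head.
by exists 0; [exact: (subalgebra0 XX) | rewrite subrr mulr0].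
Qed.

Lemma sectionsV'_adjoin f : sectionsV' a3 a2 a1 a0 f <->
  adjoin ([:: u^-1 ^+ 2; (v * u^-1) ^+ 2; (v * u^-1) ^+ 2 * u^-1;
    (v * u^-1) ^+ 2 * (v * u^-1); (v * u^-1) ^+ 2 * (u^-1 * (v * u^-1))]
    ++ [:: u^-1 + v * u ^- 4 * P]) f.
Proof.
have XX := is_subalgebra_adjoin [:: u^-1; v * u^-1].
have Xx : adjoin [:: u^-1; v * u^-1] u^-1 by apply: adjoin_head.
have Xz : adjoin [:: u^-1; v * u^-1] (v * u^-1) by apply: adjoin_cons; apply: adjoin_head.
pose Q := constK a3 + constK a2 * u^-1 + constK a1 * u^-1 ^+ 2 + constK a0 * u^-1 ^+ 3.
have XQ : adjoin [:: u^-1; v * u^-1] Q.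
  have Xc c := subalgebra_const c XX.
  have XX' n := subalgebraX n XX Xx.
  by do 3?[apply: (subalgebraD XX)] => //; apply: (subalgebraM XX).
have wE : u^-1 + v * u ^- 4 * P = u^-1 + v * u^-1 * Q.
  by rewrite polyK_glueing mul_cubic_inv // uK_neq0.
rewrite /sectionsV' wE.
apply: (pushout_ring_adjoin (gC := [:: u^-1 + v * u^-1 * Q])) => [g|].
  by rewrite inE => /eqP ->; apply: (subalgebraD XX) => //; apply: (subalgebraM XX).
split; first exact: (subalgebraX _ XX).
(* In characteristic 2, [x^2] agrees on [B] with the square of the generator [w] of the coordinate
   ring of [C]. *)
exists ((u^-1 + v * u^-1 * Q) ^+ 2).
  by apply: (subalgebraX _ (is_subalgebra_adjoin _)); apply: adjoin_head.
exists (0 - Q ^+ 2).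
  by apply: (subalgebraB XX); [exact: (subalgebra0 XX) | exact: (subalgebraX _ XX)].
by rewrite (sqrK_add hk) exprMn opprD addrA subrr !add0r mulrN.
Qed.

Lemma is_subalgebra_eq (S T : set K) : (forall a, S a <-> T a) ->
  is_subalgebra T -> is_subalgebra S.
Proof. by move=> ST; rewrite (_ : S = T) //; apply/seteqP; split=> a /ST. Qed.

Variables (D : comNzRingType) (M : idealr D) (iota : {rmorphism D -> K}).

Lemma range_subalgebra (S : set K) : is_subalgebra S -> localizes S M iota ->
  is_subalgebra [set a | exists d, iota d = a].
Proof.
move=> SS [_ _ SD _]; split=> [c|_ _ [c <-] [d <-]|_ _ [c <-] [d <-]].
- exact: SD (subalgebra_const c SS).
- by exists (c - d); rewrite rmorphB.
- by exists (c * d); rewrite rmorphM.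
Qed.

(* Away from the line, the local rings of [Y] are those of the plane. *)
Lemma localizes_plane (S : set K) (x z : K) t : is_subalgebra S -> localizes S M iota ->
  S `<=` adjoin [:: x; z] -> S (z ^+ 2 * x) -> S (z ^+ 2 * z) ->
  iota t = z ^+ 2 -> t \notin M -> localizes (adjoin [:: x; z]) M iota.
Proof.
move=> SS loc SX Sx Sz tE tM; have [locM inj SD _] := loc.
have [t' tt'] := locM _ tM.
have unit a : S (z ^+ 2 * a) -> exists d, iota d = a.
  move=> /SD[d dE]; exists (d * t').
  by rewrite rmorphM dE -tE mulrAC -rmorphM tt' rmorph1 mul1r.
apply: (localizes_change loc).
- by move=> a b; apply: (subalgebraM (is_subalgebra_adjoin _)).
- apply: (adjoin_sub (range_subalgebra SS loc)) => a.
  by rewrite !inE => /orP[]/eqP ->; apply: unit.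
- move=> a Sa; exists 1; rewrite rmorph1 mul1r idealr1; split=> //; last exact: SX.
  exact: (subalgebra1 (is_subalgebra_adjoin _)).
Qed.

Lemma is_subalgebra_sectionsV : is_subalgebra (sectionsV a3 a2 a1 a0).
Proof. exact: (is_subalgebra_eq sectionsV_adjoin (is_subalgebra_adjoin _)). Qed.

Lemma is_subalgebra_sectionsV' : is_subalgebra (sectionsV' a3 a2 a1 a0).
Proof. exact: (is_subalgebra_eq sectionsV'_adjoin (is_subalgebra_adjoin _)). Qed.

Lemma ciq_sectionsV' : localizes (sectionsV' a3 a2 a1 a0) M iota ->
  complete_intersection_quotient (completion M).
Proof.
move=> loc; have [locM inj SD _] := loc.
have SS := is_subalgebra_sectionsV'.
have Sz2 : sectionsV' a3 a2 a1 a0 ((v * u^-1) ^+ 2).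
  by apply/sectionsV'_adjoin; do 1!apply: adjoin_cons; apply: adjoin_head.
have [t tE] := SD _ Sz2.
have [tM|tM] := boolP (t \in M).
  by apply: (ciq_infty hk loc) => d; rewrite -tE => /inj ->.
have [e [eC ex ez einj]] := ex_eval_chart' k.
apply: (ciq_regular_point eC einj (iota := iota)); rewrite ex ez.
apply: (localizes_plane SS loc _ _ _ tE tM).
- by move=> f [].
- by apply/sectionsV'_adjoin; do 2!apply: adjoin_cons; apply: adjoin_head.
- by apply/sectionsV'_adjoin; do 3!apply: adjoin_cons; apply: adjoin_head.
Qed.

Lemma ciq_sectionsV'' : localizes (sectionsV'' (k := k)) M iota ->
  complete_intersection_quotient (completion M).
Proof.
move=> loc; have [e [eC ex ez einj]] := ex_eval_chart'' k.
by apply: (ciq_regular_point eC einj (iota := iota)); rewrite ex ez.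
Qed.

Hypothesis ha0 : a0 != 0.

(** Where [u^2] is a unit, the point also lies in the chart at infinity: the generators of each
    chart enter the other after multiplication by powers of [u^-2]. *)
Lemma localizes_sectionsV' s : localizes (sectionsV a3 a2 a1 a0) M iota ->
  iota s = u ^+ 2 -> s \notin M -> localizes (sectionsV' a3 a2 a1 a0) M iota.
Proof.
move=> loc sE sM; have [locM inj SD _] := loc.
have SS := is_subalgebra_sectionsV; have SS' := is_subalgebra_sectionsV'.
have u0 := uK_neq0 k; have u20 : u ^+ 2 != 0 by rewrite expf_neq0.
have [s' ss'] := locM _ sM.
have s'E : iota s' = (u ^+ 2)^-1.
  by apply: (mulfI u20); rewrite -{1}sE -rmorphM ss' rmorph1 mulfV.
have s'M : s' \notin M.
  by apply/negP => h; have := idealMr s h; rewrite ss' idealr1.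
have [i1 i2 i3 i4 [i5 i6]] := chart_change_identities v P u0.
have RR := range_subalgebra SS loc.
have SR a : sectionsV a3 a2 a1 a0 a -> exists d, iota d = a * (u ^+ 2)^-1 ^+ 2.
  by move=> /SD[d <-]; exists (d * s' ^+ 2); rewrite rmorphM rmorphXn s'E.
have Sv2 : sectionsV a3 a2 a1 a0 (v ^+ 2).
  by apply/sectionsV_adjoin; do 1!apply: adjoin_cons; apply: adjoin_head.
have Sv2u : sectionsV a3 a2 a1 a0 (v ^+ 2 * u).
  by apply/sectionsV_adjoin; do 2!apply: adjoin_cons; apply: adjoin_head.
have Sv3 : sectionsV a3 a2 a1 a0 (v ^+ 2 * v).
  by apply/sectionsV_adjoin; do 3!apply: adjoin_cons; apply: adjoin_head.
have Sv3u : sectionsV a3 a2 a1 a0 (v ^+ 2 * (u * v)).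
  by apply/sectionsV_adjoin; do 4!apply: adjoin_cons; apply: adjoin_head.
have Sw : sectionsV a3 a2 a1 a0 (u ^+ 3 + v * P).
  by apply/sectionsV_adjoin; do 6!apply: adjoin_cons; apply: adjoin_head.
have Sx2' : sectionsV' a3 a2 a1 a0 (u ^+ 2)^-1.
  by rewrite -i1; apply/sectionsV'_adjoin; apply: adjoin_head.
have Sz2' : sectionsV' a3 a2 a1 a0 (v ^+ 2 * (u ^+ 2)^-1).
  by rewrite -i2; apply/sectionsV'_adjoin; do 1!apply: adjoin_cons; apply: adjoin_head.
have Sz2x' : sectionsV' a3 a2 a1 a0 (v ^+ 2 * u * (u ^+ 2)^-1 ^+ 2).
  by rewrite -i3; apply/sectionsV'_adjoin; do 2!apply: adjoin_cons; apply: adjoin_head.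
have Sz3' : sectionsV' a3 a2 a1 a0 (v ^+ 2 * (u * v) * (u ^+ 2)^-1 ^+ 2).
  by rewrite -i4; apply/sectionsV'_adjoin; do 3!apply: adjoin_cons; apply: adjoin_head.
have Sz3x' : sectionsV' a3 a2 a1 a0 (v ^+ 2 * v * (u ^+ 2)^-1 ^+ 2).
  by rewrite -i5; apply/sectionsV'_adjoin; do 4!apply: adjoin_cons; apply: adjoin_head.
have Sw' : sectionsV' a3 a2 a1 a0 ((u ^+ 3 + v * P) * (u ^+ 2)^-1 ^+ 2).
  by rewrite -i6; apply/sectionsV'_adjoin; do 5!apply: adjoin_cons; apply: adjoin_head.
apply: (localizes_change loc).
- by move=> a b; apply: (subalgebraM SS').
- move=> a /sectionsV'_adjoin; apply: (adjoin_sub RR) => b; rewrite !inE.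
  move=> /or4P[/eqP ->|/eqP ->|/eqP ->|/or3P[]/eqP ->].
  + by exists s'; rewrite i1.
  + by have [t tE] := SD _ Sv2; exists (t * s'); rewrite i2 rmorphM tE s'E.
  + by rewrite i3; apply: SR.
  + by rewrite i4; apply: SR.
  + by rewrite i5; apply: SR.
  + by rewrite i6; apply: SR.
(* The elements that a unit denominator brings into the chart at infinity form a subalgebra, so
   generators suffice. *)
- pose T a := exists b, [/\ b \notin M, sectionsV' a3 a2 a1 a0 (iota b)
    & sectionsV' a3 a2 a1 a0 (iota b * a)].
  have T1 a : sectionsV' a3 a2 a1 a0 (a * (u ^+ 2)^-1) -> T a.
    by move=> h; exists s'; rewrite s'E mulrC.
  have T2 a : sectionsV' a3 a2 a1 a0 (a * (u ^+ 2)^-1 ^+ 2) -> T a.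
    move=> h; exists (s' ^+ 2); rewrite rmorphXn s'E mulrC; split=> //.
      by rewrite expr2; apply: local_idealrM.
    exact: (subalgebraX _ SS').
  move=> a /sectionsV_adjoin; apply: (@adjoin_sub _ _ T).
    split=> [c|a' b [m [mM Sm Sma]] [n [nM Sn Snb]]|a' b [m [mM Sm Sma]] [n [nM Sn Snb]]].
    + exists 1; rewrite rmorph1 mul1r idealr1; split=> //; first exact: (subalgebra1 SS').
      exact: (subalgebra_const c SS').
    + exists (m * n); rewrite rmorphM mulrBr; split; first exact: local_idealrM.
        exact: (subalgebraM SS').
      rewrite mulrAC -[iota m * _ * b]mulrA [_ * (_ * b)]mulrC [iota m * a' * _]mulrC.
      by apply: (subalgebraB SS'); [|rewrite mulrC]; apply: (subalgebraM SS').
    + exists (m * n); rewrite rmorphM mulrACA; split; first exact: local_idealrM.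
        exact: (subalgebraM SS').
      exact: (subalgebraM SS').
  move=> b; rewrite !inE.
  have Tu : T (u ^+ 2) by apply: T1; rewrite mulfV //; exact: (subalgebra1 SS').
  move=> /or4P[/eqP -> //|/eqP ->|/eqP ->|/or4P[/eqP ->|/eqP ->|/eqP -> //|/eqP ->]].
  + exact: T1.
  + exact: T2.
  + exact: T2.
  + exact: T2.
  + exact: T2.
Qed.

(** Three kinds of points: off the line the stalk is that of the plane; at the cusp [u^2] and [v^2]
    both lie in the maximal ideal; elsewhere on the line [u^2] is a unit and the chart at infinity
    applies. *)
Lemma ciq_sectionsV : localizes (sectionsV a3 a2 a1 a0) M iota ->
  complete_intersection_quotient (completion M).
Proof.
move=> loc; have [locM inj SD _] := loc.
have SS := is_subalgebra_sectionsV.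
have Sv2 : sectionsV a3 a2 a1 a0 (v ^+ 2).
  by apply/sectionsV_adjoin; do 1!apply: adjoin_cons; apply: adjoin_head.
have Su2 : sectionsV a3 a2 a1 a0 (u ^+ 2).
  by apply/sectionsV_adjoin; apply: adjoin_head.
have [t tE] := SD _ Sv2; have [s sE] := SD _ Su2.
have [tM|tM] := boolP (t \in M); last first.
  have [e [eC ex ez einj]] := ex_eval_chart k.
  apply: (ciq_regular_point eC einj (iota := iota)); rewrite ex ez.
  apply: (localizes_plane SS loc _ _ _ tE tM).
  - by move=> f [].
  - by apply/sectionsV_adjoin; do 2!apply: adjoin_cons; apply: adjoin_head.
  - by apply/sectionsV_adjoin; do 3!apply: adjoin_cons; apply: adjoin_head.
have [sM|sM] := boolP (s \in M).
  by apply: (ciq_origin hk ha0 loc) => d; rewrite -?tE -?sE => /inj ->.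
exact: ciq_sectionsV' (localizes_sectionsV' loc sE sM).
Qed.

End FinalCharts.

Lemma localizes_asbool (K : fieldType) (S : set K) (A : subringClosed K)
    (p : prime_idealr (subring_of A)) : (forall x, x \in A <-> S x) ->
  localizes S (local_max p) (val : {rmorphism local_ring p -> K}).
Proof.
move=> AS; have := localizes_local_ring p.
by rewrite (_ : [set x | x \in A] = S) //; apply/seteqP; split=> x /AS.
Qed.

Theorem theorem3p3 (k : fieldType) (a3 a2 a1 a0 : k)
  (hk : 2%N \in [pchar k]) (ha0 : a0 != 0) :
  locally_complete_intersection (surfaceY a3 a2 a1 a0).
Proof.
have VE x : x \in surfaceY a3 a2 a1 a0 IndexV <-> sectionsV a3 a2 a1 a0 x.
  by split=> /asboolP.
have V'E x : x \in surfaceY a3 a2 a1 a0 IndexV' <-> sectionsV' a3 a2 a1 a0 x.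
  by split=> /asboolP.
have V''E x : x \in surfaceY a3 a2 a1 a0 IndexV'' <-> sectionsV'' x.
  by split=> /asboolP.
split.
  case.
  - exact: (noetherian_adjoin (fun x => iff_trans (VE x) (@sectionsV_adjoin k a3 a2 a1 a0 x))).
  - exact: (noetherian_adjoin (fun x => iff_trans (V'E x) (@sectionsV'_adjoin k a3 a2 a1 a0 hk x))).
  - exact: (noetherian_adjoin V''E).
case=> p.
- exact: (ciq_sectionsV hk ha0 (localizes_asbool p VE)).
- exact: (ciq_sectionsV' hk (localizes_asbool p V'E)).
- exact: (ciq_sectionsV'' (localizes_asbool p V''E)).
Qed.
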